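(* Let $L$ be a self-adjoint operator in a separable complex Hilbert space $\mathcal H$ with $\langle Lu,u\rangle\ge0$ for all $u$ in its domain and $(L+I)^{-1}\in\mathcal B^p(\mathcal H)$ for some $p\ge1$. Assume that the heat trace has an asymptotic expansion $$\operatorname{tr}(e^{-tL})\sim\sum_{\alpha\in\mathcal A}\sum_{k=0}^{k_\alpha}A^H_{\alpha k}(L)\,t^\alpha\log^kt,\qquad t\to0+,$$ where $\mathcal A\subset\mathbb C$ is discrete, has finite intersection with each finite vertical strip, and $+\infty$ is the only accumulation point of $\operatorname{Re}\alpha$, $\alpha\in\mathcal A$. Assume further that $A^H_{\alpha k}(L)=0$ whenever $-\alpha\in\mathbb Z_+$ and $k>0$. Then $\log\det_\zeta(L+z)$ has the following asymptotic expansion as $\operatorname{Re}z\to\infty$: $$\begin{aligned}\log\det\nolimits_\zeta(L+z)\sim{}&-\sum_{\substack{\alpha,k\\-\alpha\notin\mathbb Z_+}}(-1)^k\sum_{j\ge k}A^H_{\alpha j}(L)\binom jk\,(\operatorname{Pf}\partial^{j-k}\Gamma)(\alpha)\,z^{-\alpha}\log^kz\\&+A^H_{00}(L)\log z+\sum_{n=1}^\infty A^H_{-n,0}(L)\,(\operatorname{Res}_{-n}\Gamma)\bigl(z^n\log z-L_n z^n\bigr),\end{aligned}$$ where $L_n=\sum_{j=1}^n\frac1j$.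
   Context: $\mathbb Z_+=\{0,1,2,\dots\}$; $\mathcal B^p(\mathcal H)$ is the Schatten class of order $p$; $A^H_{\alpha k}(L):=0$ for all pairs $(\alpha,k)$ not occurring in the heat expansion. For $\operatorname{Re}z>0$, $\zeta(s;L+z)=\sum_{\lambda\in\operatorname{spec}L}(\lambda+z)^{-s}$ (eigenvalues with multiplicity, principal branch) for $\operatorname{Re}s>p$, continued meromorphically in $s$; under the hypotheses it is regular at $s=0$, and $\log\det_\zeta(L+z):=-\partial_s\zeta(s;L+z)|_{s=0}$. $\log z$, $z^{-\alpha}$ are principal branches. $(\operatorname{Pf}F)(a)$ is the constant term and $\operatorname{Res}_aF$ the residue in the Laurent expansion of a meromorphic function $F$ at $a$; $\partial^mF$ is the $m$-th derivative. The numbers $L_n$ are not to be confused with the operator $L$. The asymptotic expansion in terms $z^{-\alpha}\log^kz$ means: for every $K>0$ the difference between the function and the finite sum of all terms with $\operatorname{Re}\alpha\le K$ is $O((\operatorname{Re}z)^{-K})$ as $\operatorname{Re}z\to\infty$. *)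

(* Defs.v *)
From HB Require Import structures.
From mathcomp Require Import all_boot all_order all_algebra finmap.
From mathcomp Require Import all_classical all_reals all_analysis.
From mathcomp Require Import complex.
From mathcomp.analysis.showcase Require summability.

Set Implicit Arguments.
Unset Strict Implicit.
Unset Printing Implicit Defensive.
Import Order.TTheory GRing.Theory Num.Theory.
Import numFieldTopology.Exports numFieldNormedType.Exports.

Local Open Scope classical_set_scope.
Local Open Scope ring_scope.
Local Open Scope complex_scope.

(* MathComp-Analysis puts the norm topology on an abstract numClosedFieldType,
   but instance resolution does not find it for the concrete field R[i]. *)
HB.instance Definition _ (R : realType) := NormedModule.copy R[i] R[i]^o.

Section ComplexFunctions.
Variable R : realType.
Local Notation C := R[i].
Implicit Types (z s a : C) (F : C -> C).

Definition cexp z : C :=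
  (expR (complex.Re z) * cos (complex.Im z)) +i*
  (expR (complex.Re z) * sin (complex.Im z)).

(* Principal argument, with values in ]-pi, pi]; only meaningful for z != 0. *)
Definition carg z : R :=
  let theta := acos (complex.Re z / complex.Re `|z|) in
  if 0 <= complex.Im z then theta else - theta.

Definition clog z : C := ln (complex.Re `|z|) +i* carg z.

Definition cpow z a : C := cexp (a * clog z).

(* F(s) = sum_(m >= -N) c_m (s - a)^m in a punctured neighbourhood of a; the
   value F a is irrelevant. *)
Definition laurent_expansion F a (c : int -> C) : Prop :=
  exists N : nat, (forall m : int, m < - N%:Z -> c m = 0) /\
    \forall s \near a^',
      series (fun k : nat => c (k%:Z - N%:Z) * (s - a) ^ (k%:Z - N%:Z)) n
        @[n --> \oo] --> F s.

Definition laurent_coef F a : int -> C :=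
  xget (fun=> 0) [set c | laurent_expansion F a c].

Definition Pf F a : C := laurent_coef F a 0.
Definition Res F a : C := laurent_coef F a (-1).

Definition regular_at F a : Prop :=
  exists c, [/\ laurent_expansion F a c, forall m : int, m < 0 -> c m = 0
              & F a = c 0].

(* Meromorphic on the whole plane. The value of F at a pole is irrelevant, but
   a removable singularity has to carry the right value. *)
Definition meromorphic F : Prop :=
  forall a, exists c, laurent_expansion F a c /\
    ((forall m : int, m < 0 -> c m = 0) -> F a = c 0).

Definition cintegral (D : set R) (f : R -> C) : C :=
  (\int[lebesgue_measure]_(t in D) complex.Re (f t)) +i*
  (\int[lebesgue_measure]_(t in D) complex.Im (f t)).

Definition euler_integral s : C :=
  cintegral `]0, +oo[ (fun t => cpow t%:C (s - 1) * (expR (- t))%:C).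

(* Euler's integral, continued by Gamma(s) = Gamma(s + n) / (s ... (s + n - 1))
   with n such that Re s + n > 0. The value at the poles 0, -1, ... is junk. *)
Definition Gamma s : C :=
  let n := (Num.truncn (- complex.Re s)).+1 in
  euler_integral (s + n%:R) / \prod_(i < n) (s + i%:R).

Definition is_Zplus z : Prop := exists n : nat, z = n%:R.

End ComplexFunctions.

Section Hilbert.
Variables (R : realType).
Local Notation C := R[i].

(* A Hilbert space is a complete normed space over C whose norm is induced by an
   inner product, taken linear in the first argument. *)
Record inner_product (H : normedModType C) := InnerProduct {
  inner :> H -> H -> C;
  inner_linear : forall (a : C) u v w,
    inner (a *: u + v) w = a * inner u w + inner v w;
  inner_conj : forall u v, inner v u = Num.conj (inner u v);
  inner_norm : forall u, inner u u = `|u| ^+ 2 }.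

Definition separable (T : topologicalType) : Prop :=
  exists S : set T, countable S /\ dense S.

(* Values of an operator outside of its domain are irrelevant. *)
Record operator (H : lmodType C) := Operator {
  dom : set H;
  app :> H -> H;
  dom0 : dom 0;
  dom_linear : forall (a : C) u v, dom u -> dom v -> dom (a *: u + v);
  app_linear : forall (a : C) u v, dom u -> dom v ->
    app (a *: u + v) = a *: app u + app v }.

Variables (H : normedModType C) (ip : inner_product H).
Implicit Types (L : operator H) (T : H -> H).

(* Densely defined, and L^* = L as graphs. *)
Definition self_adjoint L : Prop :=
  dense (dom L) /\
  forall v w, (forall u, dom L u -> ip (L u) v = ip u w) <->
              (dom L v /\ L v = w).

Definition nonneg_operator L : Prop := forall u, dom L u -> 0 <= ip (L u) u.

(* The dimension of a finite-dimensional subspace (0 if V is not one). *)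
Definition vdim (V : set H) : nat :=
  xget 0%N [set n | exists b : 'I_n -> H,
    (forall c : 'I_n -> C, \sum_i c i *: b i = 0 -> forall i, c i = 0) /\
    V = [set \sum_i c i *: b i | c in [set: 'I_n -> C]]].

Definition eigenspace (D : set H) T (l : C) : set H :=
  [set u | D u /\ T u = l *: u].

(* T is compact and its singular values, i.e. the mu > 0 such that mu ^ 2 is an
   eigenvalue of T^* T, are p-summable when counted with multiplicity. *)
Definition schatten (p : R) T : Prop :=
  exists Tadj : H -> H,
  [/\ forall (a : C) u v, T (a *: u + v) = a *: T u + T v,
      forall u v, ip (T u) v = ip u (Tadj v),
      precompact (T @` [set u | `|u| <= 1]) &
      (\esum_(mu in [set mu : R | (0 < mu)%R])
         ((vdim (eigenspace setT (Tadj \o T) (mu ^+ 2)%:C))%:R * mu `^ p)%:E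
       < +oo)%E].

(* (L + I)^-1 exists as an everywhere defined operator and is in B^p. *)
Definition inverse_in_schatten L (p : R) : Prop :=
  exists T : H -> H,
  [/\ forall v, dom L (T v) /\ L (T v) + T v = v,
      forall u, dom L u -> T (L u + u) = u &
      schatten p T].

Definition orthonormal_basis (B : set H) : Prop :=
  (forall u v, B u -> B v -> ip u v = (u == v)%:R) /\
  (forall w, (forall u, B u -> ip w u = 0) -> w = 0).

(* The common value, over all orthonormal bases B, of the unordered sum of
   <T u, u>, u in B. *)
Definition trace T : C :=
  xget 0 [set tau | forall B, orthonormal_basis B ->
    summability.partial_sum (fun u : H => (u \in B)%:R * ip (T u) u) J
      @[J --> summability.totally] --> tau].

(* (I + s L)^-1 u *)
Definition resolvent L (s : R) (u : H) : H :=
  xget 0 [set v | dom L v /\ v + s%:C *: L v = u].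

(* e^(- t L) u = lim_n (I + (t / n) L)^(- n) u, which makes sense for unbounded
   L >= 0 (unlike the exponential series). *)
Definition heat_op L (t : R) (u : H) : H :=
  lim (iter n (resolvent L (t / n%:R)) u @[n --> \oo]).

Definition heat_trace L (t : R) : C := trace (heat_op L t).

(* Unordered sum over the eigenvalues; it converges for Re s > p when
   (L + I)^-1 is in B^p. *)
Definition zeta_series L (z s : C) : C :=
  summability.sum (fun l : C =>
    (vdim (eigenspace (dom L) L l))%:R * cpow (l + z) (- s)).

Definition zeta_continuation L (p : R) (z : C) (F : C -> C) : Prop :=
  meromorphic F /\
  forall s : C, p < complex.Re s -> F s = zeta_series L z s.

Definition zeta L (p : R) (z : C) : C -> C :=
  xget (fun=> 0) [set F | zeta_continuation L p z F].

Definition log_det L (p : R) (z : C) : C := - derive1 (zeta L p z) 0.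

End Hilbert.

Section Expansions.
Variable R : realType.
Local Notation C := R[i].

Definition admissible_exponents (calA : set C) : Prop :=
  [/\ calA `<=` isolated calA,
      forall a b : R, finite_set [set al | calA al /\ a <= complex.Re al <= b] &
      limit_point [set (complex.Re al)%:E | al in calA] `<=` [set +oo%E]].

(* theta(t) ~ sum_(al in calA) sum_(k <= kmax al) coef al k t^al log^k t,
   as t -> 0+. *)
Definition heat_expansion (theta : R -> C) (calA : set C) (kmax : C -> nat)
    (coef : C -> nat -> C) : Prop :=
  forall K : R, 0 < K -> exists M : R, \forall t \near 0^'+,
    `| theta t -
       \sum_(al \in [set al | calA al /\ complex.Re al <= K])
         \sum_(k < (kmax al).+1) coef al k * cpow t%:C al * (ln t)%:C ^+ k |
    <= (M * t `^ K)%:C.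

End Expansions.

(* Main.v *)
(* For Re z > 0 and Re s > p, Gamma(s) zeta(s; L + z) is the Mellin transform of
   tr(e^(-tL)) e^(-tz). Split tr(e^(-tL)) into the heat terms t^alpha log^k t with
   Re alpha <= K and a remainder rho_K = O(t^K). The Mellin transform of a heat term times
   e^(-tz) is the k-th derivative of w |-> Gamma(w) z^(-w) at s + alpha, which is meromorphic,
   while that of rho_K(t) e^(-tz) is analytic for Re s > -K; this continues the zeta function.
   Since 1/Gamma vanishes to first order at 0, the derivative at s = 0 is computed term by term:
   an alpha with -alpha not in Z_+ contributes by Leibniz' rule, an alpha = -n contributes
   through Gamma(s - n) / Gamma(s) = 1 / ((s - 1) ... (s - n)), whose logarithmic derivative
   at 0 is the harmonic number L_n, and rho_K contributes exactly its Mellin transform at 0,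
   which is O((Re z)^(-K)). Two continuations agree by the identity
   theorem along segments.

   On the operator side, T = (L + I)^(-1) is a compact positive injective operator, hence has an
   orthonormal basis of eigenvectors. In this basis the resolvents of L and thus e^(-tL) are
   diagonal, and Parseval's identity for two orthonormal bases identifies the trace with
   the sum of the e^(-t lambda). The Schatten condition says that the sum of the
   (1 + lambda)^(-p) is finite. *)
Require Import Defs.
From HB Require Import structures.
From mathcomp Require Import all_boot all_order all_algebra finmap.
From mathcomp Require Import all_classical all_reals all_analysis.
From mathcomp Require Import measurable_realfun complex ring lra zify.
From mathcomp.analysis.showcase Require summability.
Set Implicit Arguments.
Unset Strict Implicit.
Unset Printing Implicit Defensive.
Import Order.TTheory GRing.Theory Num.Theory.
Import numFieldTopology.Exports numFieldNormedType.Exports.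
Local Open Scope classical_set_scope.
Local Open Scope ring_scope.
Local Open Scope complex_scope.

(** All complex analysis is done with power series: [has_ps] takes the place of complex
    differentiability, and no contour integral occurs. This forces some detours. The Mellin
    transform of e^(-tz) at complex z is found from a differential equation along the segment from 1
    to z instead of a rotated contour. That Gamma has no zeros, without which 1/Gamma would not be
    entire, comes from an explicit estimate far to the right combined with the functional equation.
    Values at poles are arbitrary, so meromorphic functions are compared on punctured discs by
    [near_eq]; a value is read off only at the end, through [Pf] or through the clause on removable
    singularities in [meromorphic]. Since [zeta] is a choice among continuations, the statements at
    s = 0 concern every continuation. The bounds depend on Re z alone because |e^(-tz)| = e^(-t Re
    z); this is what makes them uniform in Im z. *)

Notation cmod := ComplexField.Normc.normc.
Arguments ComplexField.Normc.normc : simpl never.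

(** * Complex sequences and series *)

Section ComplexModulus.
Variable R : realType.
Local Notation C := R[i].
Implicit Types z w : C.

Lemma normr_cmod z : `|z| = (cmod z)%:C.
Proof. by []. Qed.

Lemma cmod_def z : cmod z = Num.sqrt (complex.Re z ^+ 2 + complex.Im z ^+ 2).
Proof. by case: z. Qed.

Lemma cmod_ge0 z : 0 <= cmod z.
Proof. by rewrite cmod_def sqrtr_ge0. Qed.

Lemma cmod_sqr z : cmod z ^+ 2 = complex.Re z ^+ 2 + complex.Im z ^+ 2.
Proof. by rewrite cmod_def sqr_sqrtr// addr_ge0 ?sqr_ge0. Qed.

Lemma cmod_Re z : `|complex.Re z| <= cmod z.
Proof. by rewrite -lecR; exact: normc_ge_Re. Qed.

Lemma cmod_Im z : `|complex.Im z| <= cmod z.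
Proof.
by rewrite -sqrtr_sqr cmod_def ler_wsqrtr// lerDr sqr_ge0.
Qed.

Lemma cmodD z w : cmod (z + w) <= cmod z + cmod w.
Proof. by rewrite le_normcD. Qed.

Lemma cmodM z w : cmod (z * w) = cmod z * cmod w.
Proof. exact: ComplexField.Normc.normcM. Qed.

Lemma cmodN z : cmod (- z) = cmod z.
Proof. exact: normcN. Qed.

Lemma cmodBD z w : cmod (z - w) <= cmod z + cmod w.
Proof. by rewrite -(cmodN w) cmodD. Qed.

Lemma cmod0 : cmod (0 : C) = 0.
Proof. exact: ComplexField.Normc.normc0. Qed.

Lemma cmod1 : cmod (1 : C) = 1.
Proof. exact: ComplexField.Normc.normc1. Qed.

Lemma cmod_eq0 z : (cmod z == 0) = (z == 0).
Proof.
apply/eqP/eqP => [/ComplexField.Normc.eq0_normc//|->]; exact: cmod0.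
Qed.

Lemma cmod_gt0 z : (0 < cmod z) = (z != 0).
Proof. by rewrite lt_neqAle cmod_ge0 andbT eq_sym cmod_eq0. Qed.

Lemma cmodV z : cmod z^-1 = (cmod z)^-1.
Proof. exact: ComplexField.Normc.normcV. Qed.

Lemma cmodX z n : cmod (z ^+ n) = cmod z ^+ n.
Proof. by elim: n => [|n IH]; rewrite ?expr0 ?cmod1// !exprS cmodM IH. Qed.

Lemma cmodR (x : R) : cmod x%:C = `|x|.
Proof. by rewrite cmod_def /= expr0n/= addr0 sqrtr_sqr. Qed.

Lemma cmod_nat n : cmod (n%:R : C) = n%:R.
Proof.
rewrite (_ : n%:R = (n%:R : R)%:C); last by rewrite rmorph_nat.
by rewrite cmodR ger0_norm.
Qed.

Lemma cmod_sum (I : Type) (r : seq I) (P : pred I) (F : I -> C) :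
  cmod (\sum_(i <- r | P i) F i) <= \sum_(i <- r | P i) cmod (F i).
Proof.
elim/big_rec2 : _ => [|i x y _ h]; first by rewrite cmod0.
by rewrite (le_trans (cmodD _ _))// lerD2l.
Qed.

Lemma cmod_ReIm z : cmod z <= `|complex.Re z| + `|complex.Im z|.
Proof.
rewrite -(@ler_pXn2r _ 2)// ?nnegrE ?cmod_ge0 ?addr_ge0//.
rewrite cmod_sqr sqrrD !real_normK ?num_real// -addrA.
by rewrite [_ *+ 2 + _]addrC addrA lerDl mulrn_wge0// mulr_ge0.
Qed.

Lemma cReD z w : complex.Re (z + w) = complex.Re z + complex.Re w.
Proof. by case: z => ? ?; case: w. Qed.
Lemma cImD z w : complex.Im (z + w) = complex.Im z + complex.Im w.
Proof. by case: z => ? ?; case: w. Qed.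
Lemma cReN z : complex.Re (- z) = - complex.Re z.
Proof. by case: z. Qed.
Lemma cImN z : complex.Im (- z) = - complex.Im z.
Proof. by case: z. Qed.
Lemma cReM z w : complex.Re (z * w) =
  complex.Re z * complex.Re w - complex.Im z * complex.Im w.
Proof. by case: z => ? ?; case: w. Qed.
Lemma cImM z w : complex.Im (z * w) =
  complex.Re z * complex.Im w + complex.Im z * complex.Re w.
Proof. by case: z => ? ?; case: w. Qed.
Lemma cRe_sum (I : Type) (r : seq I) (P : pred I) (F : I -> C) :
  complex.Re (\sum_(i <- r | P i) F i) = \sum_(i <- r | P i) complex.Re (F i).
Proof. by elim/big_rec2 : _ => // i x y _ <-; rewrite cReD. Qed.
Lemma cIm_sum (I : Type) (r : seq I) (P : pred I) (F : I -> C) :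
  complex.Im (\sum_(i <- r | P i) F i) = \sum_(i <- r | P i) complex.Im (F i).
Proof. by elim/big_rec2 : _ => // i x y _ <-; rewrite cImD. Qed.
Lemma Re_real (x : R) : complex.Re x%:C = x. Proof. by []. Qed.
Lemma Im_real (x : R) : complex.Im x%:C = 0. Proof. by []. Qed.
Lemma complexP z w : complex.Re z = complex.Re w ->
  complex.Im z = complex.Im w -> z = w.
Proof. by case: z => a b; case: w => c d /= -> ->. Qed.

End ComplexModulus.

Section Convergence.
Variable R : realType.
Local Notation C := R[i].
Implicit Types (u v : nat -> C) (l : C).

(** The norm of [R[i]] takes its values in [R[i]]. With [cmod] and a real e the estimates live in a
    totally ordered field, where [lra] applies; [ccvgP] links this to the topology. *)
Definition ccvg u l := forall e : R, 0 < e ->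
  exists N, forall n, (N <= n)%N -> cmod (u n - l) <= e.

Lemma ccvg_uniq u l l' : ccvg u l -> ccvg u l' -> l = l'.
Proof.
move=> ul ul'; apply/eqP; rewrite -subr_eq0 -cmod_eq0; apply/eqP.
apply/eqP; rewrite eq_le cmod_ge0 andbT; apply/ler_addgt0Pl => e e0.
have [N1 h1] := ul _ (divr_gt0 e0 (ltr0Sn _ 1)).
have [N2 h2] := ul' _ (divr_gt0 e0 (ltr0Sn _ 1)).
have := h1 (maxn N1 N2) (leq_maxl _ _); have := h2 (maxn N1 N2) (leq_maxr _ _).
set x := u _ => a b; rewrite (_ : l - l' = (x - l') - (x - l)); last by ring.
rewrite (le_trans (cmodBD _ _))//; lra.
Qed.

Lemma ccvg_cst l : ccvg (fun=> l) l.
Proof. by move=> e e0; exists 0%N => n _; rewrite subrr cmod0 ltW. Qed.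

Lemma eq_ccvg u v l : (forall n, u n = v n) -> ccvg u l -> ccvg v l.
Proof. by move=> uv ul e /ul[N h]; exists N => n /h; rewrite uv. Qed.

Lemma ccvg_near u v l (n0 : nat) : (forall n, (n0 <= n)%N -> u n = v n) ->
  ccvg u l -> ccvg v l.
Proof.
move=> uv ul e /ul[N h]; exists (maxn n0 N) => n.
by rewrite geq_max => /andP[a b]; rewrite -uv// h.
Qed.

Lemma ccvgD u v l m : ccvg u l -> ccvg v m -> ccvg (fun n => u n + v n) (l + m).
Proof.
move=> ul vm e e0.
have [N1 h1] := ul _ (divr_gt0 e0 (ltr0Sn _ 1)).
have [N2 h2] := vm _ (divr_gt0 e0 (ltr0Sn _ 1)).
exists (maxn N1 N2) => n; rewrite geq_max => /andP[/h1 a /h2 b].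
rewrite opprD addrACA (le_trans (cmodD _ _))//; lra.
Qed.

Lemma ccvgMl (k : C) u l : ccvg u l -> ccvg (fun n => k * u n) (k * l).
Proof.
move=> ul e e0.
have k0 : 0 < cmod k + 1 by rewrite ltr_wpDl ?cmod_ge0.
have [N h] := ul _ (divr_gt0 e0 k0); exists N => n /h.
rewrite -mulrBr cmodM ler_pdivlMr//; apply: le_trans.
by rewrite mulrC ler_wpM2l ?cmod_ge0// lerDl.
Qed.

Lemma ccvgN u l : ccvg u l -> ccvg (fun n => - u n) (- l).
Proof.
move=> /(ccvgMl (-1)); rewrite mulN1r; apply: eq_ccvg => n; exact: mulN1r.
Qed.

Lemma ccvgB u v l m : ccvg u l -> ccvg v m -> ccvg (fun n => u n - v n) (l - m).
Proof. by move=> ul vm; apply: ccvgD => //; exact: ccvgN. Qed.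

Lemma ccvg_sum0 u v l : ccvg (fun n => u n - v n) 0 -> ccvg v l -> ccvg u l.
Proof.
move=> uv vl; rewrite -(add0r l); apply: eq_ccvg (ccvgD uv vl) => n.
by rewrite subrK.
Qed.

Lemma ccvg_le u l (B : R) (n0 : nat) :
  (forall n, (n0 <= n)%N -> cmod (u n) <= B) -> ccvg u l -> cmod l <= B.
Proof.
move=> uB ul; apply/ler_addgt0Pl => e e0.
have [N h] := ul _ e0; have := h (maxn N n0) (leq_maxl _ _).
have := uB (maxn N n0) (leq_maxr _ _); set x := u _ => a b.
rewrite (_ : l = x - (x - l)); last by ring.
by rewrite (le_trans (cmodBD _ _))// addrC lerD.
Qed.

Lemma ccvg_bounded u l : ccvg u l -> exists B, forall n, cmod (u n) <= B.
Proof.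
move=> /(_ _ ltr01)[N h].
exists (\sum_(i < N) cmod (u i) + (cmod l + 1)) => n.
have s0 : 0 <= \sum_(i < N) cmod (u i) by apply: sumr_ge0 => i _; exact: cmod_ge0.
have [nN|Nn] := ltnP n N.
  rewrite (bigD1 (Ordinal nN))//= -addrA lerDl addr_ge0//.
    by apply: sumr_ge0 => i _; exact: cmod_ge0.
  by rewrite addr_ge0 ?cmod_ge0.
rewrite (_ : u n = (u n - l) + l); last by ring.
rewrite (le_trans (cmodD _ _))//; have := h _ Nn; lra.
Qed.

Lemma ccvg_shift u l : ccvg (fun n => u n.+1) l <-> ccvg u l.
Proof.
split=> ul e /ul[N h].
  by exists N.+1 => -[//|n] Nn; exact: h.
by exists N => n Nn; apply: h; rewrite (leq_trans Nn).
Qed.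

Lemma ccvgP u l : u @ \oo --> l <-> ccvg u l.
Proof.
split=> [/cvgrPdist_le h e e0|h].
  have [|N _ hN] := h e%:C; first by rewrite ltcR.
  exists N => n Nn; have := hN n Nn.
  by rewrite distrC /= lecR.
apply/cvgrPdist_le => e e0.
have er : e = (complex.Re e)%:C by case: e e0 => a b; rewrite ltcE/= => /andP[/eqP-> _].
have := e0; rewrite er ltcR => /h[N hN]; exists N => // n Nn /=.
by rewrite distrC lecR hN.
Qed.

End Convergence.

Section Series.
Variable R : realType.
Local Notation C := R[i].
Implicit Types (x y : nat -> C) (B : nat -> R).

Lemma ccvg_ReIm (u : nat -> C) l :
  complex.Re (u n) @[n --> \oo] --> complex.Re l ->
  complex.Im (u n) @[n --> \oo] --> complex.Im l -> ccvg u l.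
Proof.
move=> /cvgrPdist_le hr /cvgrPdist_le hi e e0.
have [N1 _ h1] := hr _ (divr_gt0 e0 (ltr0Sn _ 1)).
have [N2 _ h2] := hi _ (divr_gt0 e0 (ltr0Sn _ 1)).
exists (maxn N1 N2) => n; rewrite geq_max => /andP[/h1 + /h2]/=.
rewrite distrC => a; rewrite distrC => b.
rewrite (le_trans (cmod_ReIm _))// cReD cImD cReN cImN; lra.
Qed.

Lemma ccvg_Re (u : nat -> C) l : ccvg u l ->
  complex.Re (u n) @[n --> \oo] --> complex.Re l.
Proof.
move=> ul; apply/cvgrPdist_le => e /ul[N h]; exists N => // n /h/=.
by rewrite distrC -cReN -cReD; apply/le_trans/cmod_Re.
Qed.

Lemma ccvg_Im (u : nat -> C) l : ccvg u l ->
  complex.Im (u n) @[n --> \oo] --> complex.Im l.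
Proof.
move=> ul; apply/cvgrPdist_le => e /ul[N h]; exists N => // n /h/=.
by rewrite distrC -cImN -cImD; apply/le_trans/cmod_Im.
Qed.

Lemma bounded_sum_cvg (u : nat -> R) (S : R) :
  (forall N, \sum_(k < N) `|u k| <= S) ->
  exists l : R, \sum_(k < N) u k @[N --> \oo] --> l.
Proof.
move=> uS; have : cvgn (series u).
  apply: normed_cvg; apply: nondecreasing_is_cvgn.
    by apply: nondecreasing_series => *; exact: normr_ge0.
  by exists S => _ [N _ <-]; move: (uS N); rewrite -(big_mkord xpredT (fun k => `|u k|)).
move=> /cvg_ex[l ul]; exists l.
suff -> : (fun N => \sum_(k < N) u k) = series u by [].
by apply/funext => N; rewrite /series/= big_mkord.
Qed.

Lemma abs_csum_cvg x (S : R) : (forall N, \sum_(k < N) cmod (x k) <= S) ->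
  exists l, ccvg (fun N => \sum_(k < N) x k) l.
Proof.
move=> xS.
have [a ha] : exists a : R, \sum_(k < N) complex.Re (x k) @[N --> \oo] --> a.
  apply: (@bounded_sum_cvg (fun k => complex.Re (x k)) S) => N; apply: le_trans (xS N).
  by apply: ler_sum => k _; exact: cmod_Re.
have [b hb] : exists a : R, \sum_(k < N) complex.Im (x k) @[N --> \oo] --> a.
  apply: (@bounded_sum_cvg (fun k => complex.Im (x k)) S) => N; apply: le_trans (xS N).
  by apply: ler_sum => k _; exact: cmod_Im.
exists (a +i* b); apply: ccvg_ReIm => /=.
  by under eq_fun do rewrite cRe_sum.
by under eq_fun do rewrite cIm_sum.
Qed.

Lemma sum_tail B (S : R) : (forall k, 0 <= B k) ->
  (forall N, \sum_(k < N) B k <= S) -> forall e, 0 < e ->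
  exists K, forall N, \sum_(K <= k < N) B k <= e.
Proof.
move=> B0 BS e e0.
have [l hl] : exists l : R, \sum_(k < N) B k @[N --> \oo] --> l.
  apply: (@bounded_sum_cvg B S) => N.
  by under eq_bigr do rewrite ger0_norm//.
have mono N M : (N <= M)%N -> \sum_(k < N) B k <= \sum_(k < M) B k.
  move=> NM; rewrite -!(big_mkord xpredT) (big_cat_nat (n := N) (p := M))//=.
  by rewrite lerDl sumr_ge0.
have lel N : \sum_(k < N) B k <= l.
  have /cvgrPdist_le h := hl; apply/ler_addgt0Pl => d d0.
  have [M _ hM] := h _ d0; have /= := hM (maxn M N) (leq_maxl _ _).
  have := mono _ _ (leq_maxr M N); rewrite distrC ler_norml => a /andP[_ b].
  move: a b; set u := \sum_(_ < _) _; set v := \sum_(_ < _) _; lra.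
have /cvgrPdist_le /(_ _ e0)[K _ hK] := hl.
exists K => N; have [NK|KN] := leqP N K; first by rewrite big_geq// ltW.
have := lel N; have /= := hK K (leqnn _); rewrite ler_norml => /andP[_].
rewrite -!(big_mkord xpredT) [in X in _ -> X -> _](big_cat_nat (n := K))//=; last exact: ltnW.
move: (\sum_(_ <= _ < _) _) (\sum_(_ <= _ < _) _) => u v; lra.
Qed.

(** Tannery's theorem, with the truncation index equal to the index of the sequence: the first K
    terms converge one by one, and the others are bounded by twice the tail of B. *)
Lemma tannery (a : nat -> nat -> C) (l : nat -> C) B (S : R) :
  (forall k, ccvg (a^~ k) (l k)) -> (forall N k, cmod (a N k) <= B k) ->
  (forall N, \sum_(k < N) B k <= S) ->
  ccvg (fun N => \sum_(k < N) (a N k - l k)) 0.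
Proof.
move=> al aB BS e e0.
have B0 k : 0 <= B k by apply: le_trans (aB 0%N k); exact: cmod_ge0.
have lB k : cmod (l k) <= B k by apply: (ccvg_le (n0 := 0%N)) (al k) => n _.
(* The tail counts twice, for a and for l, so a quarter of e for it leaves half of e for the first K
   terms. *)
have e4 : 0 < e / 4%:R by rewrite divr_gt0.
have [K hK] := sum_tail B0 BS e4.
have fin d : 0 < d -> exists N0, forall N, (N0 <= N)%N ->
    \sum_(k < K) cmod (a N k - l k) <= d.
  elim: K {hK} d => [|K IH] d d0.
    by exists 0%N => N _; rewrite big_ord0 ltW.
  have d2 : 0 < d / 2%:R by rewrite divr_gt0.
  have [N1 h1] := IH _ d2; have [N2 h2] := al K _ d2.
  exists (maxn N1 N2) => N; rewrite geq_max big_ord_recr/= => /andP[/h1 A /h2 /= B'].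
  by rewrite (splitr d) lerD.
have [N0 hN0] := fin (e / 2%:R) (divr_gt0 e0 (ltr0Sn _ 1)).
exists (maxn N0 K) => N; rewrite geq_max subr0 => /andP[h1 h2].
apply: (le_trans (cmod_sum _ _ _)).
rewrite -(big_mkord xpredT (fun k => cmod (a N k - l k))) (big_cat_nat (n := K))//=.
rewrite big_mkord (_ : e = e / 2%:R + 2%:R * (e / 4%:R)); last by field.
rewrite lerD ?hN0// (le_trans (y := \sum_(K <= k < N) (B k + B k)))//.
  by apply: ler_sum => k _; rewrite (le_trans (cmodBD _ _))// lerD.
rewrite big_split/=; move: (hK N); move: (\sum_(_ <= _ < _) _) => u; lra.
Qed.

Lemma tannery_cvg (a : nat -> nat -> C) (l : nat -> C) B (S : R) v :
  (forall k, ccvg (a^~ k) (l k)) -> (forall N k, cmod (a N k) <= B k) ->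
  (forall N, \sum_(k < N) B k <= S) ->
  ccvg (fun N => \sum_(k < N) a N k) v -> ccvg (fun N => \sum_(k < N) l k) v.
Proof.
move=> al aB BS av; apply: (ccvg_sum0 _ av).
have := ccvgN (tannery al aB BS); rewrite oppr0; apply: eq_ccvg => N.
by rewrite -sumrN -sumrB; apply: eq_bigr => k _; rewrite opprB.
Qed.

(** Mertens' theorem: the partial sum of the product is the sum of x_k times the partial sum of y of
    length N - k, so [tannery] applies with the bound |x_k| times a bound for the partial sums of
    y. *)
Lemma cauchy_product x y X Y (S : R) : (forall N, \sum_(k < N) cmod (x k) <= S) ->
  ccvg (fun N => \sum_(k < N) x k) X -> ccvg (fun N => \sum_(k < N) y k) Y ->
  ccvg (fun N => \sum_(n < N) \sum_(k < n.+1) x k * y (n - k)%N) (X * Y).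
Proof.
move=> xS xX yY; have [By hBy] := ccvg_bounded yY.
have By0 : 0 <= By by apply: le_trans (hBy 0%N); exact: cmod_ge0.
apply: (@ccvg_sum0 _ _ (fun N => \sum_(k < N) x k * Y)); last first.
  by under eq_fun do rewrite -mulr_suml mulrC; rewrite mulrC; exact: ccvgMl.
apply: (@eq_ccvg _ (fun N => \sum_(k < N) (x k * (\sum_(j < N - k) y j) - x k * Y))).
  move=> N; rewrite sumrB; congr (_ - _).
  elim: N => [|N IH]; first by rewrite !big_ord0.
  rewrite big_ord_recr/= subSnn big_ord1 [in RHS]big_ord_recr/= -IH.
  rewrite [X in _ + X = _](_ : _ = x N * y (N - N)%N); last by rewrite subnn.
  rewrite [in RHS]big_ord_recr/= addrA; congr (_ + _).
  rewrite -big_split/=; apply: eq_bigr => k _.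
  by rewrite subSn ?(ltnW (ltn_ord k))// big_ord_recr/= mulrDr.
apply: (@tannery (fun N k => x k * (\sum_(j < N - k) y j)) (fun k => x k * Y)
  (fun k => cmod (x k) * By) (S * By)).
- move=> k; apply: ccvgMl => e /yY[N h]; exists (N + k)%N => n Nn.
  by apply: h; rewrite leq_subRL 1?addnC// (leq_trans (leq_addl _ _) Nn).
- by move=> N k; rewrite cmodM ler_wpM2l ?cmod_ge0.
- by move=> N; rewrite -mulr_suml ler_wpM2r.
Qed.

End Series.

(** * Analytic and meromorphic functions *)

Section PowerSeries.
Variable R : realType.
Local Notation C := R[i].
Implicit Types (c d : nat -> C) (h a b v : C) (f g : C -> C) (r : R).

Definition pbound c r := exists M : R, forall n, cmod (c n) * r ^+ n <= M.

Definition pser c h v := ccvg (fun N => \sum_(k < N) c k * h ^+ k) v.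

(* pbound c r stands for a radius of convergence of at least r. *)
Definition has_ps f a c := exists r : R,
  [/\ 0 < r, pbound c r & forall h, cmod h < r -> pser c h (f (a + h))].

Lemma geometric_sum (q : R) N : 0 <= q -> q < 1 ->
  \sum_(k < N) q ^+ k <= (1 - q)^-1.
Proof.
move=> q0 q1; have q1' : 0 < 1 - q by rewrite subr_gt0.
rewrite -[leRHS]mul1r ler_pdivlMr// mulrC.
rewrite (_ : (1 - q) * _ = 1 - q ^+ N); first by rewrite gerBl exprn_ge0.
by rewrite -opprB mulNr -subrX1 opprB.
Qed.

Lemma pbound_le c r r' : 0 <= r' -> r' <= r -> pbound c r -> pbound c r'.
Proof.
move=> r'0 r'r [M hM]; exists M => n; apply: le_trans (hM n).
by rewrite ler_wpM2l ?cmod_ge0// lerXn2r// nnegrE// (le_trans r'0).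
Qed.

Lemma pbound_sum c r (x : R) : pbound c r -> 0 <= x -> x < r ->
  exists S : R, forall N, \sum_(k < N) cmod (c k) * x ^+ k <= S.
Proof.
move=> [M hM] x0 xr; have r0 : 0 < r by exact: le_lt_trans xr.
have M0 : 0 <= M by rewrite (le_trans _ (hM 0%N))// expr0 mulr1 cmod_ge0.
exists (M * (1 - x / r)^-1) => N.
apply: (@le_trans _ _ (M * \sum_(k < N) (x / r) ^+ k)).
  rewrite mulr_sumr; apply: ler_sum => k _.
  rewrite expr_div_n mulrA ler_pdivlMr ?exprn_gt0//.
  by rewrite mulrAC ler_wpM2r// exprn_ge0.
rewrite ler_wpM2l// geometric_sum// ?divr_ge0 ?(ltW r0)//.
by rewrite ltr_pdivrMr// mul1r.
Qed.

Lemma pser_exists c r h : pbound c r -> cmod h < r -> exists v, pser c h v.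
Proof.
move=> cr hr; have [S hS] := pbound_sum cr (cmod_ge0 h) hr.
apply: (@abs_csum_cvg _ (fun k => c k * h ^+ k) S) => N; apply: le_trans (hS N).
by apply: ler_sum => k _; rewrite cmodM cmodX.
Qed.

Lemma pser0 c : pser c 0 (c 0%N).
Proof.
move=> e e0; exists 1%N => -[//|n] _.
rewrite big_ord_recl expr0 mulr1 big1 ?addr0 ?subrr ?cmod0 ?ltW// => k _.
by rewrite expr0n/= mulr0.
Qed.

(** For |h| <= r / 2 the tail is dominated by a geometric series of ratio at most 1/2, hence the
    factor 2. Isolated zeros and derivatives both rest on this estimate. *)
Lemma pser_remainder c r M h v m : (forall n, cmod (c n) * r ^+ n <= M) ->
  0 < r -> cmod h <= r / 2%:R -> pser c h v ->
  cmod (v - \sum_(k < m) c k * h ^+ k) <= 2%:R * M * (cmod h / r) ^+ m.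
Proof.
move=> hM r0 hr cv.
have M0 : 0 <= M by rewrite (le_trans _ (hM 0%N))// expr0 mulr1 cmod_ge0.
have q0 : 0 <= cmod h / r by rewrite divr_ge0 ?cmod_ge0// ltW.
have q2 : cmod h / r <= 2%:R^-1 by rewrite ler_pdivrMr// mulrC.
have := ccvgB cv (@ccvg_cst _ (\sum_(k < m) c k * h ^+ k)).
apply: (@ccvg_le _ _ _ _ m) => N mN.
rewrite -!(big_mkord xpredT (fun k => c k * h ^+ k)) (big_cat_nat (n := m))//= addrAC subrr add0r.
rewrite -{1}(add0n m) big_addn big_mkord.
apply: (le_trans (cmod_sum _ _ _)).
apply: (@le_trans _ _ (\sum_(k < N - m) M * (cmod h / r) ^+ m * (cmod h / r) ^+ k)).
  apply: ler_sum => k _; rewrite cmodM cmodX -mulrA -exprD addnC.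
  rewrite expr_div_n mulrA ler_pdivlMr ?exprn_gt0//.
  by rewrite mulrAC ler_wpM2r// exprn_ge0// cmod_ge0.
rewrite -mulr_sumr mulrC mulrA ler_wpM2r ?exprn_ge0// ler_wpM2r//.
apply: (le_trans (geometric_sum _ q0 _)); first by apply: le_lt_trans q2 _; lra.
by rewrite -[leRHS]invrK lef_pV2 ?posrE//; lra.
Qed.

Lemma has_ps_val f a c : has_ps f a c -> f a = c 0%N.
Proof.
move=> [r [r0 _ /(_ 0)]]; rewrite cmod0 addr0 => /(_ r0) h.
exact: ccvg_uniq h (pser0 c).
Qed.

Lemma has_ps_eq f g a c (r : R) : 0 < r ->
  (forall h, cmod h < r -> f (a + h) = g (a + h)) -> has_ps f a c -> has_ps g a c.
Proof.
move=> r0 fg [r' [r'0 cr' fc]]; have m0 : 0 < Num.min r r' by rewrite lt_min r0.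
exists (Num.min r r'); split => //.
  by apply: pbound_le cr'; rewrite ?ge_min ?lexx ?orbT// ltW.
by move=> h; rewrite lt_min => /andP[hr hr']; rewrite -fg//; exact: fc.
Qed.

Lemma has_ps_cst (k : C) a : has_ps (fun=> k) a (fun n => if n == 0%N then k else 0).
Proof.
exists 1; split => //.
  exists (cmod k) => n; rewrite expr1n mulr1; case: ifP => // _.
  by rewrite cmod0 cmod_ge0.
move=> h _ e e0; exists 1%N => -[//|n] _.
rewrite big_ord_recl expr0 mulr1 big1 ?addr0 ?subrr ?cmod0 ?ltW// => i _.
by rewrite mul0r.
Qed.

Lemma has_ps_id a : has_ps id a (fun n => if n is n'.+1 then (n' == 0%N)%:R else a).
Proof.
exists 1; split => //.
  exists (cmod a + 1) => -[|[|n]]; rewrite expr1n mulr1/=.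
  - by rewrite lerDl.
  - by rewrite cmod1 lerDr cmod_ge0.
  - by rewrite cmod0 addr_ge0 ?cmod_ge0.
move=> h _ e e0; exists 2%N => -[//|[//|n]] _.
rewrite !big_ord_recl/= expr0 mulr1 mul1r big1 ?addr0 ?subrr ?cmod0 ?ltW// => i _.
by rewrite mul0r.
Qed.

Lemma has_psD f g a c d : has_ps f a c -> has_ps g a d ->
  has_ps (fun s => f s + g s) a (fun n => c n + d n).
Proof.
move=> [r [r0 cr fc]] [r' [r'0 dr' gd]].
have m0 : 0 < Num.min r r' by rewrite lt_min r0.
exists (Num.min r r'); split => //.
  have [M hM] : pbound c (Num.min r r').
    by apply: pbound_le cr; rewrite ?ge_min ?lexx ?orbT// ltW.
  have [M' hM'] : pbound d (Num.min r r').
    by apply: pbound_le dr'; rewrite ?ge_min ?lexx ?orbT// ltW.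
  exists (M + M') => n; apply: (le_trans _ (lerD (hM n) (hM' n))).
  by rewrite -mulrDl ler_wpM2r ?cmodD// exprn_ge0// ltW.
move=> h; rewrite lt_min => /andP[hr hr'].
apply: eq_ccvg (ccvgD (fc _ hr) (gd _ hr')) => N.
by rewrite -big_split/=; apply: eq_bigr => k _; rewrite mulrDl.
Qed.

Lemma has_psM f g a c d : has_ps f a c -> has_ps g a d ->
  has_ps (fun s => f s * g s) a (fun n => \sum_(k < n.+1) c k * d (n - k)%N).
Proof.
move=> [r1 [r10 cr fc]] [r2 [r20 dr gd]].
set r := Num.min r1 r2.
have r0 : 0 < r by rewrite lt_min r10.
have rr1 : r <= r1 by rewrite /r ge_min lexx.
have rr2 : r <= r2 by rewrite /r ge_min lexx orbT.
(* Each of the n + 1 terms of a product coefficient is at most M M' r^(-n); halving the radius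
   absorbs n + 1 <= 2^n. *)
exists (r / 2%:R); split; first by rewrite divr_gt0.
  have [M hM] := pbound_le (ltW r0) rr1 cr.
  have [M' hM'] := pbound_le (ltW r0) rr2 dr.
  have M0 : 0 <= M by rewrite (le_trans _ (hM 0%N))// expr0 mulr1 cmod_ge0.
  have M'0 : 0 <= M' by rewrite (le_trans _ (hM' 0%N))// expr0 mulr1 cmod_ge0.
  exists (M * M') => n; rewrite expr_div_n mulrA ler_pdivrMr ?exprn_gt0//.
  apply: (@le_trans _ _ (\sum_(k < n.+1) M * M')).
    rewrite (le_trans (ler_wpM2r _ (cmod_sum _ _ _))) ?exprn_ge0 ?(ltW r0)//.
    rewrite mulr_suml; apply: ler_sum => k _.
    have -> : r ^+ n = r ^+ k * r ^+ (n - k)%N by rewrite -exprD subnKC// leq_ord.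
    rewrite cmodM mulrACA.
    by rewrite ler_pM// mulr_ge0 ?cmod_ge0// exprn_ge0// ltW.
  rewrite sumr_const card_ord -[leLHS]mulr_natr ler_wpM2l ?mulr_ge0//.
  by rewrite -natrX ler_nat ltn_expl.
move=> h hr.
have hr1 : cmod h < r1 by lra.
have hr2 : cmod h < r2 by lra.
have [S hS] := pbound_sum cr (cmod_ge0 h) hr1.
apply: eq_ccvg (@cauchy_product _ (fun k => c k * h ^+ k) (fun k => d k * h ^+ k)
  _ _ S _ (fc _ hr1) (gd _ hr2)) => N.
  apply: eq_bigr => n _; rewrite mulr_suml; apply: eq_bigr => k _.
  by rewrite mulrACA -exprD subnKC// leq_ord.
apply: le_trans (hS N); apply: ler_sum => k _; by rewrite cmodM cmodX.
Qed.

Section Inverse.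
Variable c : nat -> C.

(** The coefficients of 1/f obey a course-of-values recursion; carrying the list of all earlier ones
    keeps the fixpoint structural. *)
Fixpoint inv_coefs (n : nat) : seq C :=
  if n is n'.+1 then rcons (inv_coefs n')
    (- (c 0%N)^-1 * \sum_(k < n'.+1) c k.+1 * nth 0 (inv_coefs n') (n' - k))
  else [:: (c 0%N)^-1].

Definition inv_coef n := nth 0 (inv_coefs n) n.

Lemma size_inv_coefs n : size (inv_coefs n) = n.+1.
Proof. by elim: n => //= n IH; rewrite size_rcons IH. Qed.

Lemma nth_inv_coefs m n : (n <= m)%N -> nth 0 (inv_coefs m) n = inv_coef n.
Proof.
elim: m => [|m IH]; first by rewrite leqn0 => /eqP ->.
rewrite leq_eqVlt => /predU1P[->//|nm].
by rewrite /= nth_rcons size_inv_coefs nm IH.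
Qed.

Lemma inv_coefS n : inv_coef n.+1 =
  - (c 0%N)^-1 * \sum_(k < n.+1) c k.+1 * inv_coef (n - k)%N.
Proof.
rewrite {1}/inv_coef /= nth_rcons size_inv_coefs ltnn eqxx.
congr (_ * _); apply: eq_bigr => k _; by rewrite nth_inv_coefs ?leq_subr.
Qed.

Lemma inv_coef_conv n : c 0%N != 0 ->
  \sum_(k < n.+1) c k * inv_coef (n - k)%N = (n == 0%N)%:R.
Proof.
move=> c0; case: n => [|n].
  by rewrite big_ord1 /inv_coef/= divff.
rewrite big_ord_recl subn0 inv_coefS mulrA mulrN divff// mulN1r /=.
apply/eqP; rewrite addrC subr_eq0; apply/eqP; apply: eq_bigr => k _.
by rewrite /bump/= add1n subSS.
Qed.

(** With D = 1/|c_0| the inverse coefficients d_n satisfy |d_n| r^n <= D (1 + D M)^n by induction,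
    because the recursion produces a geometric sum with value D ((1 + D M)^(n+1) - 1). *)
Lemma inv_coef_bound r : 0 < r -> c 0%N != 0 -> pbound c r ->
  exists2 r', 0 < r' & pbound inv_coef r'.
Proof.
move=> r0 c0 [M hM].
have M0 : 0 < M by rewrite (lt_le_trans _ (hM 0%N))// expr0 mulr1 cmod_gt0.
set D := cmod (c 0%N)^-1; have D0 : 0 < D by rewrite cmod_gt0 invr_eq0.
have DM0 : 0 < D * M by rewrite mulr_gt0.
have q0 : 0 < 1 + D * M by rewrite addr_gt0.
suff h n : cmod (inv_coef n) * r ^+ n <= D * (1 + D * M) ^+ n.
  exists (r / (1 + D * M)); first by rewrite divr_gt0.
  by exists D => n; rewrite expr_div_n mulrA ler_pdivrMr ?exprn_gt0.
elim/ltn_ind: n => -[_|n IH]; first by rewrite !expr0 !mulr1 /inv_coef.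
rewrite inv_coefS cmodM cmodN -/D -mulrA ler_wpM2l ?(ltW D0)//.
apply: (@le_trans _ _ (\sum_(k < n.+1) M * (D * (1 + D * M) ^+ (n - k)))).
  rewrite (le_trans (ler_wpM2r _ (cmod_sum _ _ _))) ?exprn_ge0 ?(ltW r0)//.
  rewrite mulr_suml; apply: ler_sum => k _; rewrite cmodM.
  have -> : r ^+ n.+1 = r ^+ k.+1 * r ^+ (n - k)%N.
    by rewrite -exprD addSn subnKC// leq_ord.
  rewrite mulrACA ler_pM ?mulr_ge0 ?cmod_ge0 ?exprn_ge0 ?(ltW r0)//.
  by rewrite IH// ltnS leq_subr.
rewrite (reindex_inj rev_ord_inj)/=.
under eq_bigr => k _ do rewrite subSS subKn ?leq_ord// mulrA (mulrC M).
rewrite -mulr_sumr; have := subrX1 (1 + D * M) n.+1.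
rewrite [X in _ = X * _](_ : _ = D * M); last by ring.
by move=> <-; rewrite gerBl.
Qed.

End Inverse.

Lemma has_psV f a c : c 0%N != 0 -> has_ps f a c ->
  has_ps (fun s => (f s)^-1) a (inv_coef c).
Proof.
move=> c0 [r [r0 cr fc]]; have [r' r'0 dr'] := inv_coef_bound r0 c0 cr.
have m0 : 0 < Num.min r r' by rewrite lt_min r0.
exists (Num.min r r'); split => //.
  by apply: pbound_le dr'; rewrite ?ge_min ?lexx ?orbT// ltW.
move=> h; rewrite lt_min => /andP[hr hr'].
have [v hv] := pser_exists dr' hr'.
suff -> : (f (a + h))^-1 = v by [].
(* That f does not vanish at a + h is itself a consequence of f v = 1. *)
suff fv1 : f (a + h) * v = 1.
  have f0 : f (a + h) != 0.
    by apply/eqP => f0; move: fv1; rewrite f0 mul0r => /esym/eqP; rewrite oner_eq0.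
  by rewrite -[LHS]mulr1 -fv1 mulKf.
have [S hS] := pbound_sum cr (cmod_ge0 h) hr.
have := @cauchy_product _ (fun k => c k * h ^+ k) (fun k => inv_coef c k * h ^+ k)
  _ _ S _ (fc _ hr) hv.
move=> /(_ _)/ccvg_uniq; apply.
  by move=> N; apply: le_trans (hS N); apply: ler_sum => k _; rewrite cmodM cmodX.
apply: (@ccvg_near _ (fun=> 1) _ _ 1%N); last exact: ccvg_cst.
move=> [//|N] _; rewrite big_ord_recl [X in _ + X]big1 ?addr0.
  by rewrite big_ord1/= !expr0 !mulr1 /inv_coef/= divff.
move=> n _.
transitivity ((\sum_(k < (bump 0 n).+1) c k * inv_coef c (bump 0 n - k)%N) * h ^+ bump 0 n).
  rewrite mulr_suml; apply: eq_bigr => k _.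
  by rewrite mulrACA -exprD subnKC// leq_ord.
by rewrite inv_coef_conv// mul0r.
Qed.

(** The binomial theorem turns the series in b + h into a double series, and [tannery] interchanges
    the sums. This makes analyticity an open condition and exhibits the derivative at a + b as the
    coefficient [d 1]. *)
Lemma has_ps_recenter f a c : has_ps f a c -> exists r : R,
  [/\ 0 < r, pbound c r & forall b, cmod b < r -> exists d, has_ps f (a + b) d /\
    forall k, ccvg (fun N => \sum_(n < N) c n * b ^+ (n - k) *+ 'C(n, k)) (d k)].
Proof.
move=> [r [r0 cr fc]]; exists r; split => // b br.
(* Half the distance to the circle: |b| + p < r keeps the double series absolutely convergent. *)
set p := (r - cmod b) / 2%:R; have p0 : 0 < p by rewrite divr_gt0 ?subr_gt0.
have bp : cmod b + p < r by rewrite /p; lra.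
have bp0 : 0 <= cmod b + p by rewrite addr_ge0 ?cmod_ge0// ltW.
have [S hS] := pbound_sum cr bp0 bp.
have bound N k : (\sum_(n < N) cmod (c n * b ^+ (n - k) *+ 'C(n, k))) * p ^+ k <= S.
  apply: le_trans (hS N); rewrite mulr_suml; apply: ler_sum => n _.
  have [kn|nk] := leqP k n; last first.
    by rewrite bin_small// mulr0n cmod0 mul0r mulr_ge0 ?cmod_ge0// exprn_ge0.
  rewrite -mulr_natr !cmodM cmodX cmod_nat -!mulrA ler_wpM2l ?cmod_ge0//.
  rewrite exprDn (bigD1 (Ordinal (_ : k < n.+1)%N)) //= mulrA mulrAC mulr_natr.
  by rewrite lerDl sumr_ge0// => i _; rewrite mulrn_wge0// mulr_ge0// exprn_ge0 ?cmod_ge0// ltW.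
have : forall k, exists v, ccvg (fun N => \sum_(n < N) c n * b ^+ (n - k) *+ 'C(n, k)) v.
  move=> k; apply: (@abs_csum_cvg _ (fun n => c n * b ^+ (n - k) *+ 'C(n, k)) (S / p ^+ k)) => N.
  by rewrite ler_pdivlMr ?exprn_gt0.
move=> /choice[d hd]; exists d; split => //.
have dp : pbound d p.
  exists S => k; rewrite -ler_pdivlMr ?exprn_gt0//.
  apply: (@ccvg_le _ _ _ _ 0%N) (hd k) => N _; rewrite ler_pdivlMr ?exprn_gt0//.
  by apply: le_trans (bound N k); rewrite ler_wpM2r ?cmod_sum// exprn_ge0// ltW.
exists p; split => // h hp.
have q0 : 0 <= cmod h / p by rewrite divr_ge0 ?cmod_ge0// ltW.
have q1 : cmod h / p < 1 by rewrite ltr_pdivrMr// mul1r.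
have S0 : 0 <= S.
  by apply: le_trans (hS 0%N); rewrite big_ord0.
apply: (@tannery_cvg _ (fun N k => (\sum_(n < N) c n * b ^+ (n - k) *+ 'C(n, k)) * h ^+ k)
   (fun k => d k * h ^+ k) (fun k => S * (cmod h / p) ^+ k) (S * (1 - cmod h / p)^-1)).
- by move=> k; rewrite mulrC; under eq_fun do rewrite mulrC; apply: ccvgMl.
- move=> N k; rewrite cmodM cmodX expr_div_n mulrA ler_pdivlMr ?exprn_gt0//.
  rewrite mulrAC ler_wpM2r ?exprn_ge0 ?cmod_ge0//.
  by apply: le_trans (bound N k); rewrite ler_wpM2r ?cmod_sum// exprn_ge0// ltW.
- by move=> N; rewrite -mulr_sumr ler_wpM2l// geometric_sum.
- have bh : cmod (b + h) < r by rewrite (le_lt_trans (cmodD _ _))//; lra.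
  rewrite -addrA; apply: eq_ccvg (fc _ bh) => N.
  under [in RHS]eq_bigr do rewrite mulr_suml.
  rewrite exchange_big/=; apply: eq_bigr => n _.
  rewrite exprDn mulr_sumr (big_ord_widen _ (fun k => c n * (b ^+ (n - k) * h ^+ k *+ 'C(n, k))) (ltn_ord n)).
  rewrite big_mkcond/=; apply: eq_bigr => k _; case: ifPn => [_|].
    by rewrite -mulrnAr mulrA mulrnAl -mulrnAr.
  by rewrite ltnS -ltnNge => nk; rewrite bin_small// mulr0n mul0r.
Qed.

Lemma has_ps_isolated f a c : has_ps f a c -> (exists m, c m != 0) ->
  exists2 r : R, 0 < r & forall h, h != 0 -> cmod h < r -> f (a + h) != 0.
Proof.
move=> [r [r0 [M hM] fc]] exm.
have [m cm0 minm] := ex_minnP exm.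
have M0 : 0 < M.
  by rewrite (lt_le_trans _ (hM m))// mulr_gt0 ?cmod_gt0// exprn_gt0.
(* For |h| < B the remainder bound 2 M (|h| / r)^(m+1) stays below the leading term |c_m| |h|^m. *)
set B := cmod (c m) * r ^+ m.+1 / (2%:R * M).
have B0 : 0 < B by rewrite divr_gt0 ?mulr_gt0 ?cmod_gt0 ?exprn_gt0.
exists (Num.min B (r / 2%:R)); first by rewrite lt_min B0 divr_gt0.
move=> h h0; rewrite lt_min => /andP[hB hr]; apply/negP => /eqP f0.
have hr' : cmod h < r by lra.
have := pser_remainder m.+1 hM r0 (ltW hr) (fc _ hr').
rewrite f0 sub0r cmodN big_ord_recr/= big1 ?add0r; last first.
  move=> k _; have [->|ck] := eqVneq (c k) 0; first by rewrite mul0r.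
  by have := minm _ ck; rewrite leqNgt ltn_ord.
rewrite cmodM cmodX expr_div_n mulrA ler_pdivlMr ?exprn_gt0//.
rewrite leNgt exprSr mulrCA -mulrA [X in _ < X](_ : _ = cmod h ^+ m * (cmod (c m) * r ^+ m.+1)).
  rewrite ltr_pM2l ?exprn_gt0 ?cmod_gt0//.
  move: hB; rewrite ltr_pdivlMr ?mulr_gt0// => hB /negP; apply.
  by apply: le_lt_trans hB; rewrite le_eqVlt; apply/orP; left; apply/eqP; ring.
by rewrite -mulrA mulrCA.
Qed.

(** A nonzero coefficient of f - g would make f - g nonzero on a punctured disc. The centre is
    excluded because the functions to be compared may carry a junk value there. *)
Lemma has_ps_unique f g a c d (r : R) : has_ps f a c -> has_ps g a d ->
  0 < r -> (forall h, h != 0 -> cmod h < r -> f (a + h) = g (a + h)) -> c = d.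
Proof.
move=> fc gd r0 fg; apply/funext => m; apply/eqP; rewrite -subr_eq0; apply: contrapT => cd.
have [|r' r'0 h] := has_ps_isolated (has_psD fc (has_psM (has_ps_cst (-1) a) gd)).
  exists m; rewrite big_ord_recl/= subn0 big1 ?addr0 ?mulN1r; first exact/negP.
  by move=> i _; rewrite mul0r.
set x := Num.min r r' / 2%:R.
have m0 : 0 < Num.min r r' by rewrite lt_min r0.
have x0 : 0 < x by rewrite divr_gt0.
have xm : x < Num.min r r' by rewrite /x; lra.
have [xr xr'] : x < r /\ x < r' by move: xm; rewrite lt_min => /andP[].
have cx : cmod (x%:C : C) = x by rewrite cmodR gtr0_norm.
have xn0 : (x%:C : C) != 0 by rewrite -cmod_gt0 cx.
by have := h x%:C xn0; rewrite cx fg ?cx// mulN1r subrr eqxx => /(_ xr').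
Qed.

(** Connects the library derivative, in which [log_det] is stated, with power series: by the
    remainder bound of order 2 the difference quotient minus [c 1] is O(|h|). *)
Lemma has_ps_derive f a c : has_ps f a c -> derive1 f a = c 1%N.
Proof.
move=> fc; have fa := has_ps_val fc.
have [r [r0 [M hM] {}fc]] := fc.
rewrite /derive1; apply: cvg_lim => //; apply/cvgrPdist_le => e e0.
have er : e = (complex.Re e)%:C by case: e e0 => ? b; rewrite ltcE/= => /andP[/eqP-> _].
move: e0; rewrite er ltcR; move: (complex.Re e) => {er}e e0.
have M0 : 0 <= M by rewrite (le_trans _ (hM 0%N))// expr0 mulr1 cmod_ge0.
set B := e * r ^+ 2 / (2%:R * M + 1).
have M1 : 0 < 2%:R * M + 1 by rewrite ltr_wpDl// mulr_ge0.
have B0 : 0 < B by rewrite divr_gt0// mulr_gt0// exprn_gt0.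
set x := Num.min B (r / 2%:R); have x0 : 0 < x by rewrite lt_min B0 divr_gt0.
near=> h.
have h0 : h != 0 by near: h; exact: nbhs_dnbhs_neq.
have hx : cmod h < x.
  have : `|h| < x%:C by near: h; apply: dnbhs0_lt; rewrite ltcR.
  by rewrite ltcR.
move: hx; rewrite lt_min => /andP[hB hr].
have hr' : cmod h < r by lra.
have := pser_remainder 2 hM r0 (ltW hr) (fc _ hr').
rewrite !big_ord_recr big_ord0/= add0r expr0 mulr1 expr1 -fa => H.
rewrite lecR -[leLHS]/(cmod _) -cmodN opprB.
have ch : 0 < cmod h by rewrite cmod_gt0.
have -> : h^-1 *: (f (h + a) - f a) - c 1%N = h^-1 * (f (a + h) - (f a + c 1%N * h)).
  by rewrite opprD addrA mulrBr (mulrCA h^-1 (c 1%N)) mulVf// mulr1 [h + a]addrC.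
rewrite cmodM cmodV mulrC ler_pdivrMr//.
apply: (le_trans H); rewrite expr_div_n expr2 mulrA ler_pdivrMr ?exprn_gt0//.
rewrite mulrA [leRHS]mulrAC ler_wpM2r ?cmod_ge0//.
move: hB; rewrite ltr_pdivlMr// => hB; rewrite (le_trans _ (ltW hB))//.
by rewrite mulrC ler_wpM2l ?cmod_ge0// lerDl.
Unshelve. all: by end_near.
Qed.

End PowerSeries.

Section Analytic.
Variable R : realType.
Local Notation C := R[i].
Implicit Types (c d : nat -> C) (h a b v s : C) (f g : C -> C) (r : R).

Definition analytic f a := exists c, has_ps f a c.

Lemma analytic_cst (k : C) a : analytic (fun=> k) a.
Proof. by eexists; exact: has_ps_cst. Qed.

Lemma analytic_id a : analytic id a.
Proof. by eexists; exact: has_ps_id. Qed.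

Lemma analyticD f g a : analytic f a -> analytic g a -> analytic (fun s => f s + g s) a.
Proof. by move=> [c fc] [d gd]; eexists; exact: has_psD fc gd. Qed.

Lemma analyticM f g a : analytic f a -> analytic g a -> analytic (fun s => f s * g s) a.
Proof. by move=> [c fc] [d gd]; eexists; exact: has_psM fc gd. Qed.

Lemma analyticN f a : analytic f a -> analytic (fun s => - f s) a.
Proof.
move=> fa; have [c hc] := analyticM (analytic_cst (-1) a) fa; exists c.
by apply: (has_ps_eq ltr01 _ hc) => h _; rewrite mulN1r.
Qed.

Lemma analyticB f g a : analytic f a -> analytic g a -> analytic (fun s => f s - g s) a.
Proof. by move=> fa ga; apply: analyticD => //; exact: analyticN. Qed.

Lemma analyticV f a : f a != 0 -> analytic f a -> analytic (fun s => (f s)^-1) a.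
Proof.
move=> fa [c fc]; exists (inv_coef c); apply: has_psV (fc).
by rewrite -(has_ps_val fc).
Qed.

Lemma analyticX f n a : analytic f a -> analytic (fun s => f s ^+ n) a.
Proof.
move=> fa; elim: n => [|n IH]; first exact: analytic_cst.
by under eq_fun do rewrite exprS; exact: analyticM.
Qed.

Lemma analytic_sum (I : Type) (l : seq I) (P : pred I) (F : I -> C -> C) a :
  (forall i, P i -> analytic (F i) a) -> analytic (fun s => \sum_(i <- l | P i) F i s) a.
Proof.
move=> Fa; elim: l => [|i l IH].
  by under eq_fun do rewrite big_nil; exact: analytic_cst.
under eq_fun do rewrite big_cons.
by case: (boolP (P i)) => // Pi; apply: analyticD => //; exact: Fa.
Qed.

Lemma analytic_prod (I : Type) (l : seq I) (P : pred I) (F : I -> C -> C) a :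
  (forall i, P i -> analytic (F i) a) -> analytic (fun s => \prod_(i <- l | P i) F i s) a.
Proof.
move=> Fa; elim: l => [|i l IH].
  by under eq_fun do rewrite big_nil; exact: analytic_cst.
under eq_fun do rewrite big_cons.
by case: (boolP (P i)) => // Pi; apply: analyticM => //; exact: Fa.
Qed.

Lemma has_ps_shift f a b c : has_ps f (a + b) c -> has_ps (fun s => f (s + b)) a c.
Proof.
move=> [r [r0 cr fc]]; exists r; split => // h hr.
by rewrite addrAC; exact: fc.
Qed.

Lemma analytic_shift f a b : analytic f (a + b) -> analytic (fun s => f (s + b)) a.
Proof. by move=> [c fc]; exists c; exact: has_ps_shift. Qed.

Lemma analytic_eq f g a r : 0 < r -> (forall h, cmod h < r -> f (a + h) = g (a + h)) ->
  analytic f a -> analytic g a.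
Proof. by move=> r0 fg [c fc]; exists c; exact: (has_ps_eq r0 fg fc). Qed.

Lemma analytic_near f a : analytic f a ->
  exists2 r : R, 0 < r & forall h, cmod h < r -> analytic f (a + h).
Proof.
move=> [c /has_ps_recenter[r [r0 _ h]]]; exists r => // b /h[d [fd _]]; by exists d.
Qed.

(** At a + b the derivative is the first coefficient of the recentred series, that is, the sum of
    the n c_n b^(n-1). Halving the radius absorbs n + 1 <= 2^n. *)
Lemma analytic_derive f a : analytic f a -> analytic (derive1 f) a.
Proof.
move=> [c /has_ps_recenter[r [r0 [M hM] h]]].
exists (fun n => c n.+1 *+ n.+1), (r / 2%:R); split; first by rewrite divr_gt0.
  exists (M / r) => n; rewrite ler_pdivlMr//.
  apply: le_trans (hM n.+1).
  rewrite -[c n.+1 *+ _]mulr_natr cmodM cmod_nat -!mulrA ler_wpM2l ?cmod_ge0//.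
  rewrite expr_div_n mulrAC -exprSr mulrA ler_pdivrMr ?exprn_gt0// mulrC.
  by rewrite ler_wpM2l ?exprn_ge0 ?(ltW r0)// -natrX ler_nat ltn_expl.
move=> b br; have br' : cmod b < r by lra.
have [d [/has_ps_derive -> hd]] := h _ br'.
have := (ccvg_shift _ _).2 (hd 1%N); apply: eq_ccvg => N.
rewrite big_ord_recl bin0n mulr0n add0r; apply: eq_bigr => k _.
by rewrite /= /bump/= add1n subn1 bin1 mulrnAl.
Qed.

Lemma derive1D f g a : analytic f a -> analytic g a ->
  derive1 (fun s => f s + g s) a = derive1 f a + derive1 g a.
Proof.
move=> [c fc] [d gd].
by rewrite (has_ps_derive (has_psD fc gd)) (has_ps_derive fc) (has_ps_derive gd).
Qed.

Lemma derive1M f g a : analytic f a -> analytic g a ->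
  derive1 (fun s => f s * g s) a = derive1 f a * g a + f a * derive1 g a.
Proof.
move=> [c fc] [d gd].
rewrite (has_ps_derive (has_psM fc gd)) (has_ps_derive fc) (has_ps_derive gd).
rewrite (has_ps_val fc) (has_ps_val gd) !big_ord_recl big_ord0/= addr0.
by rewrite subn0 subnn addrC.
Qed.

Lemma derive1_cst_C (k : C) a : derive1 (fun _ : C => k) a = 0.
Proof. by rewrite (has_ps_derive (has_ps_cst k a)). Qed.

Lemma derive1_sum (I : Type) (l : seq I) (P : pred I) (F : I -> C -> C) a :
  (forall i, P i -> analytic (F i) a) ->
  derive1 (fun s => \sum_(i <- l | P i) F i s) a = \sum_(i <- l | P i) derive1 (F i) a.
Proof.
move=> Fa; elim: l => [|i l IH].
  by under eq_fun do rewrite big_nil; rewrite derive1_cst_C big_nil.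
under eq_fun do rewrite big_cons; rewrite big_cons.
case: ifPn => // Pi; rewrite -IH; apply: derive1D; first exact: Fa.
exact: analytic_sum.
Qed.

Lemma derive1_eq f g a r : 0 < r -> (forall h, cmod h < r -> f (a + h) = g (a + h)) ->
  analytic f a -> derive1 f a = derive1 g a.
Proof.
move=> r0 fg [c fc]; rewrite (has_ps_derive fc).
by rewrite (has_ps_derive (has_ps_eq r0 fg fc)).
Qed.

Lemma derive1_shift f a b : analytic f (a + b) ->
  derive1 (fun s => f (s + b)) a = derive1 f (a + b).
Proof.
move=> [c fc]; by rewrite (has_ps_derive fc) (has_ps_derive (has_ps_shift fc)).
Qed.

Lemma derive1_id_C a : derive1 (@id C) a = 1.
Proof. by rewrite (has_ps_derive (has_ps_id a)). Qed.

End Analytic.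

(** * Local meromorphy and the identity theorem along segments *)

Section Meromorphic.
Variable R : realType.
Local Notation C := R[i].
Implicit Types (c d : nat -> C) (h a b v s : C) (f g F : C -> C) (r : R).

(** Values at a pole are arbitrary, so agreement is asked for on a punctured disc only. *)
Definition near_eq f g a := exists2 r : R, 0 < r &
  forall h, h != 0 -> cmod h < r -> f (a + h) = g (a + h).

Lemma near_eq_sym f g a : near_eq f g a -> near_eq g f a.
Proof. by move=> [r r0 fg]; exists r => // h h0 /(fg _ h0). Qed.

Lemma near_eq_trans g f k a : near_eq f g a -> near_eq g k a -> near_eq f k a.
Proof.
move=> [r r0 fg] [r' r'0 gk]; exists (Num.min r r'); first by rewrite lt_min r0.
by move=> h h0; rewrite lt_min => /andP[/(fg _ h0) -> /(gk _ h0)].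
Qed.

(** Equivalent to having a Laurent expansion at a, by [mero_laurent] and [laurent_mero], but easier
    to carry through sums, products and derivatives. *)
Definition mero f a := exists N g, analytic g a /\
  near_eq f (fun s => (s - a) ^- N * g s) a.

Lemma mero_eq f g a : near_eq f g a -> mero f a -> mero g a.
Proof.
move=> fg [N [k [ka fk]]]; exists N, k; split => //.
exact: near_eq_trans (near_eq_sym fg) fk.
Qed.

Lemma analytic_mero f a : analytic f a -> mero f a.
Proof.
by move=> fa; exists 0%N, f; split => //; exists 1 => // h _ _; rewrite expr0 invr1 mul1r.
Qed.

Lemma meroM f g a : mero f a -> mero g a -> mero (fun s => f s * g s) a.
Proof.
move=> [N [k [ka [r r0 fk]]]] [N' [k' [k'a [r' r'0 gk']]]].
exists (N + N')%N, (fun s => k s * k' s); split; first exact: analyticM.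
exists (Num.min r r'); first by rewrite lt_min r0.
move=> h h0; rewrite lt_min => /andP[/(fk _ h0) -> /(gk' _ h0) ->].
by rewrite mulrACA -invfM -exprD.
Qed.

Lemma analytic_subX a n b : analytic (fun s => (s - a) ^+ n) b.
Proof.
by apply: analyticX; apply: analyticB; [exact: analytic_id|exact: analytic_cst].
Qed.

Lemma meroD f g a : mero f a -> mero g a -> mero (fun s => f s + g s) a.
Proof.
move=> [N [k [ka [r r0 fk]]]] [N' [k' [k'a [r' r'0 gk']]]].
exists (N + N')%N, (fun s => (s - a) ^+ N' * k s + (s - a) ^+ N * k' s); split.
  by apply: analyticD; apply: analyticM => //; exact: analytic_subX.
exists (Num.min r r'); first by rewrite lt_min r0.
move=> h h0; rewrite lt_min => /andP[/(fk _ h0) -> /(gk' _ h0) ->].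
rewrite addrAC subrr add0r exprD; field.
by rewrite !expf_neq0.
Qed.

Lemma meroN f a : mero f a -> mero (fun s => - f s) a.
Proof.
move=> [N [k [ka [r r0 fk]]]]; exists N, (fun s => - k s); split; first exact: analyticN.
by exists r => // h h0 hr; rewrite fk// mulrN.
Qed.

Lemma mero_sum (I : Type) (l : seq I) (P : pred I) (F : I -> C -> C) a :
  (forall i, P i -> mero (F i) a) -> mero (fun s => \sum_(i <- l | P i) F i s) a.
Proof.
move=> Fa; elim: l => [|i l IH].
  by under eq_fun do rewrite big_nil; exact/analytic_mero/analytic_cst.
under eq_fun do rewrite big_cons.
by case: (boolP (P i)) => // Pi; apply: meroD => //; exact: Fa.
Qed.

Lemma mero_shift f a b : mero f (a + b) -> mero (fun s => f (s + b)) a.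
Proof.
move=> [N [k [ka [r r0 fk]]]]; exists N, (fun s => k (s + b)); split.
  exact: analytic_shift.
exists r => // h h0 hr; rewrite addrAC fk//.
by rewrite (_ : a + h - a = a + b + h - (a + b)) 1?(addrAC a h)//; ring.
Qed.

(** A point of the punctured disc has a full neighbourhood inside it, so equality there carries over
    to power series and derivatives. *)
Lemma near_eq_analytic f g a : near_eq f g a -> exists2 r : R, 0 < r &
  forall h, h != 0 -> cmod h < r -> analytic g (a + h) ->
  analytic f (a + h) /\ derive1 f (a + h) = derive1 g (a + h).
Proof.
move=> [r r0 fg]; exists r; first exact: r0.
move=> h h0 hr ga.
have m0 : 0 < Num.min (cmod h) (r - cmod h) by rewrite lt_min cmod_gt0 h0 subr_gt0.
have gf x : cmod x < Num.min (cmod h) (r - cmod h) -> g (a + h + x) = f (a + h + x).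
  rewrite lt_min -addrA => /andP[xh xr]; rewrite fg//.
    apply: contraTneq xh => /eqP; rewrite addr_eq0 => /eqP ->.
    by rewrite cmodN ltxx.
  by rewrite (le_lt_trans (cmodD _ _))// -ltrBrDl.
split; first exact: (analytic_eq m0 gf ga).
by symmetry; exact: (derive1_eq m0 gf ga).
Qed.

Lemma analytic_subXV a n h g : h != 0 -> analytic g (a + h) ->
  analytic (fun s => (s - a) ^- n * g s) (a + h).
Proof.
move=> h0 ga; apply: analyticM => //; apply: analyticV; last exact: analytic_subX.
by rewrite addrAC subrr add0r expf_neq0.
Qed.

Lemma mero_near f a : mero f a -> exists2 r : R, 0 < r &
  forall h, h != 0 -> cmod h < r -> analytic f (a + h).
Proof.
move=> [N [g [/analytic_near[r r0 ga] /near_eq_analytic[r' r'0 fg]]]].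
exists (Num.min r r'); first by rewrite lt_min r0.
move=> h h0; rewrite lt_min => /andP[hr hr']; have gah := ga _ hr.
by have [] := fg _ h0 hr' (analytic_subXV N h0 gah).
Qed.

Lemma derive1_subX a n b : derive1 (fun s => (s - a) ^+ n) b = n%:R * (b - a) ^+ n.-1.
Proof.
elim: n => [|n IH].
  by rewrite mul0r -(derive1_cst_C (1 : C) b).
under eq_fun do rewrite exprS.
rewrite derive1M; [|by apply: analyticB; [exact: analytic_id|exact: analytic_cst]|
  exact: analytic_subX].
rewrite IH derive1D ?derive1_id_C ?derive1_cst_C; [|exact: analytic_id|exact: analytic_cst].
rewrite addr0 mul1r mulrCA /=; case: n {IH} => [|n]; first by rewrite !mul0r addr0 mul1r.
by rewrite /= -exprS -[in RHS]addn1 natrD mulrDl mul1r addrC.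
Qed.

Lemma mero_derive f a : mero f a -> mero (derive1 f) a.
Proof.
move=> [N [g [ga /near_eq_analytic[r' r'0 fg]]]].
have [r r0 gar] := analytic_near ga.
exists N.+1, (fun s => - N%:R * g s + (s - a) * derive1 g s); split.
  apply: analyticD; apply: analyticM => //; first exact: analytic_cst.
    by apply: analyticB; [exact: analytic_id|exact: analytic_cst].
  exact: analytic_derive.
exists (Num.min r r'); first by rewrite lt_min r0.
move=> h h0; rewrite lt_min => /andP[hr hr'].
have gah := gar _ hr.
rewrite (fg _ h0 hr' _).2; last exact: analytic_subXV.
(* the product (s - a)^N * ((s - a)^-N g) = g is differentiated instead of the quotient *)
have han : analytic (fun s => (s - a) ^- N * g s) (a + h) by exact: analytic_subXV.
have m0 : 0 < cmod h by rewrite cmod_gt0.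
have ahK : a + h - a = h by rewrite addrAC subrr add0r.
have gE x : cmod x < cmod h ->
    (a + h + x - a) ^+ N * ((a + h + x - a) ^- N * g (a + h + x)) = g (a + h + x).
  move=> xh; rewrite mulrA divff ?mul1r// expf_neq0//.
  rewrite addrAC ahK; apply: contraTneq xh => /eqP.
  by rewrite addr_eq0 => /eqP ->; rewrite cmodN ltxx.
have := derive1_eq m0 gE (analyticM (analytic_subX _ _ _) han).
rewrite (derive1M (analytic_subX _ _ _) han).
rewrite derive1_subX !ahK => <-.
move: (derive1 _ _) (g (a + h)) => D G; case: N {fg han gE} => [|n].
  by rewrite oppr0 !mul0r !add0r expr0 mul1r expr1 mulKf.
rewrite /= !exprS; field.
by rewrite h0 expf_neq0.
Qed.

Lemma mero_derive1n n f a : mero f a -> mero (derive1n n f) a.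
Proof. by move=> fa; elim: n => //= n; exact: mero_derive. Qed.

Definition vanishing f a := near_eq f (fun=> 0) a.

(** After the pole is cleared, either some Taylor coefficient is nonzero and zeros are isolated, or
    all of them vanish and so does f near a. *)
Lemma mero_vanishing f a : mero f a -> ~ vanishing f a ->
  exists2 r : R, 0 < r & forall h, h != 0 -> cmod h < r -> f (a + h) != 0.
Proof.
move=> [N [g [[c gc] [r r0 fg]]]] nf.
have [[m cm0]|nc] := pselect (exists m, c m != 0).
  have [r' r'0 hr'] := has_ps_isolated gc (ex_intro _ m cm0).
  exists (Num.min r r'); first by rewrite lt_min r0.
  move=> h h0; rewrite lt_min => /andP[h1 h2].
  by rewrite fg// addrAC subrr add0r mulf_neq0 ?invr_neq0 ?expf_neq0 ?hr'.
have c0 n : c n = 0 by apply: contrapT => /eqP cn; apply: nc; exists n.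
case: nf; have [r' [r'0 _ gc']] := gc.
exists (Num.min r r'); first by rewrite lt_min r0.
move=> h h0; rewrite lt_min => /andP[h1 h2]; rewrite fg//.
rewrite (_ : g (a + h) = 0) ?mulr0//; apply: (ccvg_uniq (gc' _ h2)).
by under eq_fun do (rewrite big1; last by move=> i _; rewrite c0 mul0r); exact: ccvg_cst.
Qed.

Lemma vanishing_near f a : vanishing f a -> exists2 r : R, 0 < r &
  forall h, cmod h < r -> vanishing f (a + h).
Proof.
move=> [r r0 fr]; exists r => // h hr; have [->|h0] := eqVneq h 0.
  by rewrite addr0; exists r.
exists (Num.min (cmod h) (r - cmod h)); first by rewrite lt_min cmod_gt0 h0 subr_gt0.
move=> x x0; rewrite lt_min -addrA => /andP[xh xr]; rewrite fr//.
  apply: contraTneq xh => /eqP; rewrite addr_eq0 => /eqP ->.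
  by rewrite cmodN ltxx.
by rewrite (le_lt_trans (cmodD _ _))// -ltrBrDl.
Qed.

(** Connectedness of [0, 1] by suprema: x is the end of the initial stretch on which f vanishes
    locally. At [p x] the alternative in [mero_vanishing] leaves only vanishing, which is an open
    condition, so x = 1. *)
Lemma identity_segment f a b :
  (forall x : R, 0 <= x <= 1 -> mero f (a + x%:C * (b - a))) ->
  vanishing f a -> vanishing f b.
Proof.
move=> mf va; pose p (x : R) := a + x%:C * (b - a).
have pD (x y : R) : p (x + y) = p x + y%:C * (b - a).
  by rewrite /p rmorphD mulrDl addrA.
pose T := [set x : R | 0 <= x <= 1 /\ forall y, 0 <= y <= x -> vanishing f (p y)].
have T0 : T 0.
  split; first by rewrite lexx ler01.
  by move=> y; rewrite -eq_le => /eqP <-; rewrite /p mul0r addr0.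
have Tsup : has_sup T.
  by split; [exists 0|exists 1 => x [/andP[]]].
set x := sup T.
have x01 : 0 <= x <= 1.
  rewrite ub_le_sup//=; last by exists 1 => y [/andP[]].
  by apply: ge_sup; [exists 0|move=> y [/andP[]]].
set K := cmod (b - a) + 1; have K0 : 0 < K by rewrite ltr_wpDl ?cmod_ge0.
have pK (r y : R) : 0 < r -> `|y| < r / K -> cmod (y%:C * (b - a)) < r.
  move=> r0; rewrite ltr_pdivlMr// cmodM cmodR; apply: le_lt_trans.
  by rewrite ler_wpM2l// lerDl.
have vx : vanishing f (p x).
  apply: contrapT => nv; have [r r0 fr] := mero_vanishing (mf _ x01) nv.
  have [y Ty xy] := sup_adherent (divr_gt0 r0 K0) Tsup.
  have yx : y <= x by apply: ub_le_sup => //; exists 1 => ? [/andP[]].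
  case: Ty => /andP[y0 y1] /(_ y); rewrite y0 lexx => /(_ isT).
  move=> [r' r'0 fr'].
  have hxy : cmod ((y - x)%:C * (b - a)) < r.
    by apply: pK => //; rewrite distrC ger0_norm ?subr_ge0// ltrBlDl -ltrBlDr.
  set h := (y - x)%:C * (b - a) in hxy.
  have ph : p y = p x + h by rewrite -pD addrC subrK.
  have [h0|h0] := eqVneq h 0.
    by apply: nv; exists r' => // k k0 kr; have := fr' k k0 kr; rewrite ph h0 addr0.
  (* The point at distance m / 2 from [p y] lies in both punctured discs: f vanishes there because
     it is near [p y], and does not because it is near [p x]. *)
  set m := Num.min (cmod h) (Num.min r' (r - cmod h)).
  have m0 : 0 < m by rewrite !lt_min cmod_gt0 h0 r'0 subr_gt0.
  have mm : m / 2%:R < m by lra.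
  have [mh mr' mr] : [/\ m / 2%:R < cmod h, m / 2%:R < r' & m / 2%:R < r - cmod h].
    by move: mm; rewrite {2}/m !lt_min => /and3P[].
  have cm : cmod ((m / 2%:R)%:C : C) = m / 2%:R by rewrite cmodR gtr0_norm// divr_gt0.
  have k0 : ((m / 2%:R)%:C : C) != 0 by rewrite -cmod_gt0 cm divr_gt0.
  have := fr' _ k0; rewrite cm => /(_ mr').
  rewrite ph -addrA => /eqP; apply/negP; apply: fr.
    apply: contraTneq mh => /eqP; rewrite addr_eq0 => /eqP ->.
    by rewrite cmodN cm ltxx.
  by rewrite (le_lt_trans (cmodD _ _))// cm -ltrBrDl.
have [r r0 vr] := vanishing_near vx.
have near y : `|y - x| < r / K -> vanishing f (p y).
  move=> yx; rewrite -[y](subrK x) addrC pD; apply: vr; exact: pK.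
have Tz z : 0 <= z <= 1 -> z < x + r / K -> T z.
  move=> z01 zx; split => // y /andP[y0 yz].
  have [yx|xy] := ltP y (x - r / K / 2%:R).
    have e0 : 0 < r / K / 2%:R by rewrite !divr_gt0.
    have [w [w01 Tw] xw] := sup_adherent e0 Tsup.
    by apply: Tw; rewrite y0/= ltW// (lt_trans yx).
  apply: near; have rK : 0 < r / K by rewrite divr_gt0.
  rewrite ltr_norml; apply/andP; split; lra.
have rK : 0 < r / K by rewrite divr_gt0.
have [x1|x1] := ltP x 1.
  (* For x < 1 this is a point of [T] beyond its supremum. *)
  set z := Num.min 1 (x + r / K / 2%:R).
  have : T z.
    apply: Tz; last by rewrite gt_min; apply/orP; right; lra.
    rewrite le_min ler01 ge_min lexx/= andbT; have /andP[] := x01; lra.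
  move=> /(ub_le_sup _) -/(_ (ex_intro _ 1 _)); rewrite -/x => /(_ _)/wrap.
  move=> [|]; first by move=> ? [/andP[]].
  by rewrite leNgt lt_min x1/= ltrDl divr_gt0.
have x1' : x = 1 by apply/eqP; rewrite eq_le x1 andbT; have /andP[] := x01.
by move: vx; rewrite x1' /p mul1r addrC subrK.
Qed.

End Meromorphic.

(** * Laurent expansions and their coefficients *)

Section Laurent.
Variable R : realType.
Local Notation C := R[i].
Implicit Types (h a b v s : C) (f g F G : C -> C) (r : R).

Lemma gt0_complex (e : C) : 0 < e -> e = (complex.Re e)%:C /\ 0 < complex.Re e.
Proof. by case: e => x y; rewrite ltcE/= => /andP[/eqP -> ->]. Qed.

Lemma near_dnbhsP (P : C -> Prop) a : (\forall s \near a^', P s) <->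
  exists2 r : R, 0 < r & forall h, h != 0 -> cmod h < r -> P (a + h).
Proof.
split.
  move=> /nbhs_ballP[e /= e0 he]; have [er e0'] := gt0_complex e0.
  exists (complex.Re e) => // h h0 hr; apply: he; last first.
    by rewrite -subr_eq0 addrAC subrr add0r.
  by rewrite /ball/= opprD addrA subrr sub0r normrN er ltcR.
move=> [r r0 h]; apply/nbhs_ballP; exists r%:C; first by rewrite /= ltcR.
move=> s; rewrite /ball/= => sr sa.
rewrite (_ : s = a + (s - a)); last by rewrite addrC subrK.
by apply: h; [rewrite subr_eq0|move: sr; rewrite distrC ltcR].
Qed.

Lemma exprz_subn h (k N : nat) : h != 0 -> h ^ (k%:Z - N%:Z) = h ^+ k * h ^- N.
Proof. by move=> h0; rewrite expfzDr// exprnN. Qed.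

Lemma ccvg_shiftn (u : nat -> C) l j : ccvg (fun n => u (n + j)%N) l -> ccvg u l.
Proof.
move=> ul e /ul[N h]; exists (N + j)%N => n Nn.
have jn : (j <= n)%N by rewrite (leq_trans _ Nn)// leq_addl.
by rewrite -(subnK jn); apply: h; rewrite -(leq_add2r j) subnK.
Qed.

Lemma has_ps_mulX g a (c : nat -> C) j : has_ps g a c ->
  has_ps (fun s => (s - a) ^+ j * g s) a (fun k => if (k < j)%N then 0 else c (k - j)%N).
Proof.
move=> [r [r0 [M hM] gc]]; exists r; split => //.
  have M0 : 0 <= M by rewrite (le_trans _ (hM 0%N))// expr0 mulr1 cmod_ge0.
  exists (M * r ^+ j) => n; case: ltnP => [_|jn].
    by rewrite cmod0 mul0r mulr_ge0// exprn_ge0// ltW.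
  by rewrite -{2}(subnK jn) exprD mulrA ler_wpM2r// exprn_ge0// ltW.
move=> h hr; rewrite addrAC subrr add0r; apply: (@ccvg_shiftn _ _ j).
apply: eq_ccvg (ccvgMl (h ^+ j) (gc _ hr)) => N.
rewrite addnC -(big_mkord xpredT (fun k => (if (k < j)%N then 0 else c (k - j)%N) * h ^+ k)).
rewrite (big_cat_nat (n := j))//=; last by rewrite leq_addr.
rewrite [X in _ = X + _]big_nat_cond [X in _ = X + _]big1 ?add0r; last first.
  by move=> i; rewrite andbT => /andP[_ ->]; rewrite mul0r.
rewrite -[X in \sum_(X <= _ < _) _](add0n j) big_addn big_mkord addnC addnK mulr_sumr; apply: eq_bigr => k _.
by rewrite ltnNge leq_addl/= addnK addnC exprD mulrCA.
Qed.

(** Multiplication by (s - a)^N turns the expansion into a power series. Its terms at the single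
    point r / 2 are bounded because it converges there, whence a radius of at least r / 2. *)
Lemma laurentP F a (c : int -> C) : laurent_expansion F a c ->
  exists (N : nat) g, [/\ forall m : int, m < - N%:Z -> c m = 0,
    has_ps g a (fun k => c (k%:Z - N%:Z)) & near_eq F (fun s => (s - a) ^- N * g s) a].
Proof.
move=> [N [cN /near_dnbhsP[r r0 hF]]].
(* The value at a is the lowest coefficient, as g has to be analytic there. *)
exists N, (fun s => if s == a then c (- N%:Z) else (s - a) ^+ N * F s).
have ser h : h != 0 -> cmod h < r -> pser (fun k => c (k%:Z - N%:Z)) h (h ^+ N * F (a + h)).
  move=> h0 hr; have := hF _ h0 hr; rewrite ccvgP => /(ccvgMl (h ^+ N)).
  apply: eq_ccvg => n; rewrite /series/= big_mkord mulr_sumr.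
  apply: eq_bigr => k _; rewrite addrAC subrr add0r exprz_subn//.
  by rewrite mulrCA (mulrCA (h ^+ N)) divff ?mulr1// expf_neq0.
split => //; last first.
  exists r => // h h0 hr; rewrite addrAC subrr add0r -subr_eq0 addrAC subrr add0r.
  by rewrite (negbTE h0) mulrA mulVf ?mul1r// expf_neq0.
have x0 : 0 < r / 2%:R by rewrite divr_gt0.
have xr : r / 2%:R < r by lra.
have cx : cmod ((r / 2%:R)%:C : C) = r / 2%:R by rewrite cmodR gtr0_norm.
have xn0 : ((r / 2%:R)%:C : C) != 0 by rewrite -cmod_gt0 cx.
have := ser _ xn0; rewrite cx => /(_ xr)/ccvg_bounded[B hB].
exists (r / 2%:R); split => //.
  exists (B + B) => n; rewrite -cx -cmodX -cmodM.
  have := hB n.+1; rewrite big_ord_recr/= => h1.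
  rewrite -[X in cmod X](addKr (\sum_(k < n) c (k%:Z - N%:Z) * ((r / 2%:R)%:C : C) ^+ k)).
  by rewrite (le_trans (cmodD _ _))// cmodN lerD.
move=> h hr; have [->|h0] := eqVneq h 0.
  by rewrite addr0 eqxx -[X in c X]sub0r; exact: pser0.
rewrite -subr_eq0 addrAC subrr add0r (negbTE h0); apply: ser => //; exact: lt_trans xr.
Qed.

Lemma laurent_intro F a N g (d : nat -> C) : has_ps g a d ->
  near_eq F (fun s => (s - a) ^- N * g s) a ->
  laurent_expansion F a (fun m : int => if m < - N%:Z then 0 else d (absz (m + N%:Z))).
Proof.
move=> [r [r0 _ gd]] [r' r'0 FG]; exists N; split => [m ->//|].
apply/near_dnbhsP; exists (Num.min r r'); first by rewrite lt_min r0.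
move=> h h0; rewrite lt_min => /andP[hr hr']; rewrite (FG _ h0 hr').
rewrite ccvgP addrAC subrr add0r; apply: eq_ccvg (ccvgMl (h ^- N) (gd _ hr)) => n.
rewrite /series/= big_mkord mulr_sumr; apply: eq_bigr => k _.
rewrite exprz_subn// subrK absz_nat.
have -> : (k%:Z - N%:Z < - N%:Z) = false by lia.
by rewrite mulrCA; congr (_ * _); exact: mulrC.
Qed.

Lemma laurent_expansion_near_eq F G a c : near_eq F G a ->
  laurent_expansion F a c -> laurent_expansion G a c.
Proof.
move=> [r r0 FG] [N [cN /near_dnbhsP[r' r'0 hF]]]; exists N; split => //.
apply/near_dnbhsP; exists (Num.min r r'); first by rewrite lt_min r0.
by move=> h h0; rewrite lt_min => /andP[hr hr']; rewrite -(FG _ h0 hr); exact: hF.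
Qed.

(** Over the common denominator (s - a)^(N + N') both expansions become power series, which are
    unique; the indices are then shifted back. *)
Lemma laurent_unique F a (c d : int -> C) : laurent_expansion F a c ->
  laurent_expansion F a d -> c = d.
Proof.
move=> /laurentP[N [g [cN gc Fg]]] /laurentP[N' [g' [dN g'd Fg']]].
have [r r0 gg'] := near_eq_trans (near_eq_sym Fg) Fg'.
have key h : h != 0 -> cmod h < r ->
    (a + h - a) ^+ N' * g (a + h) = (a + h - a) ^+ N * g' (a + h).
  move=> h0 hr; have := gg' _ h0 hr; rewrite addrAC subrr add0r => e.
  have hn n : h ^+ n != 0 by rewrite expf_neq0.
  apply: (mulfI (invr_neq0 (hn (N + N')%N))).
  rewrite exprD invfM -!mulrA (mulrA (h ^- N') (h ^+ N')) mulVf// mul1r e.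
  by rewrite [in RHS]mulrCA [in RHS](mulrA (h ^- N)) mulVf// mul1r.
have E := has_ps_unique (has_ps_mulX N' gc) (has_ps_mulX N g'd) r0 key.
apply/funext => m; have [mN|Nm] := ltP m (- (N + N')%:Z).
  by rewrite cN ?dN//; lia.
have [k Ek] : exists k : nat, m = k%:Z - (N + N')%:Z.
  exists (absz (m + (N + N')%:Z)); rewrite gez0_abs; lia.
move: (congr1 (fun u => u k) E); rewrite Ek /=; case: ltnP => kN'; case: ltnP => kN.
- by rewrite cN ?dN//; lia.
- move=> e; rewrite cN; last by lia.
  by rewrite e; congr d; lia.
- move=> e; rewrite dN; last by lia.
  by rewrite -e; congr c; lia.
- by move=> e; rewrite (_ : k%:Z - _ = (k - N')%N%:Z - N%:Z) ?e; [congr d|]; lia.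
Qed.

Lemma laurent_coefE F a c : laurent_expansion F a c -> laurent_coef F a = c.
Proof.
move=> Fc; rewrite /laurent_coef; case: xgetP => [d _ Fd|/(_ c)//].
exact: laurent_unique Fd Fc.
Qed.

Lemma mero_laurent F a : mero F a -> exists c, laurent_expansion F a c.
Proof. by move=> [N [g [[d gd] /(laurent_intro gd)]]]; eexists; eassumption. Qed.

Lemma laurent_mero F a c : laurent_expansion F a c -> mero F a.
Proof. by move=> /laurentP[N [g [_ gc Fg]]]; exists N, g; split => //; eexists; exact: gc. Qed.

Lemma laurent_analytic F f a (c : nat -> C) : has_ps f a c -> near_eq F f a ->
  laurent_expansion F a (fun m : int => if m < 0 then 0 else c (absz m)).
Proof.
move=> fc Ff; have := @laurent_intro F a 0 f c fc; rewrite oppr0.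
rewrite (_ : (fun m : int => if m < 0 then 0 else c (absz m)) =
    (fun m : int => if m < 0 then 0 else c (absz (m + 0%:Z)))); last first.
  by apply/funext => m; rewrite -[0%:Z]/(0 : int) addr0.
apply; apply: near_eq_trans Ff _; exists 1 => // h _ _.
by rewrite expr0 invr1 mul1r.
Qed.

Lemma near_eq_refl f a : near_eq f f a.
Proof. by exists 1. Qed.

Lemma Pf_near_eq F f a : analytic f a -> near_eq F f a -> Pf F a = f a.
Proof.
move=> [c fc] Ff; rewrite /Pf (laurent_coefE (laurent_analytic fc Ff)) ltxx.
by rewrite (has_ps_val fc).
Qed.

Lemma Pf_analytic f a : analytic f a -> Pf f a = f a.
Proof. by move=> fa; apply: Pf_near_eq => //; exact: near_eq_refl. Qed.

Lemma Res_simple_pole F g a : analytic g a ->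
  near_eq F (fun s => (s - a)^-1 * g s) a -> Res F a = g a.
Proof.
move=> [c gc] Fg; rewrite /Res (laurent_coefE (laurent_intro (N := 1) gc _)).
  by rewrite ltxx addNr absz0 (has_ps_val gc).
by move: Fg; under eq_fun do rewrite -[_ - a]expr1.
Qed.

Lemma near_eq_Pf F a : mero F a -> near_eq (Pf F) F a.
Proof.
by move=> /mero_near[r r0 h]; exists r => // x x0 xr; rewrite Pf_analytic//; exact: h.
Qed.

(** Replacing F by its constant terms changes nothing off the singularities and repairs the value at
    removable ones, which [meromorphic] prescribes. *)
Lemma meromorphic_Pf F : (forall a, mero F a) -> meromorphic (Pf F).
Proof.
move=> mF a; have [c Fc] := mero_laurent (mF a); exists c; split.
  exact: laurent_expansion_near_eq (near_eq_sym (near_eq_Pf (mF a))) Fc.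
by move=> _; rewrite /Pf (laurent_coefE Fc).
Qed.

Lemma meromorphic_mero F a : meromorphic F -> mero F a.
Proof. by move=> /(_ a)[c [/laurent_mero]]. Qed.

(** The clause on removable singularities in [meromorphic] upgrades equality on a punctured disc to
    equality at the centre. This makes the derivative at s = 0 accessible. *)
Lemma meromorphic_analytic F f a : meromorphic F -> analytic f a -> near_eq F f a ->
  regular_at F a /\ exists2 r : R, 0 < r & forall h, cmod h < r -> F (a + h) = f (a + h).
Proof.
move=> /(_ a)[c [Fc c0]] [d fd] Ff.
have E := laurent_unique Fc (laurent_analytic fd Ff).
have cn (m : int) : m < 0 -> c m = 0 by move=> m0; rewrite E m0.
split; first by exists c; split => //; exact: c0.
have [r r0 h] := Ff; exists r => // x xr.
have [->|x0] := eqVneq x 0; last exact: h.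
by rewrite addr0 c0// E ltxx (has_ps_val fd).
Qed.

Lemma identity_theorem F G a b : (forall x : R, 0 <= x <= 1 ->
    mero F (a + x%:C * (b - a)) /\ mero G (a + x%:C * (b - a))) ->
  near_eq F G a -> near_eq F G b.
Proof.
move=> mFG [r r0 FG].
suff [r' r'0 h'] : vanishing (fun s => F s - G s) b.
  by exists r' => // h h0 hr; apply/eqP; rewrite -subr_eq0; apply/eqP; exact: h'.
apply: (@identity_segment _ _ a).
  by move=> x /mFG[mF mG]; apply: meroD => //; exact: meroN.
by exists r => // h h0 hr; rewrite FG// subrr.
Qed.

End Laurent.

(** * The complex exponential and logarithm *)

Section ComplexExp.
Variable R : realType.
Local Notation C := R[i].
Implicit Types (z w h k a : C) (x y t : R).

Lemma Re_cexp z : complex.Re (cexp z) = expR (complex.Re z) * cos (complex.Im z).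
Proof. by []. Qed.

Lemma Im_cexp z : complex.Im (cexp z) = expR (complex.Re z) * sin (complex.Im z).
Proof. by []. Qed.

Lemma cexpD z w : cexp (z + w) = cexp z * cexp w.
Proof.
apply: complexP; rewrite ?cReM ?cImM !Re_cexp !Im_cexp !cReD !cImD expRD ?cosD ?sinD; ring.
Qed.

Lemma cexp_real x : cexp x%:C = (expR x)%:C.
Proof. by rewrite /cexp /= cos0 sin0 mulr1 mulr0. Qed.

Lemma cexp0 : cexp (0 : C) = 1.
Proof. by rewrite (_ : 0 = (0 : R)%:C)// cexp_real expR0. Qed.

Lemma cmod_cexp z : cmod (cexp z) = expR (complex.Re z).
Proof.
rewrite cmod_def Re_cexp Im_cexp !exprMn -mulrDr cos2Dsin2 mulr1.
by rewrite sqrtr_sqr ger0_norm// expR_ge0.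
Qed.

Lemma cexp_natl n z : cexp (n%:R * z) = cexp z ^+ n.
Proof.
elim: n => [|n IH]; first by rewrite mul0r cexp0.
by rewrite -addn1 natrD mulrDl mul1r cexpD IH exprD expr1.
Qed.

Definition expc (n : nat) : C := (n`!%:R)^-1.

Lemma pow_i_even n : (0 +i* 1 : C) ^+ n.*2 = ((-1) ^+ n)%:C.
Proof.
by rewrite -mul2n exprM sqr_i rmorphXn/= rmorphN1.
Qed.

Lemma cexp_i_coeff y n : expc n * ((0 +i* y) ^+ n) = cos_coeff y n +i* sin_coeff y n.
Proof.
have -> : (0 +i* y : C) = y%:C * (0 +i* 1).
  by apply: complexP; rewrite ?cReM ?cImM/=; ring.
have -> : expc n = (n`!%:R^-1)%:C by rewrite /expc fmorphV rmorph_nat.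
have si (m : nat) : (-1 : R) ^ m = (-1) ^+ m by [].
rewrite exprMn -rmorphXn/= /cos_coeff /sin_coeff/= !si.
rewrite -[in (0 +i* 1) ^+ n](odd_double_half n) exprD pow_i_even.
case: (odd n) (odd_double_half n) => /= e.
  have -> : n.-1./2 = n./2 by rewrite -e /= doubleK uphalf_double.
    rewrite expr1; move: ((-1) ^+ _) (y ^+ _) (_^-1) => u v w.
  apply: complexP; rewrite !(cReM, cImM)/=.
    by rewrite !(mulr0, mul0r, subr0, add0r, addr0, sub0r, mul1r, oppr0).
  rewrite !(mulr0, mul0r, subr0, add0r, addr0, sub0r, mul1r, oppr0).
  ring.
rewrite expr0 mul1r; move: ((-1) ^+ _) ((-1) ^+ _) (y ^+ _) (_^-1) => u u' v w.
apply: complexP; rewrite !(cReM, cImM)/=.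
  rewrite !(mulr0, mul0r, subr0, add0r, addr0, sub0r, mul1r, oppr0).
  ring.
rewrite !(mulr0, mul0r, subr0, add0r, addr0, sub0r, mul1r, oppr0).
by [].
Qed.

Lemma pser_cexp_i y : pser expc (0 +i* y) (cexp (0 +i* y)).
Proof.
have E N : \sum_(k < N) expc k * (0 +i* y) ^+ k =
    series (cos_coeff y) N +i* series (sin_coeff y) N.
  rewrite /series/= !big_mkord; apply: complexP; rewrite ?cRe_sum ?cIm_sum/=;
  by apply: eq_bigr => k _; rewrite cexp_i_coeff.
apply: ccvg_ReIm.
  under eq_fun do rewrite E/=; rewrite Re_cexp/= expR0 mul1r cos.unlock.
  exact: is_cvg_series_cos_coeff.
under eq_fun do rewrite E/=; rewrite Im_cexp/= expR0 mul1r sin.unlock.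
exact: is_cvg_series_sin_coeff.
Qed.

Lemma exp_sum_le (x : R) N : 0 <= x -> \sum_(k < N) (k`!%:R)^-1 * x ^+ k <= expR x.
Proof.
move=> x0; rewrite /expR.
have -> : \sum_(k < N) (k`!%:R)^-1 * x ^+ k = series (exp_coeff x) N.
  by rewrite /series/= big_mkord; apply: eq_bigr => k _; rewrite mulrC.
apply: nondecreasing_cvgn_le; last exact: is_cvg_series_exp_coeff.
by apply: nondecreasing_series => *; exact: exp_coeff_ge0.
Qed.

Lemma cmod_expc n : cmod (expc n) = (n`!%:R)^-1.
Proof. by rewrite cmodV cmod_nat. Qed.

Lemma cexp_sum_le h N : \sum_(k < N) cmod (expc k * h ^+ k) <= expR (cmod h).
Proof.
rewrite (le_trans _ (exp_sum_le N (cmod_ge0 h)))//.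
by apply: ler_sum => k _; rewrite cmodM cmodX cmod_expc.
Qed.

Lemma pser_cexp_real x : pser expc x%:C (cexp x%:C).
Proof.
have E N : \sum_(k < N) expc k * x%:C ^+ k = (series (exp_coeff x) N)%:C.
  rewrite /series/= big_mkord rmorph_sum; apply: eq_bigr => k _.
  by rewrite /expc/= rmorphM rmorphXn/= fmorphV rmorph_nat mulrC.
rewrite cexp_real; apply: ccvg_ReIm.
  by under eq_fun do rewrite E/=; exact: is_cvg_series_exp_coeff.
by under eq_fun do rewrite E/=; exact: cvg_cst.
Qed.

(** The real series of exp, cos and sin give those of e^x and e^(iy); by the binomial theorem their
    Cauchy product is the exponential series at x + iy. *)
Lemma pser_cexp h : pser expc h (cexp h).
Proof.
case: h => x y; have xy : x +i* y = x%:C + (0 +i* y).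
  by apply: complexP; rewrite ?cReD ?cImD/= ?addr0 ?add0r.
rewrite xy cexpD /pser.
have := @cauchy_product _ (fun m => expc m * x%:C ^+ m)
  (fun m => expc m * (0 +i* y) ^+ m) _ _ (expR (cmod (x%:C : C)))
  (cexp_sum_le _) (pser_cexp_real x) (pser_cexp_i y).
apply: eq_ccvg => N; apply: eq_bigr => n _; rewrite addrC exprDn mulr_sumr; apply: eq_bigr => k _.
have kn : (k <= n)%N by rewrite leq_ord.
rewrite /expc -[_ *+ 'C(_, _)]mulr_natr -(bin_fact kn) !natrM.
have f0 m : (m`!%:R : C) != 0 by rewrite pnatr_eq0 -lt0n fact_gt0.
have b0 : ('C(n, k)%:R : C) != 0 by rewrite pnatr_eq0 -lt0n bin_gt0.
by field; rewrite !f0 b0.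
Qed.

Lemma has_ps_cexp k a : has_ps (fun s => cexp (k * s)) a
  (fun n => cexp (k * a) * (expc n * k ^+ n)).
Proof.
exists 1; split => //.
  exists (cmod (cexp (k * a)) * expR (cmod k)) => n; rewrite expr1n mulr1 cmodM.
  rewrite ler_wpM2l ?cmod_ge0// (le_trans _ (cexp_sum_le k n.+1))//.
  by rewrite big_ord_recr/= lerDr sumr_ge0// => i _; rewrite cmod_ge0.
move=> h _; rewrite mulrDr cexpD.
apply: eq_ccvg (ccvgMl (cexp (k * a)) (pser_cexp (k * h))) => N.
by rewrite mulr_sumr; apply: eq_bigr => n _; rewrite exprMn !mulrA.
Qed.

Lemma analytic_cexp k a : analytic (fun s => cexp (k * s)) a.
Proof. by eexists; exact: has_ps_cexp. Qed.

Lemma derive1_cexp k a : derive1 (fun s => cexp (k * s)) a = k * cexp (k * a).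
Proof.
by rewrite (has_ps_derive (has_ps_cexp k a)) /expc/= invr1 mul1r expr1 mulrC.
Qed.

Lemma carg_cos_sin z : z != 0 ->
  cmod z * cos (carg z) = complex.Re z /\ cmod z * sin (carg z) = complex.Im z.
Proof.
move=> z0; have m0 : 0 < cmod z by rewrite cmod_gt0.
have u1 : -1 <= complex.Re z / cmod z <= 1.
  by rewrite -ler_norml normrM normfV (gtr0_norm m0) ler_pdivrMr// mul1r cmod_Re.
have ca : cos (acos (complex.Re z / cmod z)) = complex.Re z / cmod z.
  by rewrite acosK// inE/= in_itv.
have sa : sin (acos (complex.Re z / cmod z)) = `|complex.Im z| / cmod z.
  rewrite sin_acos// -[RHS]ger0_norm ?divr_ge0 ?(ltW m0)// -sqrtr_sqr; congr Num.sqrt.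
  rewrite !expr_div_n real_normK ?num_real// -(mulfV (x := cmod z ^+ 2)); last first.
    by rewrite expf_neq0// gt_eqF.
  by rewrite -mulrBl {1}cmod_sqr addrAC subrr add0r.
rewrite /carg -[complex.Re `|z|]/(cmod z).
have mz : cmod z != 0 by rewrite gt_eqF.
case: (leP 0 (complex.Im z)) => i0.
  by rewrite ca sa ger0_norm// !(mulrCA (cmod z)) divff// !mulr1.
rewrite cosN sinN ca sa ltr0_norm// mulNr opprK.
by rewrite !(mulrCA (cmod z)) divff// !mulr1.
Qed.

Lemma clogK z : z != 0 -> cexp (clog z) = z.
Proof.
move=> z0; have [c s] := carg_cos_sin z0.
have lm : expR (ln (complex.Re `|z|)) = cmod z by rewrite lnK// posrE cmod_gt0.
by apply: complexP; rewrite ?Re_cexp ?Im_cexp /clog/= lm.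
Qed.

Lemma clog_real x : 0 < x -> clog x%:C = (ln x)%:C.
Proof.
move=> x0; have cx : cmod (x%:C : C) = x by rewrite cmodR gtr0_norm.
apply: complexP; rewrite /clog.
  by rewrite -[complex.Re `|x%:C|]/(cmod x%:C) cx.
rewrite -[complex.Im _]/(carg x%:C) Im_real /carg -[complex.Re `|x%:C|]/(cmod x%:C) cx.
by rewrite Re_real Im_real lexx divff ?gt_eqF// acos1.
Qed.

(** The arccosine in [carg] is singular on the positive real axis; on the right half-plane the
    arctangent is a smooth substitute. *)
Lemma carg_atan z : 0 < complex.Re z -> carg z = atan (complex.Im z / complex.Re z).
Proof.
move=> r0; have z0 : z != 0 by apply: contraTneq r0 => ->; rewrite ltxx.
have m0 : 0 < cmod z by rewrite cmod_gt0.
have [c s] := carg_cos_sin z0.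
have c0 : 0 < cos (carg z) by rewrite -(pmulr_rgt0 _ m0) c.
have -> : complex.Im z / complex.Re z = tan (carg z).
  rewrite -c -s /tan -mulf_div divff ?gt_eqF// mul1r.
  by [].
rewrite tanK// in_itv/=.
have u1 : -1 <= complex.Re z / cmod z <= 1.
  by rewrite -ler_norml normrM normfV (gtr0_norm m0) ler_pdivrMr// mul1r cmod_Re.
set u := complex.Re z / cmod z in u1.
have u0 : 0 < u by rewrite divr_gt0.
have p0 : 0 < pi / 2 :> R by rewrite divr_gt0// pi_gt0.
have h1 : 0 <= acos u by rewrite acos_ge0.
have h2 : acos u < pi / 2.
  rewrite ltNge; apply/negP => h.
  have : cos (acos u) <= 0.
    rewrite -(cos_pihalf R); have := @acos_lepi _ _ u1.
    move: h; rewrite le_eqVlt => /predU1P[<-//|h] hpi.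
    by rewrite ltW// ltr_cos// in_itv/= ?h1 ?hpi//; apply/andP; split; lra.
  by rewrite acosK ?inE/= ?in_itv//= leNgt u0.
rewrite /carg -[complex.Re `|z|]/(cmod z) -/u.
by case: ifP => _; apply/andP; split; lra.
Qed.

End ComplexExp.

(** * Derivatives of complex functions of a real variable *)

Section RealDerivative.
Variable R : realType.
Local Notation C := R[i].
Implicit Types (f g : R -> C) (t : R) (d e k : C).

(* Derivative of a function of a real variable; MathComp-Analysis's derive1 at R[i] is the
   complex one. *)
Definition cder f t d := is_derive t 1 (fun x => complex.Re (f x)) (complex.Re d) /\
  is_derive t 1 (fun x => complex.Im (f x)) (complex.Im d).

Lemma is_derive_mul (F G : R -> R) t (a b : R) : is_derive t 1 F a ->
  is_derive t 1 G b -> is_derive t 1 (fun x => F x * G x) (a * G t + F t * b).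
Proof.
move=> Fa Gb; apply: (is_derive_eq (is_deriveM Fa Gb)).
by rewrite /GRing.scale/= addrC (mulrC a).
Qed.

Lemma is_derive_comp_real (E F : R -> R) t (a e : R) : is_derive (F t) 1 E e ->
  is_derive t 1 F a -> is_derive t 1 (fun x => E (F x)) (e * a).
Proof. by move=> Ee Fa; exact: is_derive1_comp Ee Fa. Qed.

Lemma cderM f g t d e : cder f t d -> cder g t e ->
  cder (fun x => f x * g x) t (d * g t + f t * e).
Proof.
move=> [f1 f2] [g1 g2]; split.
  have -> : (fun x => complex.Re (f x * g x)) = (fun x => complex.Re (f x) * complex.Re (g x))
      - (fun x => complex.Im (f x) * complex.Im (g x)).
    by apply/funext => x; rewrite cReM.
  apply: (is_derive_eq (is_deriveB (is_derive_mul f1 g1) (is_derive_mul f2 g2))).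
  by rewrite cReD !cReM; ring.
have -> : (fun x => complex.Im (f x * g x)) = (fun x => complex.Re (f x) * complex.Im (g x))
    + (fun x => complex.Im (f x) * complex.Re (g x)).
  by apply/funext => x; rewrite cImM.
apply: (is_derive_eq (is_deriveD (is_derive_mul f1 g2) (is_derive_mul f2 g1))).
by rewrite cImD !cImM; ring.
Qed.

Lemma cder_cexp f t d : cder f t d -> cder (fun x => cexp (f x)) t (d * cexp (f t)).
Proof.
move=> [f1 f2]; have ef := is_derive_comp_real (is_derive_expR _) f1; split.
  apply: (is_derive_eq (is_derive_mul ef (is_derive_comp_real (is_derive_cos _) f2))).
  by rewrite cReM Re_cexp Im_cexp; ring.
apply: (is_derive_eq (is_derive_mul ef (is_derive_comp_real (is_derive_sin _) f2))).
by rewrite cImM Re_cexp Im_cexp; ring.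
Qed.

Lemma cder_cst k t : cder (fun=> k) t 0.
Proof. by split; exact: is_derive_cst. Qed.

Lemma cderMl k f t d : cder f t d -> cder (fun x => k * f x) t (k * d).
Proof. by move=> fd; have := cderM (cder_cst k t) fd; rewrite mul0r add0r. Qed.

Lemma cderD f g t d e : cder f t d -> cder g t e ->
  cder (fun x => f x + g x) t (d + e).
Proof.
move=> [f1 f2] [g1 g2]; split.
  have -> : (fun x => complex.Re (f x + g x)) = (fun x => complex.Re (f x))
      + (fun x => complex.Re (g x)) by apply/funext => x; rewrite cReD.
  by rewrite cReD; exact: is_deriveD.
have -> : (fun x => complex.Im (f x + g x)) = (fun x => complex.Im (f x))
    + (fun x => complex.Im (g x)) by apply/funext => x; rewrite cImD.
by rewrite cImD; exact: is_deriveD.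
Qed.

Lemma cder_real (F : R -> R) t (a : R) : is_derive t 1 F a -> cder (fun x => (F x)%:C) t a%:C.
Proof. by move=> Fa; split => //; exact: is_derive_cst. Qed.

Lemma cder_line k w t : cder (fun x => k + x%:C * w) t w.
Proof.
have := cderD (cder_cst k t) (cderM (cder_real (is_derive_id t 1)) (cder_cst w t)).
by rewrite mulr0 addr0 add0r mul1r.
Qed.

Lemma cder_constant f : (forall t, 0 <= t <= 1 -> cder f t 0) -> f 1 = f 0.
Proof.
move=> f0.
have key (F : R -> R) : (forall t, 0 <= t <= 1 -> is_derive t 1 F 0) -> F 1 - F 0 = 0.
  move=> F0; have [||c _ ->] := @MVT_segment _ F (fun=> 0) 0 1 ler01 _ _.
  - by move=> x; rewrite in_itv/= => /andP[/ltW x0 /ltW x1]; apply: F0; rewrite x0.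
  - apply: derivable_within_continuous => x; rewrite in_itv/= => /F0 h.
    exact: ex_derive.
  - by rewrite mul0r.
have h1 : complex.Re (f 1) - complex.Re (f 0) = 0.
  by apply: (key (fun x => complex.Re (f x))) => t /f0[].
have h2 : complex.Im (f 1) - complex.Im (f 0) = 0.
  by apply: (key (fun x => complex.Im (f x))) => t /f0[].
by move/eqP: h1; move/eqP: h2; rewrite !subr_eq0 => /eqP h2 /eqP h1; exact: complexP.
Qed.

Lemma ln_sqrt (x : R) : 0 <= x -> ln (Num.sqrt x) = ln x / 2%:R.
Proof.
rewrite le_eqVlt => /predU1P[<-|x0]; first by rewrite sqrtr0 ln0// mul0r.
rewrite -{2}(sqr_sqrtr (ltW x0)) lnXn ?sqrtr_gt0// mulr2n; lra.
Qed.

(** Near t the path a + ib stays in the right half-plane, where its logarithm has the real part ln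
    (a^2 + b^2) / 2 and the imaginary part atan (b / a). *)
Lemma cder_clog_line w (t : R) : 0 < complex.Re (1 + t%:C * w) ->
  cder (fun x => clog (1 + x%:C * w)) t (w / (1 + t%:C * w)).
Proof.
move=> r0; have [da db] := cder_line 1 w t.
set a := fun x : R => complex.Re (1 + x%:C * w) in da.
set b := fun x : R => complex.Im (1 + x%:C * w) in db.
have n0 : 0 < a t ^+ 2 + b t ^+ 2 by rewrite ltr_wpDr ?sqr_ge0// exprn_gt0.
have z0 : 1 + t%:C * w != 0.
  by apply: contraTneq r0 => ->; rewrite ltxx.
have wE : w = (complex.Re w) +i* (complex.Im w) by case: (w).
have zE : 1 + t%:C * w = a t +i* b t by rewrite /a /b; case: (1 + _).
have quo (x y c d : R) : 0 < c ^+ 2 + d ^+ 2 -> (x +i* y) / (c +i* d) =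
    ((x * c + y * d) / (c ^+ 2 + d ^+ 2)) +i* ((y * c - x * d) / (c ^+ 2 + d ^+ 2)).
  move=> cd; apply: complexP; rewrite ?cReM ?cImM/=; field; exact: lt0r_neq0.
have -> : w / (1 + t%:C * w) = ((complex.Re w * a t + complex.Im w * b t) / (a t ^+ 2 + b t ^+ 2))
   +i* ((complex.Im w * a t - complex.Re w * b t) / (a t ^+ 2 + b t ^+ 2)).
  by rewrite zE -quo// -wE.
split.
  have -> : (fun x => complex.Re (clog (1 + x%:C * w))) =
      (fun x => 2%:R^-1 * ln (a x * a x + b x * b x)).
    apply/funext => x; rewrite -[LHS]/(ln (cmod _)) cmod_def ln_sqrt.
      by rewrite mulrC !expr2.
    by rewrite addr_ge0 ?sqr_ge0.
  have dn := is_deriveD (is_derive_mul da da) (is_derive_mul db db).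
  have n0' : 0 < a t * a t + b t * b t by rewrite -!expr2.
  apply: (is_derive_eq (is_derive_mul (is_derive_cst (2%:R^-1 : R) t 1)
    (is_derive_comp_real (F := fun x => a x * a x + b x * b x) (is_derive1_ln n0') dn))).
  rewrite /= -!expr2; move: (a t) (b t) n0 => {}u {}v n0; field.
  exact: lt0r_neq0.
have dq : is_derive t 1 (fun x => b x * (a x)^-1)
    (complex.Im w * (a t)^-1 + b t * (- (a t) ^- 2 * complex.Re w)).
  by apply: is_derive_mul => //; apply: is_derive_eq (is_deriveV _ da) _; rewrite ?gt_eqF.
have ap : \near t, a t > 0.
  have : {for t, continuous a} by apply: differentiable_continuous; apply/derivable1_diffP; exact: ex_derive.
  by move=> /cvgr_gt; apply.
apply: near_eq_is_derive (is_derive_eq (is_derive_comp_real (is_derive1_atan _) dq) _).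
  by near=> x; rewrite -[RHS]/(carg _) carg_atan//; near: x.
have at0 : a t != 0 by rewrite gt_eqF.
rewrite /=; move: (a t) (b t) at0 n0 => u v u0 n0; field.
by rewrite u0 lt0r_neq0.
Unshelve. all: by end_near.
Qed.

End RealDerivative.

(** * Integrals over the half-line and Mellin transforms *)

Section Integrals.
Variable R : realType.
Local Notation C := R[i].
Local Notation mu := (@lebesgue_measure R).
Local Notation D := (`]0, +oo[%classic : set R).
Implicit Types (f g : R -> C) (u v : R -> R) (t r x : R) (s z h a k : C).

Lemma mDpos : measurable D. Proof. exact: measurable_itv. Qed.
#[local] Hint Resolve mDpos : core.

Lemma inD t : D t <-> 0 < t.
Proof. by rewrite /= in_itv/= andbT. Qed.

Definition rint u := mu.-integrable D (EFin \o u).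
Definition rI u : R := \int[mu]_(t in D) u t.
Definition cint f : C := cintegral D f.
Definition cmeas f := measurable_fun D (fun t => complex.Re (f t)) /\
  measurable_fun D (fun t => complex.Im (f t)).
Definition cintble f := cmeas f /\ rint (fun t => cmod (f t)).

Lemma rint_meas u : rint u -> measurable_fun D u.
Proof. by move=> /integrableP[/measurable_EFinP]. Qed.

Lemma rint_le u v : measurable_fun D u -> (forall t, 0 < t -> `|u t| <= v t) ->
  rint v -> rint u.
Proof.
move=> mu' uv; apply: le_integrable => //; first exact/measurable_EFinP.
by move=> t /inD t0; rewrite /= lee_fin (le_trans (uv _ t0))// ler_norm.
Qed.

Lemma eq_rint u v : (forall t, 0 < t -> u t = v t) -> rint u -> rint v.
Proof.
by move=> uv; apply: eq_integrable => // t /[!inE] /inD t0 /=; rewrite uv.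
Qed.

Lemma rintD u v : rint u -> rint v -> rint (fun t => u t + v t).
Proof.
move=> iu iv; have := @integrableD _ _ R mu D mDpos _ _ iu iv; exact: eq_integrable.
Qed.

Lemma rintZ (k : R) u : rint u -> rint (fun t => k * u t).
Proof.
move=> iu; have := @integrableZl _ _ R mu D mDpos k _ iu; exact: eq_integrable.
Qed.

Lemma rI_le u v : rint u -> rint v -> (forall t, 0 < t -> u t <= v t) -> rI u <= rI v.
Proof. by move=> iu iv uv; apply: le_Rintegral => // t /inD; exact: uv. Qed.

Lemma rI_ge0 u : (forall t, 0 < t -> 0 <= u t) -> 0 <= rI u.
Proof. by move=> u0; apply: Rintegral_ge0 => t /inD; exact: u0. Qed.

Lemma rID u v : rint u -> rint v -> rI (fun t => u t + v t) = rI u + rI v.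
Proof. exact: RintegralD. Qed.

Lemma rIZ (k : R) u : rint u -> rI (fun t => k * u t) = k * rI u.
Proof. exact: RintegralZl. Qed.

Lemma eq_rI u v : (forall t, 0 < t -> u t = v t) -> rI u = rI v.
Proof. by move=> uv; apply: eq_Rintegral => t /[!inE] /inD; exact: uv. Qed.

Lemma rI_dominated (u_ : nat -> R -> R) u v : (forall n, measurable_fun D (u_ n)) ->
  measurable_fun D u -> rint v -> (forall n t, 0 < t -> `|u_ n t| <= v t) ->
  (forall t, 0 < t -> u_ n t @[n --> \oo] --> u t) ->
  rint u /\ rI (u_ n) @[n --> \oo] --> rI u.
Proof.
move=> mu_ mu' iv uv uu.
have [|||||iu _ cv] := @dominated_convergence _ _ R mu D mDpos
  (fun n => EFin \o u_ n) (EFin \o u) (EFin \o v).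
- by move=> n; apply/measurable_EFinP; exact: mu_.
- by apply/measurable_EFinP; exact: mu'.
- by apply: aeW => t /inD t0; apply: cvg_EFin; [exact: nearW|exact: uu].
- exact: iv.
- by apply: aeW => t n /inD t0; rewrite /= lee_fin uv.
split=> //; apply: fine_cvg.
rewrite (_ : (rI u)%:E = (\int[mu]_(t in D) (EFin \o u) t)%E)//.
by rewrite /rI /Rintegral fineK//; exact: integrable_fin_num.
Qed.

Lemma cmeasD f g : cmeas f -> cmeas g -> cmeas (fun t => f t + g t).
Proof.
move=> [f1 f2] [g1 g2]; split.
  rewrite (_ : (fun t => _) = (fun t => complex.Re (f t) + complex.Re (g t))).
    exact: measurable_funD.
  by apply/funext => t; rewrite cReD.
rewrite (_ : (fun t => _) = (fun t => complex.Im (f t) + complex.Im (g t))).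
  exact: measurable_funD.
by apply/funext => t; rewrite cImD.
Qed.

Lemma cmeasM f g : cmeas f -> cmeas g -> cmeas (fun t => f t * g t).
Proof.
move=> [f1 f2] [g1 g2]; split.
  rewrite (_ : (fun t => _) = (fun t => complex.Re (f t) * complex.Re (g t) -
    complex.Im (f t) * complex.Im (g t))).
    by apply: measurable_funB; exact: measurable_funM.
  by apply/funext => t; rewrite cReM.
rewrite (_ : (fun t => _) = (fun t => complex.Re (f t) * complex.Im (g t) +
  complex.Im (f t) * complex.Re (g t))).
  by apply: measurable_funD; exact: measurable_funM.
by apply/funext => t; rewrite cImM.
Qed.

Lemma cmeas_real u : measurable_fun D u -> cmeas (fun t => (u t)%:C).
Proof. by move=> mu'; split => //; exact: measurable_cst. Qed.

Lemma cmeas_cst k : cmeas (fun=> k).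
Proof. by split; exact: measurable_cst. Qed.

Lemma cmeasX f n : cmeas f -> cmeas (fun t => f t ^+ n).
Proof.
move=> mf; elim: n => [|n IH]; first exact: cmeas_cst.
by under eq_fun do rewrite exprS; exact: cmeasM.
Qed.

Lemma cmeas_sum (I : Type) (l : seq I) (P : pred I) (F : I -> R -> C) :
  (forall i, P i -> cmeas (F i)) -> cmeas (fun t => \sum_(i <- l | P i) F i t).
Proof.
move=> Fm; elim: l => [|i l IH].
  by under eq_fun do rewrite big_nil; exact: cmeas_cst.
under eq_fun do rewrite big_cons.
by case: (boolP (P i)) => // Pi; apply: cmeasD => //; exact: Fm.
Qed.

Lemma cmeas_cexp f : cmeas f -> cmeas (fun t => cexp (f t)).
Proof.
move=> [f1 f2].
have e1 : measurable_fun D (fun t => expR (complex.Re (f t))).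
  by apply: (measurableT_comp _ f1); exact: measurable_expR.
split; apply: measurable_funM => //.
  by apply: (measurableT_comp _ f2); apply: continuous_measurable_fun; exact: continuous_cos.
by apply: (measurableT_comp _ f2); apply: continuous_measurable_fun; exact: continuous_sin.
Qed.

Lemma meas_cmod f : cmeas f -> measurable_fun D (fun t => cmod (f t)).
Proof.
move=> [f1 f2].
rewrite (_ : (fun t => _) =
  (fun t => Num.sqrt (complex.Re (f t) ^+ 2 + complex.Im (f t) ^+ 2))); last first.
  by apply/funext => t; rewrite cmod_def.
have mn : measurable_fun D (fun t => complex.Re (f t) ^+ 2 + complex.Im (f t) ^+ 2).
  by apply: measurable_funD; exact: measurable_funX.
apply: (measurableT_comp _ mn); apply: continuous_measurable_fun.
exact: sqrt_continuous.
Qed.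

Lemma meas_ln : measurable_fun D (@ln R).
Proof. by apply: measurable_funTS; exact: measurable_ln. Qed.

Lemma meas_id : measurable_fun D (@id R).
Proof. exact: measurable_id. Qed.

Lemma cintble_le f u : cmeas f -> (forall t, 0 < t -> cmod (f t) <= u t) ->
  rint u -> cintble f.
Proof.
move=> mf fu iu; split => //; apply: rint_le iu; first exact: meas_cmod.
by move=> t t0; rewrite ger0_norm ?cmod_ge0// fu.
Qed.

Lemma cintble_Re f : cintble f -> rint (fun t => complex.Re (f t)).
Proof. by move=> [[m1 _]]; apply: rint_le => // t _; exact: cmod_Re. Qed.

Lemma cintble_Im f : cintble f -> rint (fun t => complex.Im (f t)).
Proof. by move=> [[_ m1]]; apply: rint_le => // t _; exact: cmod_Im. Qed.

Lemma Re_cint f : complex.Re (cint f) = rI (fun t => complex.Re (f t)).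
Proof. by []. Qed.

Lemma Im_cint f : complex.Im (cint f) = rI (fun t => complex.Im (f t)).
Proof. by []. Qed.

Lemma eq_cint f g : (forall t, 0 < t -> f t = g t) -> cint f = cint g.
Proof.
by move=> fg; apply: complexP; rewrite ?Re_cint ?Im_cint; apply: eq_rI => t /fg ->.
Qed.

Lemma cintbleD f g : cintble f -> cintble g -> cintble (fun t => f t + g t).
Proof.
move=> [mf jf] [mg ig]; apply: cintble_le (rintD jf ig); first exact: cmeasD.
by move=> t _; exact: cmodD.
Qed.

Lemma cintbleZ k f : cintble f -> cintble (fun t => k * f t).
Proof.
move=> [mf jf]; apply: cintble_le (rintZ (cmod k) jf).
  by apply: cmeasM => //; exact: cmeas_cst.
by move=> t _; rewrite cmodM.
Qed.

Lemma cintD f g : cintble f -> cintble g -> cint (fun t => f t + g t) = cint f + cint g.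
Proof.
move=> jf ig; apply: complexP.
  rewrite cReD !Re_cint -rID; [|exact: cintble_Re|exact: cintble_Re].
  by apply: eq_rI => t _; rewrite cReD.
rewrite cImD !Im_cint -rID; [|exact: cintble_Im|exact: cintble_Im].
by apply: eq_rI => t _; rewrite cImD.
Qed.

Lemma cintZ k f : cintble f -> cint (fun t => k * f t) = k * cint f.
Proof.
move=> jf; have jr := cintble_Re jf; have ji := cintble_Im jf.
apply: complexP.
  rewrite cReM !Re_cint !Im_cint -(rIZ _ jr) -(rIZ _ ji) -mulN1r -(rIZ _ (rintZ _ ji)).
  rewrite -(rID (rintZ _ jr) (rintZ _ (rintZ _ ji))).
  by apply: eq_rI => t _; rewrite cReM mulN1r.
rewrite cImM !Re_cint !Im_cint -(rIZ _ jr) -(rIZ _ ji).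
rewrite -(rID (rintZ _ ji) (rintZ _ jr)).
by apply: eq_rI => t _; rewrite cImM.
Qed.

Lemma cintble0 : cintble (fun=> 0).
Proof.
split; first exact: cmeas_cst.
rewrite /rint (_ : _ \o _ = cst 0%E); first exact: integrable0.
by apply/funext => t; rewrite /= cmod0.
Qed.

Lemma cint0 : cint (fun=> 0) = 0.
Proof.
rewrite -[RHS](mul0r (cint (fun=> 0))) -(cintZ _ cintble0).
by apply: eq_cint => t _; rewrite mul0r.
Qed.

Lemma cintble_sum (I : Type) (l : seq I) (P : pred I) (F : I -> R -> C) :
  (forall i, P i -> cintble (F i)) -> cintble (fun t => \sum_(i <- l | P i) F i t).
Proof.
move=> Fm; elim: l => [|i l IH].
  by under eq_fun do rewrite big_nil; exact: cintble0.
under eq_fun do rewrite big_cons.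
by case: (boolP (P i)) => // Pi; apply: cintbleD => //; exact: Fm.
Qed.

Lemma cint_sum (I : Type) (l : seq I) (P : pred I) (F : I -> R -> C) :
  (forall i, P i -> cintble (F i)) ->
  cint (fun t => \sum_(i <- l | P i) F i t) = \sum_(i <- l | P i) cint (F i).
Proof.
move=> Fm; elim: l => [|i l IH].
  by under eq_fun do rewrite big_nil; rewrite big_nil cint0.
under eq_fun do rewrite big_cons; rewrite big_cons.
case: (boolP (P i)) => // Pi; rewrite -IH cintD//; first exact: Fm.
exact: cintble_sum.
Qed.

(** The factor 2 comes from estimating the real and the imaginary part separately. *)
Lemma cmod_cint f u : cmeas f -> (forall t, 0 < t -> cmod (f t) <= u t) ->
  rint u -> cmod (cint f) <= 2%:R * rI u.
Proof.
move=> mf fu iu; have jf := cintble_le mf fu iu.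
have key v : rint v -> (forall t, 0 < t -> `|v t| <= u t) -> `|rI v| <= rI u.
  move=> iv vu; apply: (@le_trans _ _ (rI (fun t => `|v t|))).
    exact: le_normr_Rintegral.
  by apply: rI_le => //; exact: integrable_norm.
rewrite (le_trans (cmod_ReIm _))// mulr_natl mulr2n lerD//; apply: key.
- exact: cintble_Re.
- by move=> t t0; rewrite (le_trans (cmod_Re _))// fu.
- exact: cintble_Im.
- by move=> t t0; rewrite (le_trans (cmod_Im _))// fu.
Qed.

Lemma cint_dominated (f_ : nat -> R -> C) f u : (forall n, cmeas (f_ n)) -> rint u ->
  (forall n t, 0 < t -> cmod (f_ n t) <= u t) ->
  (forall t, 0 < t -> ccvg (f_^~ t) (f t)) ->
  cmeas f -> cintble f /\ ccvg (fun n => cint (f_ n)) (cint f).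
Proof.
move=> mf_ iu fu ff mf; split.
  by apply: cintble_le iu => // t t0; apply: (ccvg_le (n0 := 0%N)) (ff _ t0) => n _; exact: fu.
apply: ccvg_ReIm.
  have [] := @rI_dominated (fun n t => complex.Re (f_ n t)) (fun t => complex.Re (f t)) u.
  - by move=> n; case: (mf_ n).
  - by case: mf.
  - exact: iu.
  - by move=> n t t0; rewrite (le_trans (cmod_Re _))// fu.
  - by move=> t t0; apply: ccvg_Re; exact: ff.
  by [].
have [] := @rI_dominated (fun n t => complex.Im (f_ n t)) (fun t => complex.Im (f t)) u.
- by move=> n; case: (mf_ n).
- by case: mf.
- exact: iu.
- by move=> n t t0; rewrite (le_trans (cmod_Im _))// fu.
- by move=> t t0; apply: ccvg_Im; exact: ff.
by [].
Qed.

(* Integrating the exponential series termwise; with w = ln t this expands Mellin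
   transforms, with w t = - t Laplace transforms. *)
Lemma has_ps_cint f (w : R -> R) a r : cmeas f -> measurable_fun D w -> 0 < r ->
  rint (fun t => cmod (f t) * expR (complex.Re a * w t + r * `|w t|)) ->
  has_ps (fun s => cint (fun t => f t * cexp (s * (w t)%:C))) a
    (fun n => expc R n * cint (fun t => f t * cexp (a * (w t)%:C) * (w t)%:C ^+ n)).
Proof.
move=> mf mw r0; set dom := (fun t => _) => idom.
have mfa : cmeas (fun t => f t * cexp (a * (w t)%:C)).
  apply: cmeasM => //; apply: cmeas_cexp; apply: cmeasM; first exact: cmeas_cst.
  exact: cmeas_real.
have mt n : cmeas (fun t => f t * cexp (a * (w t)%:C) * (w t)%:C ^+ n).
  by apply: cmeasM => //; apply: cmeasX; exact: cmeas_real.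
have cfa t : cmod (f t * cexp (a * (w t)%:C)) = cmod (f t) * expR (complex.Re a * w t).
  by rewrite cmodM cmod_cexp cReM Re_real Im_real mulr0 subr0.
have domE t : dom t = cmod (f t * cexp (a * (w t)%:C)) * expR (r * `|w t|).
  by rewrite /dom expRD mulrA cfa.
(* (r |w|)^n / n! is a single term of the series of e^(r |w|). *)
have tb n t : cmod (expc R n * (f t * cexp (a * (w t)%:C) * (w t)%:C ^+ n)) * r ^+ n <= dom t.
  rewrite domE cmodM [cmod (_ * _ ^+ n)]cmodM mulrCA -mulrA ler_wpM2l ?cmod_ge0//.
  rewrite cmodX cmodR cmod_expc -mulrA -exprMn [ `|_| * r]mulrC.
  have h0 : 0 <= r * `|w t| by rewrite mulr_ge0// ltW.
  rewrite (le_trans _ (exp_sum_le n.+1 h0))// big_ord_recr/= lerDr.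
  by apply: sumr_ge0 => i _; rewrite mulr_ge0 ?invr_ge0// exprn_ge0.
have ti n : cintble (fun t => f t * cexp (a * (w t)%:C) * (w t)%:C ^+ n).
  have k0 : 0 < r ^+ n / n`!%:R by rewrite divr_gt0 ?exprn_gt0// ltr0n fact_gt0.
  apply: cintble_le (rintZ (r ^+ n / n`!%:R)^-1 idom) => // t _.
  rewrite ler_pdivlMl//; apply: le_trans (tb n t).
  by rewrite [cmod (expc R n * _)]cmodM cmod_expc -[leLHS]mulrA [leLHS]mulrC.
exists r; split => //.
  exists (2%:R * rI dom) => n.
  rewrite -cintZ// -[r ^+ n]ger0_norm ?exprn_ge0 ?(ltW r0)// -cmodR -cmodM mulrC.
  rewrite -cintZ; last exact: cintbleZ.
  apply: cmod_cint idom.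
    by apply: cmeasM; [exact: cmeas_cst|apply: cmeasM => //; exact: cmeas_cst].
  move=> t _; rewrite cmodM cmodR ger0_norm ?exprn_ge0 ?(ltW r0)// mulrC; exact: tb.
move=> h hr.
have [] := @cint_dominated
  (fun N t => \sum_(n < N) (expc R n * h ^+ n) * (f t * cexp (a * (w t)%:C) * (w t)%:C ^+ n))
  (fun t => f t * cexp ((a + h) * (w t)%:C)) dom.
- by move=> n; apply: cmeas_sum => i _; apply: cmeasM => //; exact: cmeas_cst.
- exact: idom.
- move=> n t t0; rewrite domE.
  rewrite (_ : \sum_(_ < n) _ = f t * cexp (a * (w t)%:C) *
     \sum_(i < n) expc R i * (h * (w t)%:C) ^+ i).
    rewrite cmodM ler_wpM2l ?cmod_ge0// (le_trans (cmod_sum _ _ _))//.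
    rewrite (le_trans (cexp_sum_le _ _))// ler_expR cmodM cmodR ler_wpM2r//.
    exact: ltW.
  by rewrite mulr_sumr; apply: eq_bigr => i _; rewrite exprMn; ring.
- move=> t t0; rewrite mulrDl cexpD mulrA.
  apply: eq_ccvg (ccvgMl (f t * cexp (a * (w t)%:C)) (pser_cexp (h * (w t)%:C))) => N.
  by rewrite mulr_sumr; apply: eq_bigr => i _; rewrite exprMn; ring.
- apply: cmeasM => //; apply: cmeas_cexp; apply: cmeasM; first exact: cmeas_cst.
  exact: cmeas_real.
move=> _; apply: eq_ccvg => N; rewrite cint_sum; last first.
  by move=> i _; exact: cintbleZ.
by apply: eq_bigr => i _; rewrite cintZ// mulrAC.
Qed.

Lemma derive1_cint f (w : R -> R) a r : cmeas f -> measurable_fun D w -> 0 < r ->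
  rint (fun t => cmod (f t) * expR (complex.Re a * w t + r * `|w t|)) ->
  derive1 (fun s => cint (fun t => f t * cexp (s * (w t)%:C))) a =
  cint (fun t => f t * (w t)%:C * cexp (a * (w t)%:C)).
Proof.
move=> mf mw r0 idom; rewrite (has_ps_derive (has_ps_cint mf mw r0 idom)).
rewrite /expc/= invr1 mul1r; apply: eq_cint => t _.
by rewrite expr1 mulrAC.
Qed.

End Integrals.
#[global] Hint Resolve mDpos : core.

(** * The fundamental theorem of calculus on the half-line *)

Section Exhaustion.
Variable R : realType.
Local Notation mu := (@lebesgue_measure R).
Local Notation D := (`]0, +oo[%classic : set R).
Implicit Types (f F : R -> R) (t : R).

(** The intervals [1/(n+2), n+2] exhaust the half-line; the shift by 2 makes even the first one
    nondegenerate. *)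
Let lo (n : nat) : R := n.+2%:R^-1.
Let hi (n : nat) : R := n.+2%:R.
Let J n := `[lo n, hi n]%classic.

Let lo0 n : 0 < lo n. Proof. by rewrite invr_gt0. Qed.

Let lohi n : lo n < hi n.
Proof.
apply: (@lt_trans _ _ 1); last by rewrite /hi ltr1n.
by rewrite /lo invf_lt1// ltr1n.
Qed.

Let J_D n : J n `<=` D.
Proof. by move=> t; rewrite /J/= !in_itv/= andbT => /andP[h _]; exact: lt_le_trans h. Qed.

Let J_in t : 0 < t -> \forall n \near \oo, J n t.
Proof.
move=> t0; near=> n; rewrite /J/= in_itv/=; apply/andP; split.
  rewrite /lo -[leRHS]invrK lef_pV2 ?posrE ?invr_gt0//.
  by rewrite (le_trans (y := n%:R))// ?ler_nat ?leqW//; near: n; exact: nbhs_infty_ger.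
by rewrite /hi (le_trans (y := n%:R))// ?ler_nat ?leqW//; near: n; exact: nbhs_infty_ger.
Unshelve. all: by end_near. Qed.

Let J_mono : {homo J : n m / (n <= m)%N >-> (n <= m)%O}.
Proof.
move=> n m nm; rewrite subsetEset => t; rewrite /J/= !in_itv/= => /andP[a b].
apply/andP; split; last by rewrite (le_trans b)// /hi ler_nat.
by rewrite (le_trans _ a)// /lo lef_pV2 ?posrE// ler_nat.
Qed.

Let J_cup : \bigcup_n J n = D.
Proof.
apply/seteqP; split => [t [n _ /J_D]//|t].
by move=> /inD/J_in[n _ h]; exists n => //; exact: (h n (leqnn n)).
Qed.

Let FTC_J f F n : (forall t, 0 < t -> is_derive t 1 F (f t)) ->
  (forall t, 0 < t -> {for t, continuous f}) ->
  (\int[mu]_(t in J n) (f t)%:E = (F (hi n) - F (lo n))%:E)%E.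
Proof.
move=> dF cf; have pos t : lo n <= t -> 0 < t by exact: lt_le_trans.
have cF t : 0 < t -> {for t, continuous F}.
  move=> /dF dFt; apply: differentiable_continuous; apply/derivable1_diffP; exact: ex_derive.
rewrite (@continuous_FTC2 _ f F)//.
- apply: continuous_in_subspaceT => t /[!inE]; rewrite /= in_itv/= => /andP[/pos t0 _].
  exact: cf.
- split.
  + by move=> t; rewrite in_itv/= => /andP[/ltW/pos/dF h _]; exact: ex_derive.
  + by apply: cvg_at_right_filter; apply: cF.
  + by apply: cvg_at_left_filter; apply: cF; exact: lt_trans (lohi n).
- move=> t; rewrite in_itv/= => /andP[/ltW/pos/dF h _].
  by rewrite derive1E; exact: derive_val.
Qed.

(** On each compact interval the integral of f is an increment of F, hence at most 2 B; monotone
    convergence passes to the half-line. *)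
Lemma FTC_pos_integrable f F (B : R) : measurable_fun D f ->
  (forall t, 0 < t -> is_derive t 1 F (f t)) ->
  (forall t, 0 < t -> {for t, continuous f}) -> (forall t, 0 < t -> 0 <= f t) ->
  (forall t, 0 < t -> `|F t| <= B) -> rint f.
Proof.
move=> mf dF cf f0 FB; apply/integrableP; split; first exact/measurable_EFinP.
apply: (@le_lt_trans _ _ (2%:R * B)%:E); last exact: ltry.
have -> : (\int[mu]_(t in D) `|(EFin \o f) t| = \int[mu]_(t in D) (f t)%:E)%E.
  apply: eq_integral; by move=> t /[!inE] /inD t0; rewrite /= ger0_norm// f0.
have := @ge0_nondecreasing_set_cvg_integral _ (measurableTypeR R) R J (EFin \o f) mu J_mono.
rewrite J_cup => h.
have {}h := h _ _ _.
have cv : (\int[mu]_(t in J n) (f t)%:E)%E @[n --> \oo] --> (\int[mu]_(t in D) (f t)%:E)%E.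
  apply: h.
  - by move=> n; exact: measurable_itv.
  - move=> n; apply: (@measurable_funS _ _ _ _ D) => //; exact/measurable_EFinP.
  - by move=> n t /J_D/inD t0; rewrite /= lee_fin f0.
rewrite -(cvg_lim _ cv)//; apply: lime_le; first by apply/cvg_ex; eexists; exact: cv.
apply: nearW => n; rewrite FTC_J// lee_fin.
have := FB _ (lo0 n); have := FB _ (lt_trans (lo0 n) (lohi n)).
rewrite !ler_norml => /andP[_ h1] /andP[h2 _]; lra.
Qed.

Lemma FTC_pos f F (A B : R) : (forall t, 0 < t -> is_derive t 1 F (f t)) ->
  (forall t, 0 < t -> {for t, continuous f}) -> rint f ->
  F n.+2%:R^-1 @[n --> \oo] --> A -> F n.+2%:R @[n --> \oo] --> B -> rI f = B - A.
Proof.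
move=> dF cf jf FA FB.
have mf := rint_meas jf.
have mJ n : measurable (J n) by exact: measurable_itv.
have [|||||_ cv] := @rI_dominated R (fun n => f \_ (J n)) f (fun t => `|f t|).
- by move=> n; apply/(measurable_restrict _ _ _) => //; exact: measurable_funS mf.
- exact: mf.
- exact: integrable_norm.
- by move=> n t _; rewrite patchE; case: ifPn => // _; rewrite normr0.
- move=> t t0; apply: cvg_near_cst; have := J_in t0; apply: filterS => n Jt.
  by rewrite patchE mem_set.
apply: (cvg_unique _ cv) => //.
have -> : (fun n => rI (f \_ (J n))) = (fun n => F (hi n) - F (lo n)).
  apply/funext => n; rewrite /rI -Rintegral_mkcondr setIidr//.
  by rewrite /Rintegral FTC_J.
exact: cvgB.
Qed.

End Exhaustion.

(** * Mellin transforms and their derivatives in s *)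

Section Mellin.
Variable R : realType.
Local Notation C := R[i].
Local Notation D := (`]0, +oo[%classic : set R).
Implicit Types (f g : R -> C) (t r x a : R) (s z h w : C).

(** This is t^s for t > 0, with the real logarithm in place of [clog]. *)
Definition mexp s t : C := cexp (s * (ln t)%:C).
Definition Mel g s : C := cint (fun t => g t * mexp (s - 1) t).
(* Absolute convergence of the Mellin transform on the half-plane Re s > a. *)
Definition mel g a := cmeas g /\
  forall b, a < b -> rint (fun t => cmod (g t) * expR ((b - 1) * ln t)).

Lemma Re_mulR s x : complex.Re (s * x%:C) = complex.Re s * x.
Proof. by rewrite cReM Re_real Im_real mulr0 subr0. Qed.

Lemma cmod_mexp s t : cmod (mexp s t) = expR (complex.Re s * ln t).
Proof. by rewrite cmod_cexp Re_mulR. Qed.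

Lemma mexpD s w t : mexp (s + w) t = mexp s t * mexp w t.
Proof. by rewrite /mexp mulrDl cexpD. Qed.

Lemma meas_expR (u : R -> R) : measurable_fun D u -> measurable_fun D (fun t => expR (u t)).
Proof. by move=> mu; apply: (measurableT_comp _ mu); exact: measurable_expR. Qed.

Lemma cmeas_ln : cmeas (fun t => (ln t)%:C : C).
Proof. by apply: cmeas_real; exact: meas_ln. Qed.

Lemma cmeas_mexp s : cmeas (mexp s).
Proof. by apply: cmeas_cexp; apply: cmeasM; [exact: cmeas_cst|exact: cmeas_ln]. Qed.

Lemma mel_cintble g a s : mel g a -> a < complex.Re s ->
  cintble (fun t => g t * mexp (s - 1) t).
Proof.
move=> [mg ig] as'; apply: cintble_le (ig _ as').
  by apply: cmeasM => //; exact: cmeas_mexp.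
by move=> t t0; rewrite cmodM cmod_mexp cReD cReN.
Qed.

(** Expanding in s costs a factor e^(r |ln t|), which is at most t^r + t^(-r); both shifted powers
    are integrable while Re s - r stays to the right of a. *)
Lemma mel_dom g a s r : mel g a -> 0 < r -> a < complex.Re s - r ->
  rint (fun t => cmod (g t * mexp (-1) t) * expR (complex.Re s * ln t + r * `|ln t|)).
Proof.
move=> [mg ig] r0 ar; have ar' : a < complex.Re s + r by lra.
apply: rint_le (rintD (ig _ ar) (ig _ ar')).
  apply: measurable_funM.
    by apply: meas_cmod; apply: cmeasM => //; exact: cmeas_mexp.
  apply: meas_expR; apply: measurable_funD.
    by apply: measurable_funM; [exact: measurable_cst|exact: meas_ln].
  apply: measurable_funM; first exact: measurable_cst.
  by apply: (@measurableT_comp _ _ _ _ _ _ (fun x : R => `|x|) D (@ln R));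
    [exact: normr_measurable|exact: meas_ln].
move=> t t0; rewrite ger0_norm ?mulr_ge0 ?cmod_ge0 ?expR_ge0//.
rewrite cmodM cmod_mexp -mulrA -expRD -mulrDr ler_wpM2l ?cmod_ge0//.
rewrite cReN [complex.Re 1]/=.
have [l0|l0] := leP 0 (ln t).
  rewrite ler_wpDl ?expR_ge0// ler_expR (ger0_norm l0).
  by rewrite le_eqVlt; apply/orP; left; apply/eqP; ring.
rewrite ler_wpDr ?expR_ge0// ler_expR (ltr0_norm l0).
by rewrite le_eqVlt; apply/orP; left; apply/eqP; ring.
Qed.

Lemma MelE g s : Mel g s = cint (fun t => g t * mexp (-1) t * cexp (s * (ln t)%:C)).
Proof. by apply: eq_cint => t _; rewrite addrC mexpD mulrA. Qed.

Lemma analytic_Mel g a s : mel g a -> a < complex.Re s -> analytic (Mel g) s.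
Proof.
move=> mg as'; pose r := (complex.Re s - a) / 2%:R.
have r0 : 0 < r by rewrite divr_gt0// subr_gt0.
have ar : a < complex.Re s - r by rewrite /r; lra.
rewrite (_ : Mel g = fun s => cint (fun t => g t * mexp (-1) t * cexp (s * (ln t)%:C))).
  eexists; apply: has_ps_cint (mel_dom mg r0 ar) => //; last exact: meas_ln.
  by apply: cmeasM; [case: mg|exact: cmeas_mexp].
by apply/funext => w; exact: MelE.
Qed.

Lemma derive1_Mel g a s : mel g a -> a < complex.Re s ->
  derive1 (Mel g) s = Mel (fun t => g t * (ln t)%:C) s.
Proof.
move=> mg as'; pose r := (complex.Re s - a) / 2%:R.
have r0 : 0 < r by rewrite divr_gt0// subr_gt0.
have ar : a < complex.Re s - r by rewrite /r; lra.
rewrite (_ : Mel g = fun s => cint (fun t => g t * mexp (-1) t * cexp (s * (ln t)%:C))).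
  rewrite (derive1_cint _ _ r0 (mel_dom mg r0 ar)); last exact: meas_ln.
    rewrite MelE; apply: eq_cint => t _; ring.
  by apply: cmeasM; [case: mg|exact: cmeas_mexp].
by apply/funext => w; exact: MelE.
Qed.

(** The logarithm is absorbed by |ln t| <= e^(r |ln t|) / r. The half-plane of convergence is open
    and leaves room for a small r. *)
Lemma mel_ln g a : mel g a -> mel (fun t => g t * (ln t)%:C) a.
Proof.
move=> mg; have [mgm _] := mg; split => [|b ab].
  by apply: cmeasM => //; exact: cmeas_ln.
have [r r0 ar] : exists2 r, 0 < r & a < complex.Re (b%:C : C) - r.
  exists ((b - a) / 2%:R); first by rewrite divr_gt0// subr_gt0.
  by rewrite Re_real; lra.
apply: rint_le (rintZ r^-1 (mel_dom mg r0 ar)).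
  apply: measurable_funM.
    by apply: meas_cmod; apply: cmeasM => //; exact: cmeas_ln.
  apply: meas_expR.
  by apply: measurable_funM; [exact: measurable_cst|exact: meas_ln].
move=> t t0; rewrite ger0_norm ?mulr_ge0 ?cmod_ge0 ?expR_ge0//.
rewrite !cmodM cmod_mexp cmodR -!mulrA -expRD [leRHS]mulrCA ler_wpM2l ?cmod_ge0//.
have -> : complex.Re (-1 : C) * ln t + (complex.Re (b%:C : C) * ln t + r * `|ln t|) =
    (b - 1) * ln t + r * `|ln t| by rewrite cReN /=; ring.
rewrite expRD [leRHS]mulrCA.
rewrite [leLHS]mulrC ler_wpM2l ?expR_ge0// ler_pdivlMl//.
by apply: le_trans (expR_ge1Dx _); rewrite lerDr.
Qed.

Lemma mel_lnX g a k : mel g a -> mel (fun t => g t * (ln t)%:C ^+ k) a.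
Proof.
move=> mg; elim: k => [|k IH].
  by under eq_fun do rewrite expr0 mulr1.
under eq_fun do rewrite exprSr mulrA; exact: mel_ln.
Qed.

Lemma derive1n_Mel g a k s : mel g a -> a < complex.Re s ->
  derive1n k (Mel g) s = Mel (fun t => g t * (ln t)%:C ^+ k) s.
Proof.
move=> mg; elim: k s => [|k IH] s as'.
  by rewrite /=; apply: eq_cint => t _; rewrite expr0 mulr1.
rewrite -[LHS]/(derive1 (derive1n k (Mel g)) s).
have r0 : 0 < complex.Re s - a by rewrite subr_gt0.
have mk := mel_lnX k mg.
have E : forall h, cmod h < complex.Re s - a ->
    Mel (fun t => g t * (ln t)%:C ^+ k) (s + h) = derive1n k (Mel g) (s + h).
  move=> h hr; rewrite IH// cReD; have := cmod_Re h; rewrite ler_norml => /andP[]; lra.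
rewrite -(derive1_eq r0 E (analytic_Mel mk as')) (derive1_Mel mk as').
by apply: eq_cint => t _; rewrite exprSr mulrA.
Qed.

End Mellin.

(** * The Gamma integral with a complex rate z *)

Section GammaIntegrals.
Variable R : realType.
Local Notation C := R[i].
Local Notation D := (`]0, +oo[%classic : set R).
Implicit Types (t r x a b : R) (s z h w : C).

Lemma ln_le_linear a x : 0 <= a -> 0 < x -> exists c, forall t, 0 < t -> a * ln t <= x * t + c.
Proof.
rewrite le_eqVlt => /predU1P[<- x0|a0 x0].
  by exists 0 => t t0; rewrite mul0r addr0 mulr_ge0// ltW.
(* The maximum of a ln t - x t, attained at t = a / x. *)
exists (- a * (1 + ln (x / a))) => t t0.
have xa : 0 < x / a by rewrite divr_gt0.
have u0 : 0 < t * (x / a) by rewrite mulr_gt0.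
have : ln (1 + (t * (x / a) - 1)) <= t * (x / a) - 1 by apply: le_ln1Dx; lra.
rewrite addrC subrK lnM ?posrE// => h.
have -> : x * t + - a * (1 + ln (x / a)) = a * (t * (x / a) - 1 - ln (x / a)).
  by field; rewrite gt_eqF.
by rewrite ler_wpM2l ?(ltW a0)//; lra.
Qed.

Lemma is_derive_exp (F : R -> R) t a : is_derive t 1 F a ->
  is_derive t 1 (fun x => expR (F x)) (expR (F t) * a).
Proof. by move=> Fa; exact: is_derive_comp_real (is_derive_expR _) Fa. Qed.

Lemma is_derive_derivable (F : R -> R) t a : is_derive t 1 F a -> derivable F t 1.
Proof. by case. Qed.

Lemma meas_expln a x : measurable_fun D (fun t => expR (a * ln t - x * t)).
Proof.
apply: meas_expR; apply: measurable_funB.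
  by apply: measurable_funM; [exact: measurable_cst|exact: meas_ln].
by apply: measurable_funM; [exact: measurable_cst|exact: meas_id].
Qed.

(** The comparison function f is the derivative of the bounded function -1/(1 + t^a), hence
    integrable. It behaves like t^(a-1) at 0 and decays like a power at infinity, where the
    exponential is smaller. *)
Lemma rint_gamma a x : 0 < a -> 0 < x -> rint (fun t => expR ((a - 1) * ln t - x * t)).
Proof.
move=> a0 x0; pose E t := expR (a * ln t).
have Eg t : 0 < E t by exact: expR_gt0.
have dE t : 0 < t -> is_derive t 1 E (E t * (a * t^-1)).
  move=> t0; apply: (is_derive_eq (is_derive_exp
    (is_derive_mul (is_derive_cst a t 1) (is_derive1_ln t0)))).
  by rewrite /= mul0r add0r.
have E1 t : 0 < t -> expR ((a - 1) * ln t) = E t * t^-1.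
  by move=> t0; rewrite mulrBl mul1r expRB lnK ?posrE.
pose f t := a * expR ((a - 1) * ln t) * (1 + E t) ^- 2.
have dn t : 0 < t -> is_derive t 1 (fun t => (1 + E t)^-1)
    (- (1 + E t) ^- 2 * (E t * (a * t^-1))).
  move=> t0; have n0 : 1 + E t != 0 by rewrite gt_eqF// addr_gt0.
  have d1 : is_derive t 1 (fun t => 1 + E t) (E t * (a * t^-1)).
    apply: (is_derive_eq (is_deriveD (is_derive_cst (1 : R) t 1) (dE _ t0))).
    by rewrite add0r.
  split; first by apply: derivableV => //; exact: ex_derive.
  by rewrite deriveV// ?derive_val//; exact: ex_derive.
have dF t : 0 < t -> is_derive t 1 (fun t => - (1 + E t)^-1) (f t).
  move=> t0; apply: (is_derive_eq (is_deriveN (dn _ t0))).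
  rewrite /f E1//; ring.
have df t : 0 < t -> {for t, continuous f}.
  move=> t0; apply: differentiable_continuous; apply/derivable1_diffP.
  have d1 := is_derive_mul (is_derive_cst (a - 1) t 1) (is_derive1_ln t0).
  have d2 := is_derive_mul (is_derive_cst a t 1) (is_derive_exp d1).
  have d3 := is_derive_mul d2 (is_derive_mul (dn _ t0) (dn _ t0)).
  rewrite (_ : f = fun t => a * expR ((a - 1) * ln t) * ((1 + E t)^-1 * (1 + E t)^-1)).
    exact: (is_derive_derivable d3).
  by apply/funext => u; rewrite /f expr2 invfM.
have jf : rint f.
  apply: (@FTC_pos_integrable _ f (fun t => - (1 + E t)^-1) 1).
  - apply: open_continuous_measurable_fun; first exact: interval_open.
    by move=> t /[!inE] /inD t0; exact: df.
  - exact: df.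
  - move=> t t0; rewrite /f mulr_ge0 ?invr_ge0 ?exprn_ge0 ?mulr_ge0 ?expR_ge0 ?(ltW a0)//.
    by rewrite addr_ge0// ltW.
  - move=> t t0; rewrite normrN ger0_norm ?invr_ge0 ?addr_ge0 ?(ltW (Eg _))//.
    by rewrite invf_le1 ?lerDl ?(ltW (Eg _))// addr_gt0.
(* The constant comes from (1 + t^a)^2 <= 2 + 2 t^(2a) <= (2 + 2 e^c) e^(x t). *)
have [c hc] := @ln_le_linear (2%:R * a) x (mulr_ge0 (ltW (ltr0Sn _ 1)) (ltW a0)) x0.
apply: rint_le (rintZ ((2%:R + 2%:R * expR c) / a) jf).
  exact: meas_expln.
move=> t t0; rewrite ger0_norm ?expR_ge0// /f.
have -> : (2%:R + 2%:R * expR c) / a * (a * expR ((a - 1) * ln t) * (1 + E t) ^- 2) =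
    expR ((a - 1) * ln t) * ((2%:R + 2%:R * expR c) * (1 + E t) ^- 2).
  by field; rewrite !gt_eqF// addr_gt0.
rewrite expRB ler_wpM2l ?expR_ge0// ler_pdivlMr ?exprn_gt0 ?addr_gt0//.
rewrite mulrC ler_pdivrMr ?expR_gt0//.
have h2 : E t ^+ 2 <= expR c * expR (x * t).
  rewrite -expRD -expRM_natl mulrA ler_expR addrC; exact: hc.
have h1 : 1 <= expR (x * t) by rewrite -(expR0 R) ler_expR mulr_ge0// ltW.
have h3 : 0 <= (E t - 1) ^+ 2 by exact: sqr_ge0.
rewrite mulrDl; nra.
Qed.

Definition ez z t : C := cexp (- z * t%:C).

Lemma cmod_ez z t : cmod (ez z t) = expR (- complex.Re z * t).
Proof. by rewrite cmod_cexp Re_mulR cReN. Qed.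

Lemma cmeas_ez z : cmeas (ez z).
Proof.
apply: cmeas_cexp; apply: cmeasM; first exact: cmeas_cst.
by apply: cmeas_real; exact: meas_id.
Qed.

Lemma mel_ez z : 0 < complex.Re z -> mel (ez z) 0.
Proof.
move=> z0; split; first exact: cmeas_ez.
move=> b b0; apply: eq_rint (rint_gamma b0 z0) => t _.
by rewrite cmod_ez -expRD mulNr addrC.
Qed.

(* The integral of t^(s-1) e^(-tz), which is Gamma(s) z^(-s) by J_pow. *)
Definition J z s : C := Mel (ez z) s.

Lemma ez1 t : ez 1 t = (expR (- t))%:C.
Proof. by rewrite /ez mulN1r -rmorphN cexp_real. Qed.

Lemma euler_integralE s : euler_integral s = J 1 s.
Proof.
by apply: eq_cint => t t0; rewrite mulrC ez1 /cpow clog_real.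
Qed.

Lemma cder_mexp s t : 0 < t -> cder (mexp s) t (s * t^-1%:C * mexp s t).
Proof.
by move=> t0; apply: cder_cexp; apply: cderMl; apply: cder_real; exact: is_derive1_ln.
Qed.

Lemma cder_ez z t : cder (ez z) t (- z * ez z t).
Proof.
apply: cder_cexp; have := cderMl (- z) (cder_real (is_derive_id t 1)).
by rewrite mulr1.
Qed.

Lemma cder_continuous (f : R -> C) t w : cder f t w ->
  {for t, continuous (fun x => complex.Re (f x))} /\
  {for t, continuous (fun x => complex.Im (f x))}.
Proof.
by move=> [d1 d2]; split; apply: differentiable_continuous; apply/derivable1_diffP; exact: ex_derive.
Qed.

Lemma FTC_pos_complex (f F : R -> C) : (forall t, 0 < t -> cder F t (f t)) ->
  (forall t, 0 < t -> exists w, cder f t w) -> cintble f ->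
  ccvg (fun n => F n.+2%:R^-1) 0 -> ccvg (fun n => F n.+2%:R) 0 -> cint f = 0.
Proof.
move=> dF df jf F0 F1; apply: complexP.
  rewrite Re_cint -[RHS]subr0; apply: (@FTC_pos _ _ (fun t => complex.Re (F t))).
  - by move=> t /dF[].
  - by move=> t /df[w /cder_continuous[]].
  - exact: cintble_Re.
  - exact: ccvg_Re F0.
  - exact: ccvg_Re F1.
rewrite Im_cint -[RHS]subr0; apply: (@FTC_pos _ _ (fun t => complex.Im (F t))).
- by move=> t /dF[].
- by move=> t /df[w /cder_continuous[]].
- exact: cintble_Im.
- exact: ccvg_Im F0.
- exact: ccvg_Im F1.
Qed.

Lemma natr_ge_near a : exists N : nat, forall n, (N <= n)%N -> a <= n%:R.
Proof.
exists (Num.truncn `|a|).+1 => n Nn.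
rewrite (le_trans (ler_norm a))// (le_trans (ltW (truncnS_gt _)))// ler_nat.
exact: Nn.
Qed.

Lemma expR_le_eps a e : 0 < e -> - ln e <= a -> expR (- a) <= e.
Proof. by move=> e0 h; rewrite -[leRHS]lnK ?posrE// ler_expR lerNl. Qed.

(** Integration by parts: t^s e^(-tz) has the derivative s t^(s-1) e^(-tz) - z t^s e^(-tz) and tends
    to 0 at both ends. *)
Lemma J_rec z s : 0 < complex.Re z -> 0 < complex.Re s -> z * J z (s + 1) = s * J z s.
Proof.
move=> z0 s0; have s1 : 0 < complex.Re (s + 1) by rewrite cReD addr_gt0.
have mz := mel_ez z0.
have i1 := mel_cintble mz s0; have i2 := mel_cintble mz s1.
apply/esym/eqP; rewrite -subr_eq0 -mulNr /J /Mel -!cintZ// -cintD; [|exact: cintbleZ|exact: cintbleZ].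
apply/eqP; apply: (@FTC_pos_complex _ (fun t => mexp s t * ez z t)).
- move=> t t0; have := cderM (cder_mexp s t0) (cder_ez z t).
  rewrite (_ : s * _ * mexp s t * ez z t + _ = s * (ez z t * mexp (s - 1) t) +
    - z * (ez z t * mexp (s + 1 - 1) t))//.
  rewrite addrK mexpD [mexp (-1) t](_ : _ = (t^-1)%:C); first by ring.
  by rewrite /mexp mulN1r -rmorphN cexp_real expRN lnK ?posrE.
- move=> t t0; eexists; apply: cderD; apply: cderMl; apply: cderM.
  + exact: cder_ez.
  + exact: cder_mexp.
  + exact: cder_ez.
  + exact: cder_mexp.
- exact: cintbleD (cintbleZ _ i1) (cintbleZ _ i2).
- move=> e e0; have [N hN] := natr_ge_near (expR (- ln e / complex.Re s)).
  exists N => n Nn; rewrite subr0 cmodM cmod_mexp cmod_ez.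
  have n0 : 0 < n.+2%:R :> R by [].
  rewrite lnV ?posrE// mulrN (le_trans (y := expR (- (complex.Re s * ln n.+2%:R))))//.
    rewrite ler_piMr ?expR_ge0// -(expR0 R) ler_expR mulNr oppr_le0.
    by rewrite mulr_ge0 ?(ltW z0)// invr_ge0.
  apply: expR_le_eps => //; rewrite mulrC -ler_pdivrMr//.
  by rewrite -[leLHS]expRK ler_ln ?posrE ?expR_gt0// hN// (leq_trans Nn)// leqW.
- move=> e e0; have x2 : 0 < complex.Re z / 2%:R by rewrite divr_gt0.
  have [c hc] := ln_le_linear (ltW s0) x2.
  have [N hN] := natr_ge_near ((c - ln e) / (complex.Re z / 2%:R)).
  exists N => n Nn; rewrite subr0 cmodM cmod_mexp cmod_ez -expRD.
  have n0 : 0 < n.+2%:R :> R by [].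
  have h1 := hc _ n0.
  have : (c - ln e) / (complex.Re z / 2%:R) <= n.+2%:R by rewrite hN// (leq_trans Nn)// leqW.
  rewrite ler_pdivrMr// => h2.
  rewrite -[X in expR X]opprK; apply: expR_le_eps => //.
  move: h1 h2; lra.
Qed.

Lemma J1_1 : J 1 1 = 1.
Proof.
have i1 : cintble (fun t => ez 1 t * mexp (1 - 1) t).
  by apply: mel_cintble (mel_ez _) _; exact: ltr01.
have e1 t : complex.Re (ez 1 t * mexp (1 - 1) t) = expR (- t).
  by rewrite subrr /mexp mul0r cexp0 mulr1 /ez mulN1r -rmorphN cexp_real.
apply: complexP; last first.
  rewrite Im_cint (@eq_rI _ _ (fun=> 0)); last first.
    by move=> t _; rewrite subrr /mexp mul0r cexp0 mulr1 /ez mulN1r -rmorphN cexp_real.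
  by rewrite -[RHS]/(complex.Im (0 : C)) -(cint0 R).
rewrite Re_cint (eq_rI (v := fun t => expR (- t))); last by move=> t _; exact: e1.
rewrite -[RHS](_ : 0 - (-1) = 1); last by rewrite sub0r opprK.
apply: (@FTC_pos _ _ (fun t => - expR (- t))).
- move=> t _; apply: (is_derive_eq (is_deriveN (is_derive_comp_real (is_derive_expR _) (is_deriveNid t 1)))).
  by rewrite mulrN1 opprK.
- move=> t _; apply: differentiable_continuous; apply/derivable1_diffP; exact: ex_derive.
- by apply: eq_rint (cintble_Re i1) => t _; exact: e1.
- apply: cvgN; rewrite -[X in _ --> X](expR0 R) -[X in expR X]oppr0.
  apply: cvg_comp; last exact: continuous_expR.
  by apply: cvgN; have := @cvg_harmonic R; rewrite -cvg_shiftS.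
- rewrite -[X in _ --> X]oppr0; apply: cvgN.
  by have := @cvgn_expR R; rewrite -cvg_shiftS -cvg_shiftS.
Qed.

Lemma is_derive_quadratic (F : R -> R) t (d B r : R) : 0 < r ->
  (forall x, `|x| < r -> `|F (t + x) - F t - d * x| <= B * x ^+ 2) -> is_derive t 1 F d.
Proof.
move=> r0 h; have B0 : 0 <= B.
  have r2 : 0 < r / 2%:R by rewrite divr_gt0.
  have := h (r / 2%:R); rewrite gtr0_norm// => /(_ _)/(le_trans (normr_ge0 _)).
  by rewrite pmulr_lge0 ?exprn_gt0//; apply; lra.
have cv : (fun x => x^-1 *: (F (x *: 1 + t) - F t)) x @[x --> 0^'] --> d.
  apply/cvgrPdist_le => e e0; near=> x.
  have x0 : x != 0 by near: x; exact: nbhs_dnbhs_neq.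
  have xr : `|x| < r by near: x; apply: dnbhs0_lt.
  have xe : `|x| <= e / (B + 1).
    by near: x; apply: dnbhs0_le; rewrite divr_gt0// ltr_wpDl.
  rewrite distrC (_ : _ - d = x^-1 * (F (t + x) - F t - d * x)); last first.
    by rewrite -[x *: 1]/(x * 1) mulr1 [x + t]addrC -[_ *: _]/(_ * _); field.
  rewrite normrM normfV mulrC ler_pdivrMr ?normr_gt0//.
  rewrite (le_trans (h _ xr))// -real_normK ?num_real// expr2 mulrA ler_wpM2r//.
  move: xe; rewrite ler_pdivlMr ?ltr_wpDl// => xe; rewrite (le_trans _ xe)// mulrC ler_wpM2l// lerDl//.
have dF : derivable F t 1 by apply/cvg_ex; exists d; exact: cv.
by apply: DeriveDef => //; exact: cvg_lim cv.
Unshelve. all: by end_near. Qed.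

Lemma cder_has_ps (f : C -> C) k w t c : has_ps f (k + t%:C * w) c ->
  cder (fun x => f (k + x%:C * w)) t (w * c 1%N).
Proof.
move=> fc; have fa := has_ps_val fc; have [r [r0 [M hM] {}fc]] := fc.
pose q := r / 2%:R / (cmod w + 1).
have w1 : 0 < cmod w + 1 by rewrite ltr_wpDl ?cmod_ge0.
have q0 : 0 < q by rewrite !divr_gt0.
pose B := 2%:R * M * (cmod w / r) ^+ 2.
have key x : `|x| < q ->
    cmod (f (k + (t + x)%:C * w) - f (k + t%:C * w) - w * c 1%N * x%:C) <= B * x ^+ 2.
  move=> xq; have hx : cmod (x%:C * w) <= r / 2%:R.
    move: xq; rewrite ltr_pdivlMr// cmodM cmodR => /ltW; apply: le_trans.
    by rewrite ler_wpM2l// lerDl.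
  have hx' : cmod (x%:C * w) < r by lra.
  have := pser_remainder 2 hM r0 hx (fc _ hx').
  rewrite !big_ord_recr big_ord0/= add0r expr0 mulr1 expr1 -fa.
  rewrite (_ : k + (t + x)%:C * w = k + t%:C * w + x%:C * w); last first.
    by rewrite rmorphD/=; ring.
  rewrite opprD addrA (_ : w * c 1%N * x%:C = c 1%N * (x%:C * w)); last by ring.
  move=> /le_trans; apply; rewrite /B cmodM cmodR -(real_normK (num_real x)).
  by rewrite le_eqVlt; apply/orP; left; apply/eqP; field; rewrite gt_eqF.
split; apply: (is_derive_quadratic q0) => x xq; apply: le_trans (key _ xq).
  rewrite -[leLHS](_ : `|complex.Re (f (k + (t + x)%:C * w) - f (k + t%:C * w) - w * c 1%N * x%:C)| = _).
    exact: cmod_Re.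
  by rewrite !cReD !cReN Re_mulR.
rewrite -[leLHS](_ : `|complex.Im (f (k + (t + x)%:C * w) - f (k + t%:C * w) - w * c 1%N * x%:C)| = _).
  exact: cmod_Im.
by rewrite !cImD !cImN [complex.Im (w * c 1%N * x%:C)]cImM Re_real Im_real mulr0 add0r.
Qed.

(** Differentiation in z under the integral; the radius Re z / 2 still leaves the decay e^(-t Re z /
    2). *)
Lemma has_ps_J z s : 0 < complex.Re z -> 0 < complex.Re s ->
  exists2 c, has_ps (fun w => J w s) z c & c 1%N = - J z (s + 1).
Proof.
move=> z0 s0; pose r := complex.Re z / 2%:R.
have r0 : 0 < r by rewrite divr_gt0.
have mm : cmeas (mexp (s - 1)) by exact: cmeas_mexp.
have mN : measurable_fun D (fun t : R => - t) by exact: measurable_funN.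
have dom : rint (fun t => cmod (mexp (s - 1) t) * expR (complex.Re z * - t + r * `|- t|)).
  apply: eq_rint (rint_gamma s0 r0) => t t0.
  rewrite cmod_mexp cReD cReN [complex.Re 1]/= -expRD normrN gtr0_norm//.
  by congr expR; rewrite /r; field.
have := has_ps_cint mm mN r0 dom.
rewrite (_ : (fun w => cint _) = fun w => J w s); last first.
  apply/funext => w; apply: eq_cint => t _; rewrite mulrC; congr (_ * _).
  by rewrite /ez rmorphN mulNr mulrN.
move=> h; eexists; first exact: h.
rewrite /expc/= invr1 mul1r -[RHS]mulN1r -cintZ; last first.
  by apply: mel_cintble (mel_ez z0) _; rewrite cReD addr_gt0.
apply: eq_cint => t t0; rewrite expr1 addrK.
rewrite -[in RHS](subrK 1 s) [in RHS]mexpD.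
have -> : mexp 1 t = t%:C :> C by rewrite /mexp mul1r cexp_real lnK ?posrE.
have -> : ez z t = cexp (z * (- t)%:C) by rewrite /ez rmorphN mulNr mulrN.
by move: (cexp _) => u; rewrite rmorphN; ring.
Qed.

Lemma clog1 : clog (1 : C) = 0.
Proof. by rewrite -[1]/((1 : R)%:C) clog_real// ln1. Qed.

(** Along the segment u = 1 + x (z - 1) the product of [J u s] and u^s is constant: its derivative
    is a multiple of s J(u, s) / u - J(u, s + 1), which vanishes by [J_rec]. The two ends of the
    segment give the claim. *)
Lemma J_pow z s : 0 < complex.Re z -> 0 < complex.Re s ->
  J z s = J 1 s * cexp (- s * clog z).
Proof.
move=> z0 s0; pose w := z - 1.
pose h (x : R) := J (1 + x%:C * w) s * cexp (s * clog (1 + x%:C * w)).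
have pos (x : R) : 0 <= x <= 1 -> 0 < complex.Re (1 + x%:C * w).
  move=> /andP[x0 x1]; rewrite cReD mulrC Re_mulR /w cReD cReN [complex.Re 1]/=.
  by move: z0; set u := complex.Re z => u0; nra.
have h01 : h 1 = h 0.
  apply: cder_constant => x /pos x0.
  have [c hc c1] := has_ps_J x0 s0.
  have := cderM (cder_has_ps hc) (cder_cexp (cderMl s (cder_clog_line x0))).
  rewrite c1; set u := 1 + x%:C * w in x0 *.
  have u0 : u != 0 by apply: contraTneq x0 => ->; rewrite ltxx.
  have -> : J u (s + 1) = s * J u s / u by rewrite -J_rec// mulrC mulKf.
  rewrite [X in cder _ _ X](_ : _ = 0)//.
  by field.
move: h01; rewrite /h mul1r mul0r addr0 /w addrC subrK.
rewrite clog1 mulr0 cexp0 mulr1 => <-.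
by rewrite -mulrA -cexpD mulNr subrr cexp0 mulr1.
Qed.

End GammaIntegrals.

(** * The Gamma function *)

Section GammaFunction.
Variable R : realType.
Local Notation C := R[i].
Implicit Types (t r x a b : R) (s z h w al : C).

Local Notation Gamma := (@Gamma R).

Lemma prod_shift_neq0 s n : (forall i : nat, s != - i%:R) -> \prod_(i < n) (s + i%:R) != 0.
Proof.
by move=> hs; apply/prodf_neq0 => i _; rewrite addr_eq0; exact: hs.
Qed.

Lemma Re_natr n : complex.Re (n%:R : C) = n%:R.
Proof. by rewrite -[n%:R]/(n%:R) -(rmorph_nat (real_complex R)). Qed.

(** The shift in the definition of [Gamma] jumps with Re s. By the functional equation every large
    enough n gives the same quotient, so one n serves a whole neighbourhood. *)
Lemma Gamma_quotient s n : - n%:R < complex.Re s ->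
  Gamma s = J 1 (s + n%:R) / \prod_(i < n) (s + i%:R).
Proof.
pose G n := J 1 (s + n%:R) / \prod_(i < n) (s + i%:R).
have GS m : - m%:R < complex.Re s -> G m = G m.+1.
  move=> ms; rewrite /G big_ord_recr/= -[m.+1]addn1 natrD addrA.
  have pos : 0 < complex.Re (s + m%:R) by rewrite cReD Re_natr -ltrBlDr sub0r.
  have := J_rec (z := 1) ltr01 pos; rewrite mul1r => ->.
  have n0 : s + m%:R != 0 by apply: contraTneq pos => ->; rewrite ltxx.
  by rewrite invfM (mulrC (s + m%:R)) -mulrA (mulrCA (s + m%:R)) divff// mulr1.
have GD m k : - m%:R < complex.Re s -> G m = G (m + k)%N.
  move=> ms; elim: k => [|k IH]; first by rewrite addn0.
  rewrite IH addnS; apply: GS; rewrite (le_lt_trans _ ms)// lerN2 ler_nat leq_addr.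
  by [].
move=> ns; rewrite /Defs.Gamma euler_integralE -/(G _) -[RHS]/(G n).
set m := (Num.truncn _).+1.
have ms : - m%:R < complex.Re s by rewrite ltrNl truncnS_gt.
have [mn|nm] := leqP m n; first by rewrite (GD _ (n - m)%N ms) subnKC.
by rewrite (GD _ (m - n)%N ns) subnKC// ltnW.
Qed.

Lemma Gamma_right s : 0 < complex.Re s -> Gamma s = J 1 s.
Proof.
by move=> s0; rewrite (@Gamma_quotient _ 0%N) ?oppr0// big_ord0 divr1 addr0.
Qed.

Lemma analytic_J s : 0 < complex.Re s -> analytic (J (1 : C)) s.
Proof. by move=> s0; apply: analytic_Mel (mel_ez _) s0; exact: ltr01. Qed.

Lemma sin_le_abs x : `|sin x| <= `|x|.
Proof.
wlog x0 : x / 0 <= x.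
  move=> h; have [/h//|x0] := leP 0 x.
  by rewrite -normrN -sinN -(normrN x); apply: h; rewrite oppr_ge0 ltW.
have [|c _] := @MVT_segment _ (@sin R) (@cos R) 0 x x0 _ _.
  by apply: continuous_subspaceT => y; exact: continuous_sin.
rewrite sin0 !subr0 => ->; rewrite normrM ler_piMl//.
by rewrite ler_norml cos_geN1 cos_le1.
Qed.

Lemma cos_ge x : 1 - x ^+ 2 / 2%:R <= cos x.
Proof.
have -> : cos x = 1 - 2%:R * sin (x / 2%:R) ^+ 2.
  rewrite [in LHS](splitr x) cosD -!expr2 cos2sin2; ring.
have := sin_le_abs (x / 2%:R); rewrite -(ler_pXn2r (n := 2))// ?nnegrE//.
rewrite !real_normK ?num_real// expr_div_n => h; lra.
Qed.

(** Adds e^x >= 1 + x + x^2 / 2 and e^(-x) >= 1 - x for x >= 0. At x = ln q it bounds (ln q)^2 by a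
    combination of q and 1/q, whose averages against a Gamma density are explicit. *)
Lemma sqr_le_cosh x : x ^+ 2 <= 2%:R * (expR x + expR (- x) - 2%:R).
Proof.
wlog x0 : x / 0 <= x.
  move=> h; have [/h//|x0] := leP 0 x.
  by have := h (- x); rewrite sqrrN opprK [expR (- x) + _]addrC; apply; rewrite oppr_ge0 ltW.
have := exp_sum_le 3 x0; rewrite !big_ord_recr big_ord0/= add0r !expr0 expr1 !factS fact0.
have := expR_ge1Dx (- x); rewrite !muln1 invr1 !mul1r.
rewrite (_ : (2 * 1)%:R = 2%:R :> R)//; lra.
Qed.

(* |E t^{iy}| for t Gamma-distributed with shape a: the distribution concentrates
   at a, so that Re (t / a)^{iy} averages to almost 1 when a is large compared to y. *)
Lemma J_neq0_large a y : 1 + y ^+ 2 < a -> J (1 : C) (a +i* y) != 0.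
Proof.
move=> ya; have a1 : 1 < a by apply: le_lt_trans ya; rewrite lerDl sqr_ge0.
have a0 : 0 < a by exact: lt_trans a1.
pose g b t := expR ((b - 1) * ln t - 1 * t).
have ig b : 0 < b -> rint (g b) by move=> b0; exact: rint_gamma.
have gJ b : 0 < b -> J 1 b%:C = (rI (g b))%:C.
  move=> b0; have e1 t : ez 1 t * mexp (b%:C - 1) t = (g b t)%:C.
    rewrite ez1 /mexp -[1]/((1 : R)%:C) -rmorphB/= -rmorphM/= cexp_real -rmorphM/=.
    by rewrite -expRD /g mul1r addrC.
  apply: complexP.
    by rewrite Re_cint; apply: eq_rI => t _; rewrite e1.
  rewrite Im_cint (@eq_rI _ _ (fun=> 0)); last by move=> t _; rewrite e1.
  by rewrite -[RHS]/(complex.Im (0 : C)) -(cint0 R).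
have grec b : 0 < b -> rI (g (b + 1)) = b * rI (g b).
  move=> b0; have bp : 0 < b + 1 by rewrite addr_gt0.
  have := @J_rec _ 1 b%:C ltr01 b0; rewrite mul1r.
  rewrite -[X in J 1 (_ + X)]/((1 : R)%:C) -rmorphD/= !gJ// -rmorphM/=.
  exact: complexI.
have i0 := ig _ a0; have i1 : rint (g (a + 1)) by apply: ig; rewrite addr_gt0.
have am : 0 < a - 1 by rewrite subr_gt0.
have i2 := ig _ am.
have ga0 : 0 < rI (g a).
  rewrite lt_neqAle rI_ge0 ?andbT; last by move=> t _; exact: expR_ge0.
  (* If the integral were 0: where ln t >= -2k the function [g 1] is below a multiple of [g a],
     elsewhere it is below e^(-k) times the integrand of k. Integration would give 1 <= k e^(-k),
     against e^k >= 1 + k. *)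
  apply/eqP => /esym ga0.
  have h0 : 0 < 2%:R^-1 :> R by [].
  pose k := rI (g 2%:R^-1).
  have jk := rintD (rintZ (expR (2%:R * k * (a - 1))) i0) (rintZ (expR (- k)) (ig _ h0)).
  have : rI (g 1) <= rI (fun t => expR (2%:R * k * (a - 1)) * g a t + expR (- k) * g 2%:R^-1 t).
    apply: rI_le => //; first exact: ig.
    move=> t t0; rewrite /g -!expRD.
    have [lk|lk] := leP (- (2%:R * k)) (ln t).
      rewrite ler_wpDr ?expR_ge0// ler_expR subrr mul0r add0r addrA lerDr.
      by rewrite (mulrC _ (a - 1)) -mulrDr mulr_ge0 ?(ltW am)//; lra.
    rewrite ler_wpDl ?expR_ge0// ler_expR subrr mul0r add0r addrA lerDr.
    by move: lk; lra.
  rewrite rID; [|exact: rintZ|by apply: rintZ; exact: ig].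
  rewrite !rIZ//; last exact: ig.
  have -> : rI (g 1) = 1.
    by apply: complexI; rewrite -gJ//; exact: J1_1.
  rewrite ga0 mulr0 add0r -/k => h.
  have := expR_ge1Dx k; rewrite -[X in _ <= X]mul1r => h'.
  have := ler_wpM2r (expR_ge0 k) h; rewrite mulrAC -expRD addNr expR0; lra.
pose v t := y * (ln t - ln a).
(* Combines cos v >= 1 - v^2 / 2 with v^2 <= 2 y^2 (t/a + a/t - 2). *)
have key t : 0 < t -> g a t * (1 - y ^+ 2 * (t / a + a / t - 2%:R)) <= g a t * cos (v t).
  move=> t0; rewrite ler_wpM2l ?expR_ge0//; apply: le_trans (cos_ge _).
  have := sqr_le_cosh (ln t - ln a); rewrite opprB !expRB !lnK ?posrE//.
  rewrite /v exprMn; set q := t / a + a / t - 2%:R => h.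
  by have := ler_wpM2l (sqr_ge0 y) h; lra.
apply/negP => /eqP J0.
have im : cintble (fun t => ez 1 t * mexp (a +i* y - 1) t).
  by apply: mel_cintble (mel_ez _) _; [exact: ltr01|exact: a0].
have cosE t : complex.Re (cexp (0 +i* (- y * ln a)) * (ez 1 t * mexp (a +i* y - 1) t)) =
    g a t * cos (v t).
  have -> : cexp (0 +i* (- y * ln a)) * (ez 1 t * mexp (a +i* y - 1) t) =
      (expR (- t))%:C * cexp (((a - 1) * ln t) +i* v t).
    rewrite ez1 /mexp mulrCA -cexpD; congr (_ * cexp _).
    by apply: complexP; rewrite !(cReD, cImD, cReM, cImM, cReN, cImN)/= /v; ring.
  rewrite cReM Re_real Im_real mul0r subr0 Re_cexp/= mulrA -expRD /g.
  by congr (expR _ * _); ring.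
have : complex.Re (cexp (0 +i* (- y * ln a)) * J 1 (a +i* y)) = rI (fun t => g a t * cos (v t)).
  rewrite /J /Mel -cintZ// Re_cint; apply: eq_rI => t _.
  exact: cosE.
rewrite J0 mulr0 => /esym/eqP; rewrite gt_eqF//.
have E t : 0 < t -> g a t * (1 - y ^+ 2 * (t / a + a / t - 2%:R)) =
    (1 + 2%:R * y ^+ 2) * g a t + (- y ^+ 2 / a * g (a + 1) t + - y ^+ 2 * a * g (a - 1) t).
  move=> t0; have lt : expR (ln t) = t by rewrite lnK ?posrE.
  have -> : g (a + 1) t = g a t * t.
    by rewrite /g -[X in _ = _ * X]lt -expRD; congr expR; ring.
  have -> : g (a - 1) t = g a t / t.
    by rewrite /g -[X in _ = _ / X]lt -expRB; congr expR; ring.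
  by field; rewrite !gt_eqF.
have jj : rint (fun t => (1 + 2%:R * y ^+ 2) * g a t +
    (- y ^+ 2 / a * g (a + 1) t + - y ^+ 2 * a * g (a - 1) t)).
  by apply: rintD; [exact: rintZ|apply: rintD; exact: rintZ].
apply: (@lt_le_trans _ _ (rI (fun t => (1 + 2%:R * y ^+ 2) * g a t +
    (- y ^+ 2 / a * g (a + 1) t + - y ^+ 2 * a * g (a - 1) t)))); last first.
  apply: rI_le => //; last by move=> t t0; rewrite -E//; exact: key.
  have mm : cmeas (fun t => cexp (0 +i* (- y * ln a)) * (ez 1 t * mexp (a +i* y - 1) t)).
    by apply: cmeasM; [exact: cmeas_cst|case: im].
  have : rint (fun t => complex.Re (cexp (0 +i* (- y * ln a)) * (ez 1 t * mexp (a +i* y - 1) t))).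
    by apply: cintble_Re; apply: cintbleZ.
  apply: eq_rint => t _; exact: cosE.
rewrite rID; [|exact: rintZ|by apply: rintD; exact: rintZ].
rewrite rID; [|exact: rintZ|exact: rintZ].
rewrite !rIZ// grec//.
have := grec _ am; rewrite subrK => gE.
rewrite gE; set q := rI (g (a - 1)) in gE *.
have q0 : 0 < q by rewrite -(pmulr_rgt0 _ am) -gE.
(* The integrals of [g (a + 1)] and [g (a - 1)] are a and 1/(a - 1) times that of [g a], so the
   lower bound is positive exactly when a > 1 + y^2. *)
rewrite [X in 0 < X](_ : _ = q * ((a - 1) - y ^+ 2)); last first.
  by field; rewrite gt_eqF.
by rewrite mulr_gt0// subr_gt0; lra.
Qed.

Lemma J_prod s n : 0 < complex.Re s ->
  J (1 : C) (s + n%:R) = \prod_(i < n) (s + i%:R) * J 1 s.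
Proof.
move=> s0; elim: n => [|n IH]; first by rewrite big_ord0 mul1r addr0.
rewrite big_ord_recr/= -[n.+1]addn1 natrD addrA.
have pos : 0 < complex.Re (s + n%:R) by rewrite cReD Re_natr ltr_wpDr.
have := J_rec (z := 1) ltr01 pos; rewrite mul1r => ->.
by rewrite IH; ring.
Qed.

(** By the functional equation a zero at s would propagate to s + N, which [J_neq0_large] excludes
    as soon as N >= 2 + (Im s)^2. *)
Lemma J_neq0 s : 0 < complex.Re s -> J (1 : C) s != 0.
Proof.
move=> s0; have [N hN] := natr_ge_near (2%:R + complex.Im s ^+ 2).
have := J_prod N s0; apply: contra_eq_neq => ->; rewrite mulr0.
rewrite (_ : s + N%:R = (complex.Re s + N%:R) +i* complex.Im s).
  apply: J_neq0_large; have := hN N (leqnn _); lra.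
apply: complexP; first by rewrite cReD Re_natr.
by rewrite cImD -[X in _ + X](_ : 0 = _) ?addr0// -(rmorph_nat (real_complex R)).
Qed.

Lemma is_ZplusP s : ~ is_Zplus (- s) <-> forall n : nat, s != - n%:R.
Proof.
split=> [h n|h [n sn]].
  by apply/eqP => sn; apply: h; exists n; rewrite sn opprK.
by have := h n; rewrite -sn opprK eqxx.
Qed.

Lemma Re_near s h (r : R) : cmod h < r -> complex.Re s - r < complex.Re (s + h).
Proof. by move=> hr; rewrite cReD; have := cmod_Re h; rewrite ler_norml => /andP[]; lra. Qed.

Lemma c01 : cmod (0 : C) < 1.
Proof. by rewrite cmod0. Qed.

Lemma Gamma_near s : exists n : nat, forall h, cmod h < 1 ->
  Gamma (s + h) = J 1 (s + h + n%:R) / \prod_(i < n) (s + h + i%:R) /\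
  0 < complex.Re (s + h + n%:R).
Proof.
have [n hn] := natr_ge_near (1 - complex.Re s).
exists n => h h1; have := Re_near s h1; have := hn n (leqnn _) => h2 h3.
split; first by apply: Gamma_quotient; lra.
by rewrite cReD Re_natr; lra.
Qed.

Lemma analytic_prod_shift (n : nat) s : analytic (fun s : C => \prod_(i < n) (s + i%:R)) s.
Proof.
by apply: analytic_prod => i _; apply: analyticD; [exact: analytic_id|exact: analytic_cst].
Qed.

Lemma analytic_Gamma s : (forall n : nat, s != - n%:R) -> analytic Gamma s.
Proof.
move=> hs; have [n hn] := Gamma_near s.
apply: (@analytic_eq _ (fun s => J 1 (s + n%:R) * (\prod_(i < n) (s + i%:R))^-1) _ _ 1) => //.
  by move=> h /hn[->].
apply: analyticM.
  apply: analytic_shift; apply: analytic_J.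
  by have [_] := hn 0 c01; rewrite addr0.
by apply: analyticV; [exact: prod_shift_neq0|exact: analytic_prod_shift].
Qed.

(** At a pole [Gamma] is a quotient by 0, hence 0, and its inverse is 0 again: the default value is
    the true value of 1/Gamma. *)
Definition rGamma s : C := (Gamma s)^-1.

Lemma rGammaE s n : - n%:R < complex.Re s ->
  rGamma s = \prod_(i < n) (s + i%:R) / J 1 (s + n%:R).
Proof. by move=> ns; rewrite /rGamma (Gamma_quotient ns) invf_div. Qed.

Lemma analytic_rGamma s : analytic rGamma s.
Proof.
have [n hn] := Gamma_near s.
apply: (@analytic_eq _ (fun s => \prod_(i < n) (s + i%:R) * (J 1 (s + n%:R))^-1) _ _ 1) => //.
  by move=> h /hn[e _]; rewrite /rGamma e invf_div.
have pos : 0 < complex.Re (s + n%:R).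
  by have [_] := hn 0 c01; rewrite addr0.
apply: analyticM; first exact: analytic_prod_shift.
apply: analyticV; first exact: J_neq0.
by apply: analytic_shift; exact: analytic_J.
Qed.

Lemma rGamma0 : rGamma 0 = 0.
Proof.
by rewrite (@rGammaE _ 1%N) ?oppr_lt0// big_ord1 addr0 mul0r.
Qed.

(** Near 0 the function is s divided by [J 1 (s + 1)], and [J 1 1] is 1. *)
Lemma derive1_rGamma0 : derive1 rGamma 0 = 1.
Proof.
have E h : cmod h < 1 -> (0 + h) * (J 1 (0 + h + 1))^-1 = rGamma (0 + h).
  move=> h1; rewrite (@rGammaE _ 1%N) ?big_ord1 ?addr0//.
  by have := Re_near 0 h1; rewrite sub0r.
have aJ : analytic (fun s : C => (J 1 (s + 1))^-1) 0.
  by apply: analyticV; [rewrite add0r J1_1 oner_neq0|apply: analytic_shift; rewrite add0r; exact: analytic_J].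
have := derive1_eq ltr01 E (analyticM (analytic_id 0) aJ).
by rewrite (derive1M (analytic_id 0) aJ) derive1_id_C mul0r addr0 mul1r add0r J1_1 invr1 => <-.
Qed.

Lemma prod_shift_split s (n : nat) :
  \prod_(i < n.+1) (s - n%:R + i%:R) = s * \prod_(i < n) (s - (i.+1)%:R).
Proof.
rewrite big_ord_recr/= subrK mulrC; congr (_ * _).
rewrite (reindex_inj rev_ord_inj)/=; apply: eq_bigr => i _.
rewrite -addrA; congr (_ + _); rewrite natrB; last exact: ltn_ord.
by rewrite addrA addNr add0r.
Qed.

Lemma Gamma_pole (n : nat) h : h != 0 -> cmod h < 1 ->
  Gamma (h - n%:R) = h^-1 * (J 1 (h + 1) / \prod_(i < n) (h - (i.+1)%:R)).
Proof.
move=> h0 h1; rewrite (@Gamma_quotient _ n.+1).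
  rewrite prod_shift_split invfM [RHS]mulrCA -[n.+1]addn1 natrD addrA subrK.
  by rewrite mulrCA.
rewrite cReD cReN Re_natr.
by have := Re_near 0 h1; rewrite sub0r add0r -natr1; lra.
Qed.

Lemma analytic_prod_pole (n : nat) s : analytic (fun s : C => \prod_(i < n) (s - (i.+1)%:R)) s.
Proof.
by apply: analytic_prod => i _; apply: analyticB; [exact: analytic_id|exact: analytic_cst].
Qed.

Lemma prod_pole0 (n : nat) : \prod_(i < n) (0 - (i.+1)%:R) = (-1) ^+ n * n`!%:R :> C.
Proof.
elim: n => [|n IH]; first by rewrite big_ord0 mul1r.
by rewrite big_ord_recr/= IH factS natrM exprS; ring.
Qed.

Lemma prod_pole0_neq0 (n : nat) : \prod_(i < n) (0 - (i.+1)%:R) != 0 :> C.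
Proof.
by rewrite prod_pole0 mulf_neq0 ?expf_neq0 ?oppr_eq0 ?oner_neq0// pnatr_eq0 -lt0n fact_gt0.
Qed.

Lemma Gamma_pole_analytic (n : nat) :
  analytic (fun s => J 1 (s + 1) / \prod_(i < n) (s - (i.+1)%:R)) (0 : C).
Proof.
apply: analyticM; first by apply: analytic_shift; rewrite add0r; exact: analytic_J.
by apply: analyticV; [exact: prod_pole0_neq0|exact: analytic_prod_pole].
Qed.

Lemma Gamma_pole_near (n : nat) : exists2 g, analytic g (- n%:R) &
  near_eq Gamma (fun s => (s - - n%:R)^-1 * g s) (- n%:R) /\
  g (- n%:R) = ((-1) ^+ n * n`!%:R)^-1.
Proof.
pose f s : C := J 1 (s + 1) / \prod_(i < n) (s - (i.+1)%:R).
exists (fun s => f (s + n%:R)).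
  by apply: analytic_shift; rewrite addNr; exact: Gamma_pole_analytic.
split; last by rewrite addNr /f add0r J1_1 prod_pole0 mul1r.
exists 1 => // h h0 h1; rewrite addrC Gamma_pole// opprK subrK.
by [].
Qed.

Lemma Res_Gamma (n : nat) : Res Gamma (- n%:R) = ((-1) ^+ n * n`!%:R)^-1.
Proof.
by have [g ga [Gg <-]] := Gamma_pole_near n; exact: Res_simple_pole.
Qed.

Lemma mero_Gamma s : mero Gamma s.
Proof.
have [[n sn]|/is_ZplusP hs] := pselect (is_Zplus (- s)); last exact/analytic_mero/analytic_Gamma.
have [g ga [Gg _]] := Gamma_pole_near n.
rewrite (_ : s = - n%:R); last by rewrite -sn opprK.
by exists 1%N, g; split => //; under eq_fun do rewrite expr1.
Qed.

Lemma rGamma_mul s : (forall n : nat, s != - n%:R) -> rGamma s * Gamma s = 1.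
Proof.
move=> hs; rewrite /rGamma mulVf//.
have [n hn] := Gamma_near s; have [e pos] := hn 0 c01.
rewrite addr0 in e pos; rewrite e mulf_neq0 ?J_neq0// invr_neq0//.
exact: prod_shift_neq0.
Qed.

Lemma rGamma_Gamma_pole (n : nat) h : h != 0 -> cmod h < 1 ->
  rGamma h * Gamma (h - n%:R) = (\prod_(i < n) (h - (i.+1)%:R))^-1.
Proof.
move=> h0 h1; have h1' : - 1%:R < complex.Re h by have := Re_near 0 h1; rewrite sub0r add0r.
rewrite Gamma_pole// (rGammaE h1') big_ord1 addr0.
have j0 : J 1 (h + 1) != 0.
  by apply: J_neq0; rewrite cReD -ltrBlDr sub0r.
by set u := (\prod_(i < n) _)^-1; field; rewrite j0 h0.
Qed.

End GammaFunction.

(** * Continuation of the zeta function from the heat expansion *)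

Section HeatTerms.
Variable R : realType.
Local Notation C := R[i].
Local Notation Gamma := (@Gamma R).
Implicit Types (z w s h a : C) (f g F G : C -> C) (n k j : nat).

Lemma Pf_congr F G a : mero F a -> near_eq F G a -> Pf F a = Pf G a.
Proof.
move=> /mero_laurent[c Fc] FG.
by rewrite /Pf (laurent_coefE Fc) (laurent_coefE (laurent_expansion_near_eq FG Fc)).
Qed.

Lemma derive1nS_C n f : derive1n n.+1 f = derive1 (derive1n n f).
Proof. by []. Qed.

Lemma analytic_derive1n n f a : analytic f a -> analytic (derive1n n f) a.
Proof. by move=> fa; elim: n => //= n; exact: analytic_derive. Qed.

(** The induction step of Leibniz' rule: X stands for the derivatives of one factor, w^k for those
    of the exponential. *)
Lemma pascal_sum (X : nat -> C) w j :
  \sum_(k < j.+1) 'C(j, k)%:R * (X (j - k).+1 * w ^+ k + X (j - k)%N * w ^+ k.+1) =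
  \sum_(k < j.+2) 'C(j.+1, k)%:R * (X (j.+1 - k)%N * w ^+ k).
Proof.
rewrite [RHS]big_ord_recl /= bin0 subn0 expr0 !mul1r mulr1.
under [in RHS]eq_bigr do rewrite /bump /= add1n binS subSS natrD mulrDl.
rewrite big_split/= addrA.
transitivity (\sum_(k < j.+2) 'C(j, k)%:R * (X (j.+1 - k)%N * w ^+ k) +
  \sum_(k < j.+1) 'C(j, k)%:R * (X (j - k)%N * w ^+ k.+1)).
  rewrite [X in _ = X + _]big_ord_recr/= bin_small// mul0r addr0 -big_split/=.
  by apply: eq_bigr => k _; rewrite mulrDr subSn// -ltnS.
congr (_ + _); rewrite big_ord_recl/= bin0 subn0 expr0 mul1r mulr1.
by congr (_ + _); apply: eq_bigr => k _; rewrite /bump /= add1n subSS.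
Qed.

Lemma leibniz_exp f w a j : analytic f a -> derive1n j (fun s => f s * cexp (w * s)) a =
  \sum_(k < j.+1) 'C(j, k)%:R * (derive1n (j - k) f a * w ^+ k) * cexp (w * a).
Proof.
elim: j a => [|j IH] a fa.
  by rewrite big_ord_recl big_ord0 /= bin0 expr0 mul1r mulr1 addr0.
have [r r0 fr] := analytic_near fa.
rewrite derive1nS_C; pose t k s := 'C(j, k)%:R * (derive1n (j - k) f s * w ^+ k) * cexp (w * s).
have at' k : analytic (t k) a.
  apply: analyticM (analytic_cexp _ _); apply: analyticM; first exact: analytic_cst.
  by apply: analyticM; [exact: analytic_derive1n|exact: analytic_cst].
rewrite -(@derive1_eq _ (fun s => \sum_(k < j.+1) t k s) _ a r r0); first last.
- by apply: analytic_sum => k _; exact: at'.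
- by move=> h hr; rewrite IH//; exact: fr.
rewrite derive1_sum; last by move=> k _; exact: at'.
rewrite -mulr_suml -(pascal_sum (fun m => derive1n m f a)) mulr_suml; apply: eq_bigr => k _.
pose u s := ('C(j, k)%:R * w ^+ k) * derive1n (j - k) f s.
have au : analytic u a by apply: analyticM; [exact: analytic_cst|exact: analytic_derive1n].
have -> : t k = fun s => u s * cexp (w * s).
  by apply/funext => s; rewrite /t /u; congr (_ * _); rewrite -mulrA; congr (_ * _); exact: mulrC.
rewrite (derive1M au (analytic_cexp _ _)) derive1_cexp.
have -> : derive1 u a = 'C(j, k)%:R * w ^+ k * derive1n (j - k).+1 f a.
  rewrite /u (derive1M (analytic_cst _ _) (analytic_derive1n _ fa)) derive1_cst_C mul0r add0r.
  by rewrite derive1nS_C.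
rewrite /u exprS; move: (derive1n _ f a) (derive1n _ f a) ('C(j, k)%:R : C) (w ^+ k) (cexp _) => x y b e c.
ring.
Qed.

Lemma derive1_inv_prod n :
  derive1 (fun s => (\prod_(i < n) (s - (i.+1)%:R))^-1) (0 : C) =
  (\prod_(i < n) (0 - (i.+1)%:R))^-1 * \sum_(i < n) (i.+1)%:R^-1.
Proof.
elim: n => [|n IH].
  rewrite (_ : (fun s => _) = fun=> 1); last by apply/funext => s; rewrite big_ord0 invr1.
  by rewrite derive1_cst_C big_ord0 [X in _ * X]big_ord0 mulr0.
have c0 : (n.+1)%:R != 0 :> C by rewrite pnatr_eq0.
pose q s : C := (s - (n.+1)%:R)^-1.
have al : analytic (fun s => s - (n.+1)%:R) (0 : C).
  by apply: analyticB; [exact: analytic_id|exact: analytic_cst].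
have aq : analytic q 0 by apply: analyticV => //; rewrite sub0r oppr_eq0.
have dl : derive1 (fun s => s - (n.+1)%:R) (0 : C) = 1.
  rewrite (derive1D (analytic_id _) (analytic_cst _ _)) derive1_id_C.
  by rewrite derive1_cst_C addr0.
have dq : derive1 q 0 = - ((n.+1)%:R ^- 2).
  (* The derivative of q is obtained by differentiating (s - (n + 1)) q(s) = 1. *)
  have h1 : derive1 (fun s => (s - (n.+1)%:R) * q s) 0 = 0 :> C.
    rewrite -(@derive1_eq _ (fun=> 1) _ 0 1 ltr01) ?derive1_cst_C//; last exact: analytic_cst.
    move=> h h1; rewrite add0r /q mulfV// subr_eq0; apply/eqP => e.
    by move: h1; rewrite e cmod_nat ltrn1.
  move: h1; rewrite (derive1M al aq) dl mul1r sub0r {1}/q sub0r mulNr invrN.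
  move=> /eqP; rewrite addr_eq0 opprK => /eqP e.
  by rewrite expr2 invfM -mulrN e mulKf.
have ap : analytic (fun s => (\prod_(i < n) (s - (i.+1)%:R))^-1) (0 : C).
  by apply: analyticV; [exact: prod_pole0_neq0|exact: analytic_prod_pole].
rewrite (_ : (fun s => _) = fun s => (\prod_(i < n) (s - (i.+1)%:R))^-1 * q s); last first.
  by apply/funext => s; rewrite big_ord_recr/= invfM.
rewrite (derive1M ap aq) IH dq /q sub0r [in RHS]big_ord_recr/= [X in _ = _ * X]big_ord_recr/=.
have := prod_pole0_neq0 R n; set x := \prod_(i < n) _; set y := \sum_(i < n) _.
by move: (n.+1%:R : C) c0 => c c0' x0; field; rewrite c0' x0.
Qed.

(** Gamma(w) z^(-w), the meromorphic continuation of [J z] from the right half-plane. *)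
Definition Gz z w : C := Gamma w * cexp (- clog z * w).

Lemma mero_Gz z w : mero (Gz z) w.
Proof. by apply: meroM; [exact: mero_Gamma|apply: analytic_mero; exact: analytic_cexp]. Qed.

Lemma Gz_J z w : 0 < complex.Re z -> 0 < complex.Re w -> Gz z w = J z w.
Proof.
by move=> z0 w0; rewrite /Gz Gamma_right// (J_pow z0 w0) !mulNr [clog z * w]mulrC.
Qed.

Lemma derive1n_Gz z k w : 0 < complex.Re z -> 0 < complex.Re w ->
  derive1n k (Gz z) w = Mel (fun t => ez z t * (ln t)%:C ^+ k) w.
Proof.
move=> z0 w0; rewrite -(derive1n_Mel k (mel_ez z0))//.
elim: k w w0 => [|k IH] w w0; first exact: Gz_J.
rewrite !derive1nS_C; apply/esym/(@derive1_eq _ _ _ w (complex.Re w)) => //.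
  by move=> h hr; rewrite IH// (le_lt_trans _ (Re_near w hr))// subrr.
by apply: analytic_derive1n; exact: analytic_Mel (mel_ez z0) w0.
Qed.

Section Term.
Variables (al : C) (m : nat) (A : nat -> C) (z : C).

(* The Mellin transform of the sum of the A_k t^al log^k t e^(-tz), k <= m, continued to all s. *)
Definition heat_term s : C := \sum_(k < m.+1) A k * derive1n k (Gz z) (s + al).

Lemma mero_heat_term s : mero heat_term s.
Proof.
apply: mero_sum => k _; apply: meroM; first by apply: analytic_mero; exact: analytic_cst.
by apply: mero_shift; apply: mero_derive1n; exact: mero_Gz.
Qed.

(** The contribution of al to the derivative of zeta at 0, hence the negative of its term in the
    expansion of log det. *)
Definition regular_coef : C := \sum_(k < m.+1) (-1) ^+ k *
  (\sum_(k <= j < m.+1) A j * 'C(j, k)%:R * Pf (derive1n (j - k) Gamma) al) *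
  cpow z (- al) * clog z ^+ k.

Lemma heat_term_regular : ~ is_Zplus (- al) -> exists2 f, analytic f 0 &
  near_eq (fun s => rGamma s * heat_term s) f 0 /\ derive1 f 0 = regular_coef.
Proof.
move=> /is_ZplusP ga; have aG := analytic_Gamma ga.
have aGz : analytic (Gz z) al by apply: analyticM => //; exact: analytic_cexp.
have at' : analytic heat_term 0.
  apply: analytic_sum => k _; apply: analyticM; first exact: analytic_cst.
  by apply: analytic_shift; rewrite add0r; exact: analytic_derive1n.
exists (fun s => rGamma s * heat_term s); first exact: analyticM (analytic_rGamma _) at'.
split; first exact: near_eq_refl.
rewrite (derive1M (analytic_rGamma _) at') rGamma0 mul0r addr0 derive1_rGamma0 mul1r.
rewrite /heat_term /regular_coef.
(* j numbers the heat coefficients and k the powers of log z; the triangle is written as a square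
   with a condition so that the sums can be exchanged. *)
transitivity (\sum_(j < m.+1) \sum_(k < m.+1 | (k <= j)%N)
  A j * ('C(j, k)%:R * (derive1n (j - k) Gamma al * (- clog z) ^+ k) * cexp (- clog z * al))).
  apply: eq_bigr => j _; rewrite add0r leibniz_exp// mulr_sumr.
  rewrite (big_ord_widen_cond m.+1 xpredT (fun k => A j * ('C(j, k)%:R *
    (derive1n (j - k) Gamma al * (- clog z) ^+ k) * cexp (- clog z * al))))//.
rewrite (exchange_big_dep xpredT)//=; apply: eq_bigr => k _.
rewrite big_geq_mkord mulr_sumr !mulr_suml; apply: eq_bigr => j _.
rewrite Pf_analytic; last exact: analytic_derive1n.
rewrite /cpow [- al * _]mulrC mulrN mulNr [(- clog z) ^+ k]exprNn.
move: (derive1n _ _ _) ('C(j, k)%:R : C) (cexp _) ((-1) ^+ k) (clog z ^+ k) => a b c d e; ring.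
Qed.

Lemma heat_term_pole (n : nat) : z != 0 -> al = - n%:R -> (forall k, (0 < k)%N -> A k = 0) ->
  exists2 f, analytic f 0 & near_eq (fun s => rGamma s * heat_term s) f 0 /\
  derive1 f 0 = - (A 0%N * Res Gamma al *
    (z ^+ n * clog z - (\sum_(1 <= j < n.+1) j%:R^-1) * z ^+ n)).
Proof.
move=> z0 eal A0; pose P s : C := (\prod_(i < n) (s - (i.+1)%:R))^-1.
have aP : analytic P 0.
  by apply: analyticV; [exact: prod_pole0_neq0|exact: analytic_prod_pole].
have ae : analytic (fun s => cexp (- clog z * (s - n%:R))) 0.
  by apply: (@analytic_shift _ (fun s => cexp (- clog z * s))); exact: analytic_cexp.
exists (fun s => A 0%N * (P s * cexp (- clog z * (s - n%:R)))).
  by apply: analyticM; [exact: analytic_cst|exact: analyticM].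
split.
  exists 1 => // h h0 h1; rewrite add0r /heat_term big_ord_recl big1 ?addr0 => [|i _]; last first.
    by rewrite A0 ?mul0r.
  rewrite mulrCA eal -[derive1n _ _ _]/(Gz z (h - n%:R)) /Gz; congr (_ * _).
  by rewrite mulrA (rGamma_Gamma_pole _ h0 h1).
rewrite (derive1M (analytic_cst _ _) (analyticM aP ae)) derive1_cst_C mul0r add0r.
rewrite (derive1M aP ae) derive1_inv_prod.
rewrite (@derive1_shift _ (fun s => cexp (- clog z * s)))//; last exact: analytic_cexp.
rewrite derive1_cexp eal Res_Gamma {1}/P prod_pole0 add0r mulrN mulNr opprK [clog z * n%:R]mulrC cexp_natl clogK//.
rewrite big_add1 big_mkord /=.
by move: (_^-1) (z ^+ n) (clog z) (\sum_(_ < _) _) => a b c d; ring.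
Qed.

End Term.

End HeatTerms.

Section MonotoneIntegral.
Variable R : realType.
Local Notation mu := (@lebesgue_measure R).
Local Notation D := (`]0, +oo[%classic : set R).
Implicit Types (t x a b : R).

Lemma meas_cvg (u_ : nat -> R -> R) (u : R -> R) : (forall n, measurable_fun D (u_ n)) ->
  (forall t, 0 < t -> u_ n t @[n --> \oo] --> u t) -> measurable_fun D u.
Proof.
by move=> mu_ uu; apply: (measurable_fun_cvg (h := u_)) => // t /inD; exact: uu.
Qed.

Lemma rint_monotone (u_ : nat -> R -> R) (u : R -> R) (B : R) : (forall n, rint (u_ n)) ->
  (forall n t, 0 < t -> 0 <= u_ n t) -> (forall n t, 0 < t -> u_ n t <= u_ n.+1 t) ->
  (forall t, 0 < t -> u_ n t @[n --> \oo] --> u t) -> (forall n, rI (u_ n) <= B) -> rint u.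
Proof.
move=> iu u0 uS uu uB; have mD := @mDpos R.
have mu_ n : measurable_fun D (u_ n) by exact: rint_meas.
have mu' := meas_cvg mu_ uu.
have homo t : 0 < t -> {homo u_^~ t : n m / (n <= m)%N >-> n <= m}.
  by move=> t0; apply/nondecreasing_seqP => n; exact: uS.
have up t : 0 < t -> 0 <= u t.
  move=> t0; have := uu _ t0 => /cvgP cu; rewrite -(cvg_lim _ (uu _ t0))//.
  by apply: limr_ge => //; apply: nearW => n; exact: u0.
apply/integrableP; split; first exact/measurable_EFinP.
have -> : (\int[mu]_(t in D) `|(EFin \o u) t| =
    \int[mu]_(t in D) (limn (fun n => (EFin \o u_ n) t)))%E.
  apply: eq_integral => t /[!inE] /inD t0; rewrite /= ger0_norm ?up//.
  apply/esym/cvg_lim => //; apply: cvg_EFin; [exact: nearW|exact: uu].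
rewrite (@monotone_convergence _ _ R mu D mD (fun n => EFin \o u_ n)).
- apply: (@le_lt_trans _ _ B%:E); last exact: ltry.
  have nd : {homo (fun n => (\int[mu]_(t in D) (EFin \o u_ n) t)%E) : n m / (n <= m)%N >-> (n <= m)%E}.
    move=> n m nm; apply: ge0_le_integral => //.
    + by move=> t /inD t0; rewrite /= lee_fin u0.
    + by apply/measurable_EFinP; exact: mu_.
    + by apply/measurable_EFinP; exact: mu_.
    + by move=> t /inD t0; rewrite /= lee_fin homo.
  apply: lime_le; first exact: ereal_nondecreasing_is_cvgn.
  apply: nearW => n; have := uB n; rewrite -lee_fin; apply: le_trans.
  rewrite /rI /Rintegral fineK; first exact: lexx.
  by apply: integrable_fin_num => //; exact: iu.
- by move=> n; apply/measurable_EFinP; exact: mu_.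
- by move=> n t /inD t0; rewrite /= lee_fin u0.
- by move=> t /inD t0 n m nm; rewrite /= lee_fin homo.
Qed.

(** Equal to Gamma(a) x^(-a); the scaling in x is [gint_pow]. *)
Definition gint (a x : R) : R := rI (fun t => expR ((a - 1) * ln t - x * t)).

Lemma J_real a x : 0 < a -> 0 < x -> J x%:C (a%:C) = (gint a x)%:C.
Proof.
move=> a0 x0; have e1 t : ez x%:C t * mexp (a%:C - 1) t = (expR ((a - 1) * ln t - x * t))%:C :> R[i].
  rewrite /ez /mexp -[1]/((1 : R)%:C) -rmorphB/= -rmorphN -!rmorphM/= !cexp_real -rmorphM/=.
  by rewrite -expRD mulNr addrC.
apply: complexP.
  by rewrite Re_cint; apply: eq_rI => t _; rewrite e1.
rewrite Im_cint (@eq_rI _ _ (fun=> 0)); last by move=> t _; rewrite e1.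
by rewrite -[RHS]/(complex.Im (0 : R[i])) -(cint0 R).
Qed.

Lemma gint_pow a x : 0 < a -> 0 < x -> gint a x = gint a 1 * expR (- a * ln x).
Proof.
move=> a0 x0; apply: (@complexI R).
rewrite rmorphM/= -!J_real// J_pow// clog_real//.
by rewrite -rmorphN -rmorphM/= cexp_real.
Qed.

Lemma gint_ge0 a x : 0 <= gint a x.
Proof. by apply: rI_ge0 => t _; exact: expR_ge0. Qed.

End MonotoneIntegral.

(** * Heat trace, its tail, and the continued zeta function *)

Section HeatMellin.
Variable R : realType.
Local Notation C := R[i].
Implicit Types (t x a b : R) (s z h al : C).

(** The operator enters here only through the eigenvalues [lam i] with multiplicities [w i], the
    heat trace [th] and the zeta series [zs]; [spectral_data] supplies them. *)
Variables (lam w : nat -> R) (p S : R) (th : R -> R) (zs : C -> C -> C).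
Hypothesis lam0 : forall i, 0 <= lam i.
Hypothesis w0 : forall i, 0 <= w i.
Hypothesis wS : forall N, \sum_(i < N) w i * expR (- p * ln (1 + lam i)) <= S.
Hypothesis p1 : 1 <= p.
Hypothesis th_sum : forall t, 0 < t ->
  (fun N => \sum_(i < N) w i * expR (- (t * lam i))) @ \oo --> th t.
Hypothesis zs_sum : forall z s, 0 < complex.Re z -> p < complex.Re s ->
  ccvg (fun N => \sum_(i < N) (w i)%:C * cpow ((lam i)%:C + z) (- s)) (zs z s).

Lemma th_partial t N : 0 < t -> \sum_(i < N) w i * expR (- (t * lam i)) <= th t.
Proof.
move=> t0; rewrite -(cvg_lim _ (th_sum t0))//; apply: nondecreasing_cvgn_le; last first.
  by apply/cvg_ex; exists (th t); exact: th_sum.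
apply/nondecreasing_seqP => n; rewrite big_ord_recr/= lerDl.
by rewrite mulr_ge0 ?w0// expR_ge0.
Qed.

Lemma th_ge0 t : 0 < t -> 0 <= th t.
Proof. by move=> t0; have := th_partial 0 t0; rewrite big_ord0. Qed.

Lemma th_le a t : 0 < a -> a <= t -> th t <= th a.
Proof.
move=> a0 at'; have t0 : 0 < t by exact: lt_le_trans at'.
rewrite -(cvg_lim _ (th_sum t0))//; apply: limr_le.
  by apply/cvg_ex; exists (th t); exact: th_sum.
apply: nearW => N; apply: le_trans (th_partial N a0); apply: ler_sum => i _.
by rewrite ler_wpM2l ?w0// ler_expR lerN2 ler_wpM2r.
Qed.

Lemma meas_th : measurable_fun (`]0, +oo[%classic : set R) th.
Proof.
apply: meas_cvg th_sum => N.
have m1 : forall i, measurable_fun (`]0, +oo[%classic : set R) (fun t => w i * expR (- (t * lam i))).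
  move=> i; apply: measurable_funM; first exact: measurable_cst.
  apply: meas_expR; apply: measurable_funN; apply: measurable_funM; first exact: meas_id.
  exact: measurable_cst.
elim: N => [|N IH].
  rewrite (_ : (fun t => _) = fun=> 0); last by apply/funext => t; rewrite big_ord0.
  exact: measurable_cst.
rewrite (_ : (fun t => _) = fun t => \sum_(i < N) w i * expR (- (t * lam i)) +
  w N * expR (- (t * lam N))); last by apply/funext => t; rewrite big_ord_recr.
exact: measurable_funD.
Qed.

Definition thc t : C := (th t)%:C.
Definition theta z t : C := thc t * ez z t.

(** From lam + x >= q (1 + lam) with q = min(1, x): each term is at most a constant times (1 +
    lam)^(-b) <= (1 + lam)^(-p), which the Schatten condition sums. *)
Lemma sum_gint_bound b x : p <= b -> 0 < x -> exists B : R, forall N,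
  \sum_(i < N) w i * gint b (lam i + x) <= B.
Proof.
move=> pb x0; have b0 : 0 < b by apply: lt_le_trans pb; apply: lt_le_trans p1.
pose q := Num.min 1 x; have q0 : 0 < q by rewrite lt_min ltr01.
exists (gint b 1 * expR (- b * ln q) * S) => N.
apply: le_trans (ler_wpM2l _ (wS N)); last by rewrite mulr_ge0 ?gint_ge0 ?expR_ge0.
rewrite mulr_sumr; apply: ler_sum => i _.
have l1 : 0 < 1 + lam i by rewrite ltr_wpDr.
have lx : 0 < lam i + x by rewrite ltr_wpDl.
rewrite gint_pow// mulrCA -[leRHS]mulrA ler_wpM2l ?gint_ge0// mulrCA ler_wpM2l ?w0//.
rewrite -expRD ler_expR.
have h1 : ln (q * (1 + lam i)) <= ln (lam i + x).
  rewrite ler_ln ?posrE ?mulr_gt0// mulrDr mulr1 addrC lerD//.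
    by rewrite ler_piMl// ge_min lexx.
  by rewrite ge_min lexx orbT.
rewrite lnM ?posrE// in h1.
have h2 : 0 <= ln (1 + lam i) by rewrite ln_ge0// lerDl.
by nra.
Qed.

(** Monotone convergence over the partial sums of the trace reduces integrability to the sum of the
    Gamma integrals at [lam i] + Re z. *)
Lemma mel_theta z : 0 < complex.Re z -> mel (theta z) p.
Proof.
move=> z0; split.
  by apply: cmeasM; [apply: cmeas_real; exact: meas_th|exact: cmeas_ez].
move=> b pb; have b0 : 0 < b by apply: lt_trans pb; apply: lt_le_trans p1.
have [B hB] := sum_gint_bound (ltW pb) z0.
have xi i : 0 < lam i + complex.Re z by rewrite ltr_wpDl.
apply: (@rint_monotone _ (fun N t => \sum_(i < N) w i *
    expR ((b - 1) * ln t - (lam i + complex.Re z) * t)) _ B).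
- move=> N; elim: N => [|N IH].
    apply: eq_rint (rintZ 0 (rint_gamma b0 z0)) => t _.
    by rewrite big_ord0 mul0r.
  have := rintD IH (rintZ (w N) (rint_gamma b0 (xi N))).
  by apply: eq_rint => t _; rewrite big_ord_recr.
- by move=> n t t0; apply: sumr_ge0 => i _; rewrite mulr_ge0 ?w0 ?expR_ge0.
- by move=> n t t0; rewrite big_ord_recr/= lerDl mulr_ge0 ?w0 ?expR_ge0.
- move=> t t0; rewrite cmodM cmodR ger0_norm ?th_ge0// cmod_ez -mulrA.
  have -> : (fun n => \sum_(i < n) w i * expR ((b - 1) * ln t - (lam i + complex.Re z) * t)) =
      (fun n => (\sum_(i < n) w i * expR (- (t * lam i))) *
        (expR (- complex.Re z * t) * expR ((b - 1) * ln t))).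
    apply/funext => n; rewrite mulr_suml; apply: eq_bigr => i _.
    by rewrite -mulrA -!expRD; congr (_ * expR _); ring.
  by apply: cvgMl; exact: th_sum.
- move=> N; apply: le_trans (hB N).
  have H n : rint (fun t => \sum_(i < n) w i * expR ((b - 1) * ln t - (lam i + complex.Re z) * t)) /\
    rI (fun t => \sum_(i < n) w i * expR ((b - 1) * ln t - (lam i + complex.Re z) * t)) =
    \sum_(i < n) w i * gint b (lam i + complex.Re z).
    elim: n => [|n [IH1 IH2]].
      have i0 := rintZ 0 (rint_gamma b0 z0); split.
        by apply: eq_rint i0 => t _; rewrite big_ord0 mul0r.
      rewrite big_ord0 -[RHS](mul0r (gint b (complex.Re z))) -(rIZ 0 (rint_gamma b0 z0)).
      by apply: eq_rI => t _; rewrite big_ord0 mul0r.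
    have i1 := rintZ (w n) (rint_gamma b0 (xi n)); split.
      by apply: eq_rint (rintD IH1 i1) => t _; rewrite big_ord_recr.
    rewrite big_ord_recr/= -IH2 -(rIZ (w n) (rint_gamma b0 (xi n))) -(rID IH1 i1).
    by apply: eq_rI => t _; rewrite big_ord_recr.
  by rewrite (H N).2.
Qed.

Lemma Mel_theta z s : 0 < complex.Re z -> p < complex.Re s ->
  Mel (theta z) s = Gamma s * zs z s.
Proof.
move=> z0 ps; have s0 : 0 < complex.Re s by apply: lt_trans ps; apply: lt_le_trans p1.
have zi i : 0 < complex.Re ((lam i)%:C + z) by rewrite cReD Re_real ltr_wpDl.
have mt := mel_theta z0.
have ezD i t : ez ((lam i)%:C + z) t = (expR (- (t * lam i)))%:C * ez z t.
  rewrite -cexp_real /ez -cexpD; congr cexp.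
  by rewrite rmorphN rmorphM/=; ring.
have [] := @cint_dominated _ (fun N t => \sum_(i < N) (w i)%:C * (ez ((lam i)%:C + z) t * mexp (s - 1) t))
  (fun t => theta z t * mexp (s - 1) t)
  (fun t => cmod (theta z t) * expR ((complex.Re s - 1) * ln t)).
- move=> n; apply: cmeas_sum => i _; apply: cmeasM; first exact: cmeas_cst.
  by apply: cmeasM; [exact: cmeas_ez|exact: cmeas_mexp].
- by case: mt => _; apply.
- move=> n t t0.
  rewrite (_ : \sum_(_ < _) _ = (\sum_(i < n) w i * expR (- (t * lam i)))%:C * ez z t * mexp (s - 1) t).
    rewrite 2!cmodM cmod_mexp cReD cReN ler_wpM2r ?expR_ge0// cmodM.
    rewrite ler_wpM2r ?cmod_ge0// !cmodR !ger0_norm ?th_ge0 ?th_partial//.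
    by apply: sumr_ge0 => i _; rewrite mulr_ge0 ?w0 ?expR_ge0.
  rewrite rmorph_sum/= !mulr_suml; apply: eq_bigr => i _.
  by rewrite ezD rmorphM/=; ring.
- move=> t t0; rewrite -mulrA mulrC.
  have th_c : ccvg (fun N => (\sum_(i < N) w i * expR (- (t * lam i)))%:C) (th t)%:C.
    by apply: ccvg_ReIm => /=; [exact: th_sum|exact: cvg_cst].
  apply: eq_ccvg (ccvgMl (ez z t * mexp (s - 1) t) th_c) => N.
  rewrite rmorph_sum/= mulr_sumr; apply: eq_bigr => i _.
  by rewrite ezD rmorphM/=; ring.
- by apply: cmeasM; [case: mt|exact: cmeas_mexp].
move=> _ cv; apply: (ccvg_uniq cv).
apply: eq_ccvg (ccvgMl (Gamma s) (zs_sum z0 ps)) => N.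
have im i : cintble (fun t => ez ((lam i)%:C + z) t * mexp (s - 1) t).
  by apply: mel_cintble (mel_ez _) _.
rewrite cint_sum; last by move=> i _; exact: cintbleZ.
rewrite mulr_sumr; apply: eq_bigr => i _; rewrite cintZ// -[cint _]/(J _ s).
by rewrite J_pow// Gamma_right// /cpow mulrCA.
Qed.

Variables (calA : set C) (kmax : C -> nat) (AH : C -> nat -> C).
Hypothesis hA : admissible_exponents calA.
Hypothesis hAH0 : forall al k, ~ (calA al /\ (k <= kmax al)%N) -> AH al k = 0.
Hypothesis hlog : forall al k, is_Zplus (- al) -> (0 < k)%N -> AH al k = 0.

Definition expo (K : R) : set C := [set al | calA al /\ complex.Re al <= K].

(** The real parts of the exponents are bounded below, for otherwise -oo would be a limit point of
    them in the extended reals. The exponents with Re <= K thus lie in a finite strip. *)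
Lemma finite_expo K : finite_set (expo K).
Proof.
have [_ strip lim] := hA.
suff [b hb] : exists b : R, forall al, calA al -> b <= complex.Re al.
  by apply: sub_finite_set (strip b K) => al [cal alK]; split => //; rewrite hb.
apply: contrapT => nb.
have : limit_point [set (complex.Re al)%:E | al in calA] -oo%E.
  move=> U /= [r [_ hU]].
  have [al] : exists al, calA al /\ complex.Re al < r.
    apply: contrapT => na; apply: nb; exists r => al cal; rewrite leNgt.
    by apply/negP => h; apply: na; exists al.
  move=> [cal alr]; exists (complex.Re al)%:E; split => //.
    by exists al.
  by apply: hU; rewrite lte_fin.
by move/lim.
Qed.

Definition expos (K : R) : seq C := finmap.enum_fset (fset_set (expo K)).

Lemma expos_sum (K : R) (F : C -> C) : \sum_(al \in expo K) F al = \sum_(al <- expos K) F al.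
Proof. by rewrite fsbig_finite//; exact: finite_expo. Qed.

Definition tail K t : C := thc t - \sum_(al <- expos K) \sum_(k < (kmax al).+1)
  AH al k * mexp al t * (ln t)%:C ^+ k.

Hypothesis htail : forall K, 0 < K -> exists M t0 : R, 0 < t0 /\
  forall t, 0 < t -> t < t0 -> cmod (tail K t) <= M * expR (K * ln t).

(** The quotient of the left side by t^K is at most e^(q |ln t|) with q = |b - K| + k. For t0 <= t <
    1 the logarithm is bounded, and beyond that q ln t is bounded by a linear function of
    arbitrarily small slope. *)
Lemma pow_log_bound b K e t0 (k : nat) : 0 < e -> 0 < t0 -> exists B, forall t, t0 <= t ->
  expR (b * ln t) * `|ln t| ^+ k <= B * expR (K * ln t + e * t).
Proof.
move=> e0 t00; pose q := `|b - K| + k%:R.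
have q0 : 0 <= q by rewrite addr_ge0.
have [c hc] := ln_le_linear q0 e0.
exists (expR (q * `|ln t0| + `|c|)) => t t0t.
have t0' : 0 < t by exact: lt_le_trans t0t.
have l1 : `|ln t| ^+ k <= expR (k%:R * `|ln t|).
  rewrite expRM_natl lerXn2r ?nnegrE ?expR_ge0//.
  by apply: le_trans (expR_ge1Dx _); rewrite lerDr.
rewrite (le_trans (ler_wpM2l (expR_ge0 _) l1))// -!expRD ler_expR.
have h1 : q * `|ln t| <= q * `|ln t0| + `|c| + e * t.
  have [lt0|lt0] := leP 0 (ln t).
    rewrite (ger0_norm lt0) (le_trans (hc _ t0'))// addrC lerD2r.
    by rewrite (le_trans (ler_norm _))// lerDr mulr_ge0.
  have h2 : `|ln t| <= `|ln t0|.
    have : ln t0 <= ln t by rewrite ler_ln ?posrE.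
    by rewrite (ltr0_norm lt0) => h3; rewrite -normrN (le_trans _ (ler_norm _))// lerN2.
  rewrite -addrA (le_trans (ler_wpM2l q0 h2))// lerDl addr_ge0// mulr_ge0 ?(ltW e0)//.
  exact: ltW.
have h2 : (b - K) * ln t <= `|b - K| * `|ln t| by rewrite -normrM ler_norm.
move: h1 h2; rewrite /q; lra.
Qed.

(** The heat expansion controls the tail near 0 only. Beyond t0 the trace is bounded because it
    decreases, and the finitely many terms grow like powers with logarithms; a slowly growing
    exponential, to be outweighed by e^(-tz), covers both. *)
Lemma tail_bound K e : 0 < K -> 0 < e -> exists B : R, 0 <= B /\ forall t, 0 < t ->
  cmod (tail K t) <= B * expR (K * ln t + e * t).
Proof.
move=> K0 e0; have [M [t0 [t00 hM]]] := htail K0.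
have [B0 hB0] := pow_log_bound 0 K 0 e0 t00.
have hterm (l : seq C) : exists B : R, forall t, t0 <= t ->
   cmod (\sum_(al <- l) \sum_(k < (kmax al).+1) AH al k * mexp al t * (ln t)%:C ^+ k) <=
   B * expR (K * ln t + e * t).
  elim: l => [|al l [B IH]].
    by exists 0 => t _; rewrite big_nil cmod0 mul0r.
  have [B' hB'] : exists B : R, forall t, t0 <= t ->
     cmod (\sum_(k < (kmax al).+1) AH al k * mexp al t * (ln t)%:C ^+ k) <=
     B * expR (K * ln t + e * t).
    elim: (kmax al).+1 => [|n [B' IHn]].
      by exists 0 => t _; rewrite big_ord0 cmod0 mul0r.
    have [B2 h2] := pow_log_bound (complex.Re al) K n e0 t00.
    exists (B' + cmod (AH al n) * B2) => t tt; rewrite big_ord_recr/=.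
    rewrite (le_trans (cmodD _ _))// mulrDl lerD ?IHn//.
    by rewrite !cmodM cmod_mexp cmodX cmodR -!mulrA ler_wpM2l ?cmod_ge0// h2.
  exists (B' + B) => t tt; rewrite big_cons (le_trans (cmodD _ _))// mulrDl lerD//.
    exact: hB'.
  exact: IH.
have [B1 hB1] := hterm (expos K).
exists (`|M| + `|th t0 * B0 + B1|); split; first by rewrite addr_ge0.
move=> t tp; have E0 := expR_ge0 (K * ln t + e * t).
have [tt|tt] := leP t0 t.
  rewrite mulrDl ler_wpDl ?mulr_ge0//.
  apply: (@le_trans _ _ ((th t0 * B0 + B1) * expR (K * ln t + e * t))); last first.
    by rewrite ler_wpM2r ?ler_norm.
  rewrite mulrDl (le_trans (cmodBD _ _))// lerD ?hB1// cmodR ger0_norm ?th_ge0//.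
  rewrite (le_trans (th_le t00 tt))// -mulrA -[leLHS]mulr1 ler_wpM2l ?th_ge0//.
  by have := hB0 _ tt; rewrite mul0r expR0 expr0 mulr1.
rewrite mulrDl ler_wpDr ?mulr_ge0//.
rewrite (le_trans (hM _ tp tt))// (le_trans (ler_wpM2r (expR_ge0 _) (ler_norm M)))//.
by rewrite ler_wpM2l// ler_expR lerDl mulr_ge0// ltW.
Qed.

Lemma cmeas_tail K : cmeas (tail K).
Proof.
rewrite /tail (_ : (fun t => _) = fun t => thc t + (-1) * \sum_(al <- expos K)
  \sum_(k < (kmax al).+1) AH al k * mexp al t * (ln t)%:C ^+ k); last first.
  by apply/funext => t; rewrite mulN1r.
apply: cmeasD; first by apply: cmeas_real; exact: meas_th.
apply: cmeasM; first exact: cmeas_cst.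
apply: cmeas_sum => al _; apply: cmeas_sum => k _; apply: cmeasM.
  by apply: cmeasM; [exact: cmeas_cst|exact: cmeas_mexp].
by apply: cmeasX; exact: cmeas_ln.
Qed.

Lemma mel_tail K z : 0 < K -> 0 < complex.Re z -> mel (fun t => tail K t * ez z t) (- K).
Proof.
move=> K0 z0; have z2 : 0 < complex.Re z / 2%:R by rewrite divr_gt0.
have [B [B0 hB]] := tail_bound K0 z2.
split; first by apply: cmeasM; [exact: cmeas_tail|exact: cmeas_ez].
move=> b Kb; have Kb0 : 0 < K + b by rewrite addrC -ltrBlDr sub0r.
apply: rint_le (rintZ B (rint_gamma Kb0 z2)).
  apply: measurable_funM.
    by apply: meas_cmod; apply: cmeasM; [exact: cmeas_tail|exact: cmeas_ez].
  apply: meas_expR; apply: measurable_funM; [exact: measurable_cst|exact: meas_ln].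
move=> t t0; rewrite ger0_norm ?mulr_ge0 ?cmod_ge0 ?expR_ge0// cmodM cmod_ez.
rewrite (le_trans (ler_wpM2r (expR_ge0 _) (ler_wpM2r (expR_ge0 _) (hB _ t0))))//.
rewrite -!mulrA ler_wpM2l// -!expRD ler_expR le_eqVlt; apply/orP; left; apply/eqP.
by field.
Qed.

(* The Mellin transform of th(t) e^(-tz), continued to Re s > -K. *)
Definition contin K z s : C := \sum_(al <- expos K) heat_term al (kmax al) (AH al) z s +
  Mel (fun t => tail K t * ez z t) s.

Lemma mero_contin K z s : 0 < K -> 0 < complex.Re z -> - K < complex.Re s ->
  mero (contin K z) s.
Proof.
move=> K0 z0 sK; apply: meroD; first by apply: mero_sum => al _; exact: mero_heat_term.
by apply: analytic_mero; exact: analytic_Mel (mel_tail K0 z0) sK.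
Qed.

Lemma contin_theta K z s : 0 < K -> 0 < complex.Re z -> p < complex.Re s ->
  (forall al, al \in expos K -> 0 < complex.Re (s + al)) -> contin K z s = Mel (theta z) s.
Proof.
move=> K0 z0 ps sal; have p0 : 0 < p by apply: lt_le_trans p1.
have i1 : cintble (fun t => tail K t * ez z t * mexp (s - 1) t).
  by apply: mel_cintble (mel_tail K0 z0) _; apply: lt_trans ps; apply: lt_trans p0; rewrite oppr_lt0.
pose g al k t : C := AH al k * (ez z t * (ln t)%:C ^+ k * mexp (s + al - 1) t).
have i0 al k : 0 < complex.Re (s + al) ->
    cintble (fun t => ez z t * (ln t)%:C ^+ k * mexp (s + al - 1) t).
  by move=> h; apply: mel_cintble (mel_lnX k (mel_ez z0)) h.
have i2 al : al \in expos K -> cintble (fun t => \sum_(k < (kmax al).+1) g al k t).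
  by move=> /sal h; apply: cintble_sum => k _; apply: cintbleZ; exact: i0.
have i3 : cintble (fun t => \sum_(al <- expos K | al \in expos K) \sum_(k < (kmax al).+1) g al k t).
  by apply: cintble_sum => al; exact: i2.
have -> : Mel (theta z) s = cint (fun t => (\sum_(al <- expos K | al \in expos K)
    \sum_(k < (kmax al).+1) g al k t) + tail K t * ez z t * mexp (s - 1) t).
  apply: eq_cint => t _; rewrite -big_seq /theta /tail !mulrBl [RHS]addrC.
  rewrite [X in _ = _ - X + _](_ : _ = \sum_(al <- expos K) \sum_(k < (kmax al).+1) g al k t).
    by rewrite subrK.
  rewrite !mulr_suml; apply: eq_bigr => al _; rewrite !mulr_suml; apply: eq_bigr => k _.
  rewrite /g [s + al - 1]addrAC [mexp (s - 1 + al) t]mexpD.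
  by move: (ez _ _) (mexp _ _) (mexp _ _) (_ ^+ _) => a b c d; ring.
rewrite cintD// cint_sum//; congr (_ + _); rewrite big_seq; apply: eq_bigr => al hal.
rewrite cint_sum; last by move=> k _; apply: cintbleZ; apply: i0; exact: sal.
apply: eq_bigr => k _; rewrite cintZ; last by apply: i0; exact: sal.
by rewrite derive1n_Gz//; exact: sal.
Qed.

Lemma contin_theta_large K z : 0 < K -> 0 < complex.Re z -> exists c : R, forall s,
  c < complex.Re s -> contin K z s = Mel (theta z) s.
Proof.
move=> K0 z0; have [c hc] : exists c : R, forall al, al \in expos K -> - complex.Re al <= c.
  elim: (expos K) => [|al l [c IH]]; first by exists 0.
  exists (Num.max c (- complex.Re al)) => be; rewrite inE => /orP[/eqP ->|/IH h].
    by rewrite le_max lexx orbT.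
  by rewrite le_max h.
exists (Num.max c p) => s; rewrite gt_max => /andP[cs ps]; apply: contin_theta => // al /hc h.
by rewrite cReD -ltrBlDr sub0r (le_lt_trans h).
Qed.

Lemma Re_segment (a b : C) (x : R) : complex.Re (a + x%:C * (b - a)) =
  (1 - x) * complex.Re a + x * complex.Re b.
Proof. by rewrite cReD mulrC Re_mulR cReD cReN; ring. Qed.

Lemma identity_half_plane (F G : C -> C) c (a b : C) : (forall s, c < complex.Re s -> mero F s /\ mero G s) ->
  c < complex.Re a -> c < complex.Re b -> near_eq F G a -> near_eq F G b.
Proof.
move=> FG ca cb; apply: identity_theorem => x /andP[x0 x1]; apply: FG.
rewrite Re_segment; have [->|xn] := eqVneq x 0; first by rewrite subr0 mul1r mul0r addr0.
have xp : 0 < x by rewrite lt_neqAle eq_sym xn.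
nra.
Qed.

Lemma near_half_plane (F G : C -> C) c (a : C) : (forall s, c < complex.Re s -> F s = G s) ->
  c < complex.Re a -> near_eq F G a.
Proof.
move=> FG ca; exists (complex.Re a - c); first by rewrite subr_gt0.
by move=> h _ hr; apply: FG; have := Re_near a hr; rewrite subKr.
Qed.

(** Termwise Mellin transforms require Re (s + al) > 0 for all exponents used, perhaps far to the
    right of p. The identity theorem brings the equality back to Re s > p. *)
Lemma contin_near_theta K z s : 0 < K -> 0 < complex.Re z -> p < complex.Re s ->
  near_eq (contin K z) (Mel (theta z)) s.
Proof.
move=> K0 z0 ps; have p0 : 0 < p by apply: lt_le_trans p1.
have [c hc] := contin_theta_large K0 z0.
apply: (@identity_half_plane _ _ p ((Num.max c p + 1)%:C)) => //.
- move=> v pv; split; last by apply: analytic_mero; exact: analytic_Mel (mel_theta z0) pv.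
  by apply: mero_contin => //; apply: lt_trans pv; apply: lt_trans p0; rewrite oppr_lt0.
- by rewrite Re_real ltr_pwDr// le_max lexx orbT.
- by apply: near_half_plane hc _; rewrite Re_real ltr_pwDr// le_max lexx.
Qed.

Lemma contin_near K K' z s : 0 < K -> 0 < K' -> 0 < complex.Re z ->
  - K < complex.Re s -> - K' < complex.Re s -> near_eq (contin K z) (contin K' z) s.
Proof.
move=> K0 K'0 z0 sK sK'; have p0 : 0 < p by apply: lt_le_trans p1.
apply: (@identity_half_plane _ _ (Num.max (- K) (- K')) (p + 1)%:C).
- by move=> v; rewrite gt_max => /andP[h1 h2]; split; exact: mero_contin.
- rewrite Re_real gt_max; apply/andP; split; lra.
- by rewrite gt_max sK.
- apply: near_eq_trans (near_eq_sym (contin_near_theta K'0 z0 _)).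
    by apply: contin_near_theta => //; rewrite Re_real ltrDl.
  by rewrite Re_real ltrDl.
Qed.

Definition zfun K z s : C := rGamma s * contin K z s.

Lemma mero_zfun K z s : 0 < K -> 0 < complex.Re z -> - K < complex.Re s -> mero (zfun K z) s.
Proof.
move=> K0 z0 sK; apply: meroM (mero_contin K0 z0 sK).
by apply: analytic_mero; exact: analytic_rGamma.
Qed.

Lemma zfun_near K K' z s : 0 < K -> 0 < K' -> 0 < complex.Re z ->
  - K < complex.Re s -> - K' < complex.Re s -> near_eq (zfun K z) (zfun K' z) s.
Proof.
move=> K0 K'0 z0 sK sK'; have [r r0 h] := contin_near K0 K'0 z0 sK sK'.
by exists r => // x x0 xr; rewrite /zfun h.
Qed.

Lemma zfun_near_zs K z s : 0 < K -> 0 < complex.Re z -> p < complex.Re s ->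
  near_eq (zfun K z) (zs z) s.
Proof.
move=> K0 z0 ps; have [r r0 h] := contin_near_theta K0 z0 ps.
exists (Num.min r (complex.Re s - p)); first by rewrite lt_min r0 subr_gt0.
move=> x x0; rewrite lt_min => /andP[xr xp]; rewrite /zfun h//.
have px : p < complex.Re (s + x) by have := Re_near s xp; rewrite subKr.
rewrite Mel_theta// mulrA rGamma_mul ?mul1r// => n; apply/eqP => e.
have p0 : 0 < p by apply: lt_le_trans p1.
by move: px; rewrite e cReN Re_natr ltNge ltW// (le_lt_trans _ p0)// oppr_le0.
Qed.

(** A cut-off K depending on s and large enough for s to lie in Re s > -K; with it the continuations
    to half-planes are patched into one function. *)
Let width s : R := `|complex.Re s| + 1.

Let width_gt0 s : 0 < width s. Proof. by rewrite ltr_wpDl. Qed.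

Let width_lt s : - width s < complex.Re s.
Proof. by rewrite ltrNl /width ltr_pwDr// -normrN ler_norm. Qed.

(* The continuations to Re s > -K agree up to their values at the singularities, which Pf
   normalizes. *)
Lemma zeta_exists z : 0 < complex.Re z -> exists F : C -> C, meromorphic F /\
  forall s, p < complex.Re s -> F s = zs z s.
Proof.
move=> z0; pose F s := Pf (zfun (width s) z) s.
have FE K s : 0 < K -> - K < complex.Re s -> F s = Pf (zfun K z) s.
  by move=> K0 sK; apply: Pf_congr (mero_zfun _ _ _) (zfun_near _ _ _ _ _).
have Fn K s : 0 < K -> - K < complex.Re s -> near_eq F (zfun K z) s.
  move=> K0 sK; apply: near_eq_trans (near_eq_Pf (mero_zfun K0 z0 sK)).
  exists (complex.Re s + K); first by rewrite -ltrBlDr sub0r.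
  by move=> h _ hr; apply: FE => //; have := Re_near s hr; rewrite opprD addrA subrr sub0r.
have mF s : mero F s.
  apply: mero_eq (near_eq_sym (Fn _ _ (width_gt0 s) (width_lt s))) _.
  exact: mero_zfun.
exists F; split.
  rewrite (_ : F = Pf F); first exact: meromorphic_Pf.
  apply/funext => s; apply/esym/Pf_congr; first exact: mF.
  exact: Fn.
move=> s ps; have p0 : 0 < p by apply: lt_le_trans p1.
have aM : analytic (fun s => rGamma s * Mel (theta z) s) s.
  by apply: analyticM; [exact: analytic_rGamma|exact: analytic_Mel (mel_theta z0) ps].
rewrite /F (Pf_near_eq aM).
  rewrite Mel_theta// mulrA rGamma_mul ?mul1r// => n; apply/eqP => e.
  by move: ps; rewrite e cReN Re_natr ltNge ltW// (le_lt_trans _ p0)// oppr_le0.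
have [r r0 h] := contin_near_theta (width_gt0 s) z0 ps.
by exists r => // x x0 xr; rewrite /zfun h.
Qed.

Lemma zeta_near K z G s : 0 < K -> 0 < complex.Re z -> - K < complex.Re s -> meromorphic G ->
  (forall s, p < complex.Re s -> G s = zs z s) -> near_eq G (zfun K z) s.
Proof.
move=> K0 z0 sK mG Gz; have p0 : 0 < p by apply: lt_le_trans p1.
apply: (@identity_half_plane _ _ (- K) (p + 1)%:C) => //.
- by move=> v vK; split; [exact: meromorphic_mero|exact: mero_zfun].
- by rewrite Re_real; lra.
- apply: near_eq_trans (near_eq_sym (zfun_near_zs K0 z0 _)).
    by apply: near_half_plane Gz _; rewrite Re_real ltrDl.
  by rewrite Re_real ltrDl.
Qed.

(** The case n = 0 is included: the residue is 1 and the harmonic sum is empty, which leaves - A_00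
    log z. *)
Definition pole_coef z (n : nat) : C := - (AH (- n%:R) 0%N * Res (@Gamma R) (- n%:R) *
  (z ^+ n * clog z - (\sum_(1 <= j < n.+1) j%:R^-1) * z ^+ n)).

(** For -al in Z_+ the truncation of its real part is exact and recovers the integer. *)
Definition exp_coef z al : C := if `[< is_Zplus (- al) >]
  then pole_coef z (Num.truncn (complex.Re (- al)))
  else regular_coef al (kmax al) (AH al) z.

Lemma heat_terms_derive z (l : seq C) : 0 < complex.Re z -> exists2 f, analytic f 0 &
  near_eq (fun s => rGamma s * \sum_(al <- l) heat_term al (kmax al) (AH al) z s) f 0 /\
  derive1 f 0 = \sum_(al <- l) exp_coef z al.
Proof.
move=> z0; have zn : z != 0 by apply: contraTneq z0 => ->; rewrite ltxx.
elim: l => [|al l [f fa [[r r0 hf] df]]].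
  exists (fun=> 0); first exact: analytic_cst.
  split; first by exists 1 => // h _ _; rewrite big_nil mulr0.
  by rewrite derive1_cst_C big_nil.
have [g ga [[r' r'0 hg] dg]] : exists2 f, analytic f 0 &
    near_eq (fun s => rGamma s * heat_term al (kmax al) (AH al) z s) f 0 /\
  derive1 f 0 = exp_coef z al.
  rewrite /exp_coef; case: asboolP => [zal|]; last exact: heat_term_regular.
  have [n en] := zal.
  have eal : al = - n%:R by rewrite -en opprK.
  have A0 k : (0 < k)%N -> AH al k = 0 by exact: hlog.
  have [g ga [h1 h2]] := heat_term_pole (kmax al) zn eal A0.
  exists g => //; split => //.
  have tn : Num.truncn (complex.Re (- al)) = n by rewrite en Re_natr natrK.
  rewrite tn /pole_coef -eal; exact: h2.
exists (fun s => g s + f s); first exact: analyticD.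
split.
  exists (Num.min r r'); first by rewrite lt_min r0.
  move=> h h0; rewrite lt_min => /andP[hr hr'].
  by rewrite big_cons mulrDr hf// hg.
by rewrite (derive1D ga fa) df dg big_cons.
Qed.

(** The derivative at 0 of 1/Gamma times an analytic function is the value of that function, so the
    tail contributes its Mellin transform at 0. G is arbitrary because [zeta] is chosen among all
    continuations. *)
Lemma zeta_at0 K z G : 0 < K -> 0 < complex.Re z -> meromorphic G ->
  (forall s, p < complex.Re s -> G s = zs z s) -> regular_at G 0 /\
  derive1 G 0 = \sum_(al <- expos K) exp_coef z al + Mel (fun t => tail K t * ez z t) 0.
Proof.
move=> K0 z0 mG Gz; have [f fa [[r r0 hf] df]] := heat_terms_derive (expos K) z0.
have K0' : - K < complex.Re (0 : C) by rewrite oppr_lt0.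
have aM := analytic_Mel (mel_tail K0 z0) K0'.
have aN := analyticM (analytic_rGamma 0) aM.
have nG : near_eq G (fun s => f s + rGamma s * Mel (fun t => tail K t * ez z t) s) 0.
  apply: near_eq_trans (zeta_near K0 z0 K0' mG Gz) _; exists r => // h h0 hr.
  by rewrite -hf// /zfun /contin mulrDr.
have [rG [r' r'0 hG]] := meromorphic_analytic mG (analyticD fa aN) nG.
split => //; rewrite -(@derive1_eq _ _ G 0 r' r'0 (fun h hr => esym (hG h hr)) (analyticD fa aN)).
rewrite (derive1D fa aN) df (derive1M (analytic_rGamma 0) aM).
by rewrite rGamma0 mul0r addr0 derive1_rGamma0 mul1r.
Qed.

Lemma Mel_tail_bound K : 0 < K -> exists B : R, forall z, 2%:R <= complex.Re z ->
  cmod (Mel (fun t => tail K t * ez z t) 0) <= B * expR (- K * ln (complex.Re z)).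
Proof.
move=> K0; have [B [B0 hB]] := tail_bound K0 ltr01.
exists (2%:R * (B * (gint K 1 * expR (K * ln 2%:R)))) => z z2.
have x0 : 0 < complex.Re z by apply: lt_le_trans z2; exact: ltr0Sn _ 1.
have x1 : 0 < complex.Re z - 1 by rewrite subr_gt0 (lt_le_trans _ z2)// ltr1n.
have bound t : 0 < t -> cmod (tail K t * ez z t * mexp (0 - 1) t) <=
    B * expR ((K - 1) * ln t - (complex.Re z - 1) * t).
  move=> t0; rewrite 2!cmodM cmod_mexp cmod_ez sub0r cReN.
  rewrite (le_trans (ler_wpM2r (expR_ge0 _) (ler_wpM2r (expR_ge0 _) (hB _ t0))))//.
  rewrite -!mulrA ler_wpM2l// -!expRD ler_expR le_eqVlt; apply/orP; left; apply/eqP.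
  by rewrite -[complex.Re 1]/(1 : R); ring.
have ib := rintZ B (rint_gamma K0 x1).
have cm : cmeas (fun t => tail K t * ez z t * mexp (0 - 1) t).
  by apply: cmeasM (cmeas_mexp _); apply: cmeasM; [exact: cmeas_tail|exact: cmeas_ez].
apply: le_trans (cmod_cint cm bound ib) _.
rewrite -mulrA ler_wpM2l// -mulrA rIZ ?rint_gamma// ler_wpM2l// -[rI _]/(gint K (complex.Re z - 1)) gint_pow//.
rewrite -[leRHS]mulrA ler_wpM2l ?gint_ge0// -expRD ler_expR !mulNr lerNl opprD opprK.
have : ln (complex.Re z) <= ln (2%:R * (complex.Re z - 1)).
  rewrite ler_ln ?posrE ?mulr_gt0//; lra.
by rewrite lnM ?posrE// => h; nra.
Qed.

End HeatMellin.

(** * Assembling the expansion of log det *)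

Section Asymptotics.
Variable R : realType.
Local Notation C := R[i].

Variables (p : R) (th : R -> R) (calA : set C) (kmax : C -> nat) (AH : C -> nat -> C).
Hypothesis hA : admissible_exponents calA.
Hypothesis hAH0 : forall al k, ~ (calA al /\ (k <= kmax al)%N) -> AH al k = 0.
Hypothesis hlog : forall al k, is_Zplus (- al) -> (0 < k)%N -> AH al k = 0.
Hypothesis hheat : heat_expansion (fun t => (th t)%:C) calA kmax AH.

Lemma at_right0P (P : R -> Prop) : (\forall t \near 0^'+, P t) ->
  exists t0, 0 < t0 /\ forall t, 0 < t -> t < t0 -> P t.
Proof.
move=> [e /= e0 he]; exists e; split => // t t0 te; apply: he => //.
by rewrite /ball/= sub0r normrN gtr0_norm.
Qed.

Lemma cpow_real (t : R) al : 0 < t -> cpow t%:C al = mexp al t.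
Proof. by move=> t0; rewrite /cpow clog_real. Qed.

Lemma powR_expR (t K : R) : 0 < t -> t `^ K = expR (K * ln t).
Proof. by move=> t0; rewrite /powR gt_eqF. Qed.

Lemma heat_tail (K : R) : 0 < K -> exists M t0 : R, 0 < t0 /\
  forall t, 0 < t -> t < t0 -> cmod (tail th calA kmax AH K t) <= M * expR (K * ln t).
Proof.
move=> K0; have [M /at_right0P[t0 [t00 h]]] := hheat K0; exists M, t0; split => // t tp tt.
have := h _ tp tt; rewrite normr_cmod lecR powR_expR//; apply: le_trans.
rewrite le_eqVlt; apply/orP; left; apply/eqP; congr (cmod (_ - _)).
rewrite -expos_sum//; apply: eq_fsbigr => al _; apply: eq_bigr => k _.
by rewrite cpow_real.
Qed.

Definition expansion_sum (K : R) (z : C) : C :=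
  - (\sum_(al \in [set al | [/\ calA al, ~ is_Zplus (- al) & complex.Re al <= K]])
       \sum_(k < (kmax al).+1)
         (-1) ^+ k *
         (\sum_(k <= j < (kmax al).+1)
            AH al j * 'C(j, k)%:R * Pf (derive1n (j - k) (@Gamma R)) al)
         * cpow z (- al) * clog z ^+ k)
  + AH 0 0%N * clog z
  + \sum_(n \in [set n : nat | (0 < n)%N])
      AH (- n%:R) 0%N * Res (@Gamma R) (- n%:R) *
      (z ^+ n * clog z - (\sum_(1 <= j < n.+1) j%:R^-1) * z ^+ n).

(** The exponents with Re <= K split into those outside -Z_+, zero, and the negative integers. As K
    > 0, the last two kinds are never cut off, and those missing from [calA] have coefficient 0 by
    [hAH0]. *)
Lemma expansion_sumE (K : R) z : 0 < K ->
  expansion_sum K z = - \sum_(al <- expos calA K) exp_coef kmax AH z al.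
Proof.
move=> K0; have fK := finite_expo hA K.
pose Z := [set al : C | is_Zplus (- al)].
have exp_pole n : exp_coef kmax AH z (- n%:R) = pole_coef AH z n.
  rewrite /exp_coef opprK Re_natr natrK; case: asboolP => // h.
  by exfalso; apply: h; exists n.
have eN : \sum_(al \in expo calA K `&` ~` Z) exp_coef kmax AH z al =
    \sum_(al \in [set al | [/\ calA al, ~ is_Zplus (- al) & complex.Re al <= K]])
      regular_coef al (kmax al) (AH al) z.
  rewrite (_ : [set al | _] = expo calA K `&` ~` Z); last first.
    apply/seteqP; split => al /=; first by case.
    by case=> -[].
  by apply: eq_fsbigr => al /[!inE] -[_ nz]; rewrite /exp_coef; case: asboolP => // /nz.
have e0 : \sum_(al \in expo calA K `&` Z `&` [set 0]) exp_coef kmax AH z al =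
    - (AH 0 0%N * clog z).
  transitivity (pole_coef AH z 0).
    rewrite (fsbig_widen _ [set 0]).
    - by rewrite fsbig_set1 -exp_pole oppr0.
    - by move=> x [].
    - move=> x [/= -> nx]; rewrite -[X in exp_coef _ _ _ X]oppr0 (exp_pole 0%N) /pole_coef oppr0.
      rewrite hAH0 ?mul0r ?oppr0// => -[c0 _]; apply: nx; split => //.
      by split; [split => //; exact: ltW|exists 0%N; rewrite oppr0].
  rewrite /pole_coef Res_Gamma oppr0 expr0 !mul1r big_geq// mul0r subr0.
  by rewrite fact0 invr1 mulr1.
have eP : \sum_(al \in expo calA K `&` Z `&` ~` [set 0]) exp_coef kmax AH z al =
    - \sum_(n \in [set n : nat | (0 < n)%N])
      AH (- n%:R) 0%N * Res (@Gamma R) (- n%:R) *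
      (z ^+ n * clog z - (\sum_(1 <= j < n.+1) j%:R^-1) * z ^+ n).
  rewrite (@reindex_fsbig _ _ _ _ _ (fun n : nat => - n%:R : C) [set n | (0 < n)%N /\ calA (- n%:R)]).
    rewrite -[RHS]mulN1r mulr_fsumr (fsbig_widen _ [set n : nat | (0 < n)%N]).
    - by apply: eq_fsbigr => n _; rewrite exp_pole /pole_coef mulN1r.
    - by move=> n [].
    - move=> n [/= n0 /not_andP[//|nc]]; rewrite exp_pole /pole_coef hAH0 ?mul0r ?oppr0//.
      by move=> -[] /nc.
  split.
  - move=> n [n0 cn]; split; last by apply/eqP; rewrite oppr_eq0 pnatr_eq0 -lt0n.
    split; last by exists n; rewrite opprK.
    by split => //; rewrite cReN Re_natr (le_trans _ (ltW K0))// oppr_le0.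
  - by move=> m n _ _ /oppr_inj/eqP; rewrite eqr_nat => /eqP.
  - move=> al [[[cal _] [n en]] al0]; exists n; last by rewrite -en opprK.
    split; last by rewrite -en opprK.
    rewrite lt0n; apply/eqP => n0; apply: al0; move: en; rewrite n0 => /eqP.
    by rewrite oppr_eq0 => /eqP.
rewrite -expos_sum// (fsbigID Z)// (fsbigID [set 0] (_ `&` Z)); last exact: finite_setIl.
rewrite /= eN e0 eP /expansion_sum.
move: (\sum_(al \in _) _) (\sum_(n \in _) _) => a b; ring.
Qed.

Variables (lam w : nat -> R) (S : R) (zs : C -> C -> C).
Hypothesis lam0 : forall i, 0 <= lam i.
Hypothesis w0 : forall i, 0 <= w i.
Hypothesis wS : forall N, \sum_(i < N) w i * expR (- p * ln (1 + lam i)) <= S.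
Hypothesis p1 : 1 <= p.
Hypothesis th_sum : forall t, 0 < t ->
  (fun N => \sum_(i < N) w i * expR (- (t * lam i))) @ \oo --> th t.
Hypothesis zs_sum : forall z s, 0 < complex.Re z -> p < complex.Re s ->
  ccvg (fun N => \sum_(i < N) (w i)%:C * cpow ((lam i)%:C + z) (- s)) (zs z s).

Definition continues (z : C) (G : C -> C) :=
  meromorphic G /\ forall s, p < complex.Re s -> G s = zs z s.

Lemma continuation_exists z : 0 < complex.Re z -> exists G, continues z G.
Proof. exact: (zeta_exists lam0 w0 wS p1 th_sum zs_sum heat_tail). Qed.

Lemma continuation_regular z G : 0 < complex.Re z -> continues z G -> regular_at G 0.
Proof.
move=> z0 [mG Gz].
by have [] := zeta_at0 lam0 w0 wS p1 th_sum zs_sum hlog heat_tail ltr01 z0 mG Gz.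
Qed.

Lemma continuation_asymptotics (K : R) : 0 < K -> exists M : R, forall z G,
  2%:R <= complex.Re z -> continues z G ->
  `| - derive1 G 0 - expansion_sum K z | <= (M * complex.Re z `^ (- K))%:C.
Proof.
move=> K0; have [B hB] := Mel_tail_bound lam0 w0 th_sum heat_tail K0.
exists B => z G z2 [mG Gz].
have z0 : 0 < complex.Re z by apply: lt_le_trans z2; exact: ltr0Sn _ 1.
have [_ dG] := zeta_at0 lam0 w0 wS p1 th_sum zs_sum hlog heat_tail K0 z0 mG Gz.
rewrite dG expansion_sumE// opprD opprK addrAC addNr add0r normr_cmod cmodN lecR powR_expR//.
exact: hB.
Qed.

End Asymptotics.

(** * Hilbert spaces and compact operators *)

Section InnerProductSpace.
Variables (R : realType) (H : completeNormedModType R[i]) (ip : inner_product H).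
Local Notation C := R[i].
Implicit Types (u v w x y : H) (a c : C) (e : R).

(** The library norm is [R[i]]-valued; this is its value as a real number. *)
Definition nrm u : R := complex.Re `|u|.

Lemma normE u : `|u| = (nrm u)%:C.
Proof.
by have := normr_ge0 u; rewrite /nrm le_eqVlt => /orP[/eqP <-//|/gt0_complex[]].
Qed.

Lemma nrm_ge0 u : 0 <= nrm u.
Proof. by rewrite -lecR -normE normr_ge0. Qed.

Lemma nrm_eq0 u : nrm u = 0 -> u = 0.
Proof. by move=> h; apply/eqP; rewrite -normr_eq0 normE h. Qed.

Lemma nrm0 : nrm 0 = 0.
Proof. by rewrite /nrm normr0. Qed.

Lemma nrmD u v : nrm (u + v) <= nrm u + nrm v.
Proof. by have := ler_normD u v; rewrite !normE -rmorphD/= lecR. Qed.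

Lemma nrmN u : nrm (- u) = nrm u.
Proof. by rewrite /nrm normrN. Qed.

Lemma nrmB u v : nrm (u - v) = nrm (v - u).
Proof. by rewrite -nrmN opprB. Qed.

Lemma nrmZ a u : nrm (a *: u) = cmod a * nrm u.
Proof. by apply: (@complexI R); rewrite -normE normrZ normr_cmod normE rmorphM. Qed.

Lemma nrm_tri u v w : nrm (u - w) <= nrm (u - v) + nrm (v - w).
Proof. by rewrite (le_trans _ (nrmD _ _))// addrA subrK. Qed.

Lemma cmod_conj a : cmod (Num.conj a) = cmod a.
Proof. by apply: (@complexI R); rewrite -!normr_cmod norm_conjC. Qed.

Lemma mul_conj a : a * Num.conj a = (cmod a ^+ 2)%:C.
Proof. by rewrite -normCK normr_cmod rmorphXn. Qed.

Lemma conj_real e : Num.conj e%:C = e%:C.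
Proof.
apply: CrealP; rewrite realE; have [h|h] := leP 0 e; apply/orP; [left|right].
  by rewrite lecR.
by rewrite lecR ltW.
Qed.

Lemma ipDl u v w : ip (u + v) w = ip u w + ip v w.
Proof. by have := inner_linear ip 1 u v w; rewrite scale1r mul1r. Qed.

Lemma ip0l w : ip 0 w = 0.
Proof. by apply: (addrI (ip 0 w)); rewrite -ipDl !addr0. Qed.

Lemma ipZl a u w : ip (a *: u) w = a * ip u w.
Proof. by have := inner_linear ip a u 0 w; rewrite addr0 ip0l addr0. Qed.

Lemma ipNl u w : ip (- u) w = - ip u w.
Proof. by rewrite -scaleN1r ipZl mulN1r. Qed.

Lemma ipBl u v w : ip (u - v) w = ip u w - ip v w.
Proof. by rewrite ipDl ipNl. Qed.

Lemma ipDr u v w : ip w (u + v) = ip w u + ip w v.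
Proof. by rewrite (inner_conj ip _ w) ipDl rmorphD/= -!inner_conj. Qed.

Lemma ipZr a u w : ip w (a *: u) = Num.conj a * ip w u.
Proof. by rewrite (inner_conj ip _ w) ipZl rmorphM/= -inner_conj. Qed.

Lemma ipNr u w : ip w (- u) = - ip w u.
Proof. by rewrite (inner_conj ip _ w) ipNl rmorphN/= -inner_conj. Qed.

Lemma ipBr u v w : ip w (u - v) = ip w u - ip w v.
Proof. by rewrite ipDr ipNr. Qed.

Lemma ip0r w : ip w 0 = 0.
Proof. by rewrite (inner_conj ip _ w) ip0l rmorph0. Qed.

Lemma ip_suml (I : Type) (r : seq I) (P : pred I) (F : I -> H) w :
  ip (\sum_(i <- r | P i) F i) w = \sum_(i <- r | P i) ip (F i) w.
Proof. by apply: (big_morph (ip^~ w)) => [u v|]; [exact: ipDl|exact: ip0l]. Qed.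

Lemma ip_sumr (I : Type) (r : seq I) (P : pred I) (F : I -> H) w :
  ip w (\sum_(i <- r | P i) F i) = \sum_(i <- r | P i) ip w (F i).
Proof. by apply: (big_morph (ip w)) => [u v|]; [exact: ipDr|exact: ip0r]. Qed.

Lemma ip_nrm u : ip u u = (nrm u ^+ 2)%:C.
Proof. by rewrite inner_norm normE rmorphXn. Qed.

Lemma ip_eq0 u : ip u u = 0 -> u = 0.
Proof.
rewrite ip_nrm => h; apply: nrm_eq0; apply/eqP; rewrite -sqrf_eq0.
by apply/eqP; apply: (@complexI R).
Qed.

Lemma ip_ext u v : (forall w, ip u w = ip v w) -> u = v.
Proof. by move=> h; apply/eqP; rewrite -subr_eq0; apply/eqP/ip_eq0; rewrite ipBl h subrr. Qed.

(* Positivity of q(u - t c v, u - t c v) for all real t, with c = q(u, v). *)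
Lemma positive_cauchy_schwarz (q : H -> H -> C) :
  (forall a u v w, q (a *: u + v) w = a * q u w + q v w) ->
  (forall u v, q v u = Num.conj (q u v)) -> (forall u, 0 <= q u u) ->
  forall u v, cmod (q u v) ^+ 2 <= complex.Re (q u u) * complex.Re (q v v).
Proof.
move=> ql qc q0 u v.
have qr w : q w w = (complex.Re (q w w))%:C.
  by have := q0 w; rewrite le_eqVlt => /orP[/eqP <-//|/gt0_complex[]].
have qr0 w : 0 <= complex.Re (q w w) by rewrite -lecR -qr.
set a := complex.Re (q u u); set b := complex.Re (q v v); set m := cmod (q u v) ^+ 2.
have m0 : 0 <= m by rewrite exprn_ge0 ?cmod_ge0.
have mc : q u v * q v u = m%:C by rewrite (qc u v) mul_conj.
clearbody m; have pos (t : R) : 0 <= a - 2%:R * t * m + t ^+ 2 * m * b.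
  have e : q (- (t%:C * q u v) *: v + u) (- (t%:C * q u v) *: v + u) =
      (a - 2%:R * t * m + t ^+ 2 * m * b)%:C.
    rewrite ql (qc (_ + u) u) (qc (_ + u) v) !ql !(rmorphD, rmorphM, rmorphN)/=.
    rewrite -!(qc _ _) (qr u) (qr v) -/a -/b conj_real -mc.
    by move: (q u v) (q v u) (a%:C) (b%:C) (t%:C) => c c' a' b' t'; ring.
  by rewrite -lecR -e.
have a0 : 0 <= a by exact: qr0.
(* If b = 0, a positive m would make the affine function a - 2 t m negative at t = (a + 1) / m;
   otherwise t = 1 / b minimizes the quadratic. *)
have b0 : 0 <= b by exact: qr0.
have [bz|bn] := eqVneq b 0.
  rewrite bz mulr0; rewrite leNgt; apply/negP => mp.
  have := pos ((a + 1) / m); rewrite bz mulr0 addr0 -mulrA divfK ?gt_eqF// => h.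
  lra.
have bp : 0 < b by rewrite lt_neqAle eq_sym bn.
have := pos (b^-1); rewrite (_ : _ + _ = a - m / b); last by field.
by rewrite subr_ge0 ler_pdivrMr.
Qed.

Lemma cauchy_schwarz u v : cmod (ip u v) <= nrm u * nrm v.
Proof.
have := @positive_cauchy_schwarz ip (inner_linear ip) (inner_conj ip) _ u v.
rewrite !ip_nrm !Re_real -exprMn ler_pXn2r ?nnegrE ?cmod_ge0 ?mulr_ge0 ?nrm_ge0//.
by apply=> w; rewrite ip_nrm lecR exprn_ge0 ?nrm_ge0.
Qed.

Definition hcvg (x_ : nat -> H) x := forall e, 0 < e ->
  exists N : nat, forall n, (N <= n)%N -> nrm (x_ n - x) < e.

Lemma ball_nrm u e v : ball u e%:C v <-> nrm (u - v) < e.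
Proof. by rewrite -ball_normE /ball_/= normE ltcR. Qed.

Lemma hcvg_cvg (x_ : nat -> H) x : hcvg x_ x -> x_ @ \oo --> x.
Proof.
move=> xx; apply/cvg_ballP => e /gt0_complex[-> e0].
have [N hN] := xx _ e0; exists N => // n Nn.
by apply/ball_nrm; rewrite nrmB; exact: hN.
Qed.

Lemma cauchy_hcvg (x_ : nat -> H) : (forall e, 0 < e -> exists N : nat, forall n m,
  (N <= n)%N -> (N <= m)%N -> nrm (x_ n - x_ m) < e) -> exists x, hcvg x_ x.
Proof.
move=> cx; have : cauchy (x_ @ \oo).
  apply: cauchy_exP => e /gt0_complex[-> e0]; have [N hN] := cx _ e0.
  exists (x_ N), N => // n Nn /=; apply/ball_nrm; exact: hN.
move=> /cauchy_cvgP/cvg_ballP h; exists (lim (x_ @ \oo)) => e e0.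
have := h e%:C; rewrite ltcR => /(_ e0)[N _ hN]; exists N => n Nn.
by rewrite nrmB; apply/ball_nrm; exact: hN.
Qed.

End InnerProductSpace.

Section UnorderedSums.
Variables (R : realType) (T : choiceType).
Implicit Types (J K : {fset T}) (A : set T) (f : T -> R).

Lemma sum_subfset (V : nmodType) (F : T -> V) J K : {subset K <= J} ->
  \sum_(b <- J | b \in K) F b = \sum_(b <- K) F b.
Proof.
move=> KJ; rewrite -big_filter; apply: perm_big; apply: uniq_perm.
- by rewrite filter_uniq// fset_uniq.
- exact: fset_uniq.
by move=> b; rewrite mem_filter; apply/andP/idP => [[]//|bK]; split => //; exact: KJ.
Qed.

Lemma ler_sum_fset f (g : T -> R) J : (forall b, b \in J -> f b <= g b) ->
  \sum_(b <- J) f b <= \sum_(b <- J) g b.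
Proof. by move=> fg; rewrite big_seq [leRHS]big_seq; apply: ler_sum. Qed.

Lemma le_esum_fset A f J : [set` J] `<=` A ->
  ((\sum_(b <- J) f b)%:E <= \esum_(b in A) (f b)%:E)%E.
Proof.
move=> JA; apply: esum_ge; exists [set` J]; first by split => //; exact: finite_fset.
by rewrite fsbig_finite ?set_fsetK//= sumEFin.
Qed.

Lemma esum_fset_le A f (s : R) : (forall J, [set` J] `<=` A -> \sum_(b <- J) f b <= s) ->
  (\esum_(b in A) (f b)%:E <= s%:E)%E.
Proof.
move=> h; apply: ge_ereal_sup => _ [X [fX XA] <-].
by rewrite fsbig_finite//= sumEFin lee_fin; apply: h; rewrite fset_setK.
Qed.

Lemma esum_fset_approx A f (s : R) : \esum_(b in A) (f b)%:E = s%:E ->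
  forall e : R, 0 < e -> exists J, [set` J] `<=` A /\ s - e < \sum_(b <- J) f b.
Proof.
move=> As e e0; have h : ereal_sup [set \sum_(b \in X) (f b)%:E | X in fsets A]%E \is a fin_num.
  by rewrite -[ereal_sup _]/(\esum_(b in A) (f b)%:E)%E As.
have [_ [X [fX XA] <-]] := ub_ereal_sup_adherent e0 h.
rewrite -[ereal_sup _]/(\esum_(b in A) (f b)%:E)%E As fsbig_finite//= sumEFin => hX.
by exists (fset_set X); rewrite fset_setK.
Qed.

Lemma esum_fset_eq A f (s : R) : (forall J, [set` J] `<=` A -> \sum_(b <- J) f b <= s) ->
  (forall e : R, 0 < e -> exists J, [set` J] `<=` A /\ s - e < \sum_(b <- J) f b) ->
  \esum_(b in A) (f b)%:E = s%:E.
Proof.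
move=> h1 h2; apply/eqP; rewrite eq_le esum_fset_le//=.
apply/lee_addgt0Pr => e e0; have [J [JA hJ]] := h2 _ e0.
apply: (@le_trans _ _ ((\sum_(b <- J) f b)%:E + e%:E)%E).
  by rewrite -EFinD lee_fin; lra.
by rewrite leeD2r//; exact: le_esum_fset.
Qed.

End UnorderedSums.

(** * Expansions in an orthonormal basis of any cardinality *)

Section OrthonormalBasis.
Variables (R : realType) (H : completeNormedModType R[i]) (ip : inner_product H).
Local Notation C := R[i].
Variable B : set H.
Hypothesis onb : orthonormal_basis ip B.
Implicit Types (u v w x y b : H) (c : H -> C) (J K : {fset H}) (e : R).

Definition comb J c : H := \sum_(b <- J) c b *: b.

Lemma ip_comb J c b : [set` J] `<=` B -> B b ->
  ip (comb J c) b = if b \in J then c b else 0.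
Proof.
move=> JB Bb; rewrite /comb ip_suml.
rewrite (eq_big_seq (fun b' => if b' == b then c b else 0)); last first.
  move=> b' /JB Bb'; rewrite ipZl (onb.1 _ _ Bb' Bb); case: eqP => [->|_]; first by rewrite mulr1.
  by rewrite mulr0.
case: ifPn => bJ; last first.
  by rewrite big1_seq// => b' /= b'J; case: eqP => // e; rewrite -e b'J in bJ.
rewrite (bigD1_seq b) ?fset_uniq//= eqxx big1 ?addr0// => b' /negPf ->.
by [].
Qed.

Lemma nrm_comb J c : [set` J] `<=` B -> nrm (comb J c) ^+ 2 = \sum_(b <- J) cmod (c b) ^+ 2.
Proof.
move=> JB; apply: (@complexI R); rewrite -(ip_nrm ip) {1}/comb ip_suml rmorph_sum/=.
apply: eq_big_seq => b bJ; rewrite ipZl (inner_conj ip (comb J c)) ip_comb//; last exact: JB.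
by rewrite bJ mul_conj.
Qed.

Lemma nrm_sub_comb J u : [set` J] `<=` B ->
  nrm (u - comb J (ip u)) ^+ 2 = nrm u ^+ 2 - \sum_(b <- J) cmod (ip u b) ^+ 2.
Proof.
move=> JB; apply: (@complexI R); rewrite -(ip_nrm ip) rmorphB/= -(ip_nrm ip u) rmorph_sum/=.
rewrite ipBl [ip (comb _ _) _](_ : _ = 0) ?subr0; last first.
  rewrite {1}/comb ip_suml big1_seq// => b /= bJ; rewrite ipZl (inner_conj ip _ b) ipBl.
  by rewrite ip_comb ?bJ ?subrr ?rmorph0 ?mulr0//; exact: JB.
rewrite ipBr /comb ip_sumr; congr (_ - _); apply: eq_bigr => b _.
by rewrite ipZr mulrC mul_conj.
Qed.

Lemma bessel J u : [set` J] `<=` B -> \sum_(b <- J) cmod (ip u b) ^+ 2 <= nrm u ^+ 2.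
Proof. by move=> JB; rewrite -subr_ge0 -nrm_sub_comb// exprn_ge0// nrm_ge0. Qed.

Lemma comb_sub J K c : [set` J] `<=` B -> {subset K <= J} ->
  nrm (comb J c - comb K c) ^+ 2 =
  \sum_(b <- J) cmod (c b) ^+ 2 - \sum_(b <- K) cmod (c b) ^+ 2.
Proof.
move=> JB KJ; pose c' b := if b \in K then 0 else c b.
rewrite -!(sum_subfset _ KJ) (_ : _ - _ = comb J c').
  rewrite nrm_comb// [X in _ = X - _](bigID (mem K))/= addrC addrK [RHS]big_mkcond/=.
  by apply: eq_bigr => b _; rewrite /c'; case: ifP => _ //=; rewrite cmod0 expr0n.
rewrite /comb -(sum_subfset _ KJ) (bigID (mem K))/= addrC addrK [LHS]big_mkcond/=.
by apply: eq_bigr => b _; rewrite /c'; case: (b \in K) => //=; rewrite scale0r.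
Qed.

(** No enumeration of B is at hand. Finite sets whose partial sums come within 1/(n+1)^2 of the
    supremum give a Cauchy sequence, since adding further vectors to the n-th one moves the
    combination by at most 1/(n+1). *)
Lemma riesz_fischer c (S : R) :
  (forall J, [set` J] `<=` B -> \sum_(b <- J) cmod (c b) ^+ 2 <= S) ->
  exists y, (forall b, B b -> ip y b = c b) /\
    forall e, 0 < e -> exists J, [set` J] `<=` B /\ nrm (y - comb J c) < e.
Proof.
move=> cS; pose A := [set s : R | exists2 J : {fset H}, [set` J] `<=` B & s = \sum_(b <- J) cmod (c b) ^+ 2].
have supA : has_sup A.
  split; first by exists 0, fset0; rewrite ?big_seq_fset0// => x; rewrite /= inE.
  by exists S => _ [J JB ->]; exact: cS.
pose eps (n : nat) : R := n.+1%:R^-1.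
have eps0 n : 0 < eps n by rewrite invr_gt0.
have /choice[J hJ] : forall n, exists J : {fset H}, [set` J] `<=` B /\
    sup A - eps n ^+ 2 < \sum_(b <- J) cmod (c b) ^+ 2.
  move=> n; have [_ [J JB ->] h] := sup_adherent (exprn_gt0 2 (eps0 n)) supA.
  by exists J.
have near K n : [set` K] `<=` B -> {subset J n <= K} -> nrm (comb K c - comb (J n) c) <= eps n.
  move=> KB JK; rewrite -(@ler_pXn2r _ 2)// ?nnegrE ?nrm_ge0 ?(ltW (eps0 _))// comb_sub//.
  have h1 := (hJ n).2; have h2 : \sum_(b <- K) cmod (c b) ^+ 2 <= sup A.
    by apply: ub_le_sup; [case: supA|exists K].
  by lra.
have small e : 0 < e -> exists N : nat, forall n, (N <= n)%N -> eps n < e.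
  move=> e0; have [N hN] := natr_ge_near e^-1; exists N => n /hN h.
  by rewrite /eps invf_plt ?posrE// (le_lt_trans h)// ltr_nat.
have [y hy] : exists y, hcvg (fun n => comb (J n) c) y.
  apply: cauchy_hcvg => e e0; have e2 : 0 < e / 2%:R by rewrite divr_gt0.
  have [N hN] := small _ e2; exists N => n m Nn Nm.
  have UB : [set` (J n `|` J m)%fset] `<=` B.
    by move=> x /=; rewrite inE => /orP[/((hJ n).1 x)|/((hJ m).1 x)].
  have h1 := near _ n UB (fun x xn => fsubsetP (fsubsetUl _ _) x xn).
  have h2 := near _ m UB (fun x xn => fsubsetP (fsubsetUr _ _) x xn).
  rewrite (le_lt_trans (nrm_tri _ (comb (J n `|` J m)%fset c) _))// nrmB.
  by have := hN _ Nn; have := hN _ Nm; lra.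
exists y; split; last first.
  move=> e /hy[N hN]; exists (J N); split; first exact: (hJ N).1.
  by rewrite nrmB; exact: hN.
move=> b Bb; apply/eqP; rewrite -subr_eq0 -cmod_eq0; apply/eqP/le_anti.
rewrite cmod_ge0 andbT; apply/ler_addgt0Pr => e e0; rewrite add0r.
have e2 : 0 < e / 2%:R by rewrite divr_gt0.
have [N hN] := small _ e2; have [M hM] := hy _ e2; pose n := maxn N M.
have UB : [set` (b |` J n)%fset] `<=` B.
  by move=> x /=; rewrite !inE => /orP[/eqP ->//|/((hJ n).1 x)].
have h1 := near _ n UB (fun x xn => fsubsetP (fsubsetU1 _ _) x xn).
have -> : c b = ip (comb (b |` J n)%fset c) b by rewrite ip_comb// fset1U1.
rewrite -ipBl (le_trans (cauchy_schwarz _ _ _))//.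
have -> : nrm b = 1.
  have := ip_nrm ip b; rewrite (onb.1 _ _ Bb Bb) eqxx => /(@complexI R 1)/esym/eqP.
  by rewrite -[X in _ == X](expr1n _ 2) eqrXn2 ?nrm_ge0// => /eqP.
rewrite mulr1 (le_trans (nrm_tri _ (comb (J n) c) _))//.
have h2 := hM n (leq_maxr _ _); have h3 := hN n (leq_maxl _ _).
by rewrite nrmB [X in _ + X]nrmB; lra.
Qed.

Lemma onb_ext u v : (forall b, B b -> ip u b = ip v b) -> u = v.
Proof.
move=> h; apply/eqP; rewrite -subr_eq0; apply/eqP; apply: onb.2 => b Bb.
by rewrite ipBl h// subrr.
Qed.

(** [riesz_fischer] produces a vector that has the coefficients of u and is approximated by finite
    combinations; totality of the basis identifies it with u. *)
Lemma comb_dense u e : 0 < e -> exists J, [set` J] `<=` B /\ nrm (u - comb J (ip u)) < e.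
Proof.
move=> e0; have [y [yb hy]] := riesz_fischer (fun J => @bessel J u).
by rewrite -{1}(onb_ext yb); exact: hy.
Qed.

Lemma multiplier (m : H -> C) (M : R) u : (forall b, B b -> cmod (m b) <= M) ->
  exists y, forall b, B b -> ip y b = m b * ip u b.
Proof.
move=> mM; have [J JB|y [hy _]] := @riesz_fischer (fun b => m b * ip u b) (M ^+ 2 * nrm u ^+ 2).
  rewrite (le_trans _ (ler_wpM2l (sqr_ge0 M) (bessel u JB)))// mulr_sumr.
  apply: ler_sum_fset => b /JB Bb; rewrite cmodM exprMn ler_wpM2r ?exprn_ge0 ?cmod_ge0//.
  have := mM _ Bb => h; rewrite ler_pXn2r ?nnegrE ?cmod_ge0//.
  exact: le_trans (cmod_ge0 _) h.
by exists y.
Qed.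

Lemma parseval u : \esum_(b in B) (cmod (ip u b) ^+ 2)%:E = (nrm u ^+ 2)%:E.
Proof.
apply: esum_fset_eq => [J|e e0]; first exact: bessel.
have se : 0 < Num.sqrt e by rewrite sqrtr_gt0.
have [J [JB hJ]] := comb_dense u se.
exists J; split => //; have := nrm_sub_comb u JB.
have : nrm (u - comb J (ip u)) ^+ 2 < e.
  by rewrite -[ltRHS]sqr_sqrtr ?(ltW e0)// ltr_pXn2r ?nnegrE ?nrm_ge0 ?sqrtr_ge0.
by lra.
Qed.

Lemma nrm_sqr_le u (S : R) : (forall J, [set` J] `<=` B -> \sum_(b <- J) cmod (ip u b) ^+ 2 <= S) ->
  nrm u ^+ 2 <= S.
Proof. by move=> /esum_fset_le; rewrite parseval lee_fin. Qed.

(** Replacing u by finite combinations in the second slot of <v, u> gives the partial sums, with an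
    error controlled by Cauchy-Schwarz. Reality and the value of the sum both follow. *)
Lemma diagonal_form u v (m : H -> R) : (forall b, B b -> 0 <= m b) ->
  (forall b, B b -> ip v b = (m b)%:C * ip u b) ->
  exists2 q : R, ip v u = q%:C & \esum_(b in B) (m b * cmod (ip u b) ^+ 2)%:E = q%:E.
Proof.
move=> m0 vb; have near J : [set` J] `<=` B ->
    cmod (ip v u - (\sum_(b <- J) m b * cmod (ip u b) ^+ 2)%:C) <= nrm v * nrm (u - comb J (ip u)).
  move=> JB; rewrite (_ : _ - _ = ip v (u - comb J (ip u))); first exact: cauchy_schwarz.
  rewrite ipBr /comb ip_sumr rmorph_sum/=; congr (_ - _); apply: eq_big_seq => b /JB Bb.
  rewrite ipZr (vb _ Bb) rmorphM/= -mul_conj.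
  by move: (ip u b) (Num.conj _) ((m b)%:C) => x y z; ring.
have close e : 0 < e -> exists J, [set` J] `<=` B /\
    cmod (ip v u - (\sum_(b <- J) m b * cmod (ip u b) ^+ 2)%:C) < e.
  move=> e0; have v1 : 0 < nrm v + 1 by rewrite ltr_wpDl ?nrm_ge0.
  have [J [JB hJ]] := @comb_dense u (e / (nrm v + 1)) (divr_gt0 e0 v1).
  exists J; split => //; apply: le_lt_trans (near _ JB) _.
  rewrite (@le_lt_trans _ _ ((nrm v + 1) * nrm (u - comb J (ip u))))//.
    by rewrite ler_wpM2r ?nrm_ge0// lerDl.
  by rewrite mulrC -ltr_pdivlMr.
have im0 : complex.Im (ip v u) = 0.
  apply/eqP; rewrite -normr_eq0; apply/eqP/le_anti; rewrite normr_ge0 andbT.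
  apply/ler_addgt0Pr => e /close[J [JB /ltW h]]; rewrite add0r; apply: le_trans h.
  by apply: le_trans (cmod_Im _); rewrite cImD cImN Im_real oppr0 addr0.
exists (complex.Re (ip v u)); first by apply: complexP; rewrite ?Re_real ?Im_real.
have re J : `|complex.Re (ip v u) - \sum_(b <- J) m b * cmod (ip u b) ^+ 2| <=
    cmod (ip v u - (\sum_(b <- J) m b * cmod (ip u b) ^+ 2)%:C).
  by apply: le_trans (cmod_Re _); rewrite cReD cReN Re_real.
apply: esum_fset_eq => [J JB|e /close[J [JB h]]]; last first.
  by exists J; split => //; have := le_lt_trans (re J) h; rewrite ltr_norml => /andP[]; lra.
apply/ler_addgt0Pr => e /close[K [KB h]].
have UB : [set` (J `|` K)%fset] `<=` B by move=> x /=; rewrite inE => /orP[/(JB x)|/(KB x)].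
have v1 : 0 < nrm v + 1 by rewrite ltr_wpDl ?nrm_ge0.
have mono J' K' : {subset J' <= K'} -> [set` K'] `<=` B ->
    \sum_(b <- J') m b * cmod (ip u b) ^+ 2 <= \sum_(b <- K') m b * cmod (ip u b) ^+ 2.
  move=> JK K'B; rewrite -(sum_subfset _ JK) big_mkcond/=; apply: ler_sum_fset => b /K'B Bb.
  by case: ifP => // _; rewrite mulr_ge0 ?m0// exprn_ge0 ?cmod_ge0.
apply: le_trans (mono _ (J `|` K)%fset _ UB) _; first by apply/fsubsetP/fsubsetUl.
have [L [LB hL]] : exists L, [set` L] `<=` B /\ nrm (u - comb L (ip u)) < e / (nrm v + 1).
  by apply: comb_dense; rewrite divr_gt0//; apply: le_lt_trans h; exact: cmod_ge0.
(* Enlarging by L brings the combination close to u, and the partial sum over J only grows since the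
   terms are nonnegative. *)
pose U := ((J `|` K) `|` L)%fset.
have UUB : [set` U] `<=` B by move=> x /=; rewrite inE => /orP[/(UB x)|/(LB x)].
apply: le_trans (mono _ U _ UUB) _; first by apply/fsubsetP/fsubsetUl.
have hU : nrm (u - comb U (ip u)) < e / (nrm v + 1).
  apply: le_lt_trans hL; rewrite -(@ler_pXn2r _ 2)// ?nnegrE ?nrm_ge0// !nrm_sub_comb// lerD2l lerN2.
  have LU : {subset L <= U} by apply/fsubsetP/fsubsetUr.
  rewrite -(sum_subfset _ LU) big_mkcond/=; apply: ler_sum => b _.
  by case: ifP => // _; rewrite exprn_ge0 ?cmod_ge0.
have hh : cmod (ip v u - (\sum_(b <- U) m b * cmod (ip u b) ^+ 2)%:C) <= e.
  apply: le_trans (near _ UUB) _.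
  rewrite (@le_trans _ _ ((nrm v + 1) * nrm (u - comb U (ip u))))//.
    by rewrite ler_wpM2r ?nrm_ge0// lerDl.
  by rewrite mulrC -ler_pdivlMr// ltW.
by have := le_trans (re U) hh; rewrite ler_norml => /andP[]; lra.
Qed.

End OrthonormalBasis.

(** * The spectral theorem for a compact positive injective operator *)

Section CompactOperator.
Variables (R : realType) (H : completeNormedModType R[i]) (ip : inner_product H).
Local Notation C := R[i].
Variable T : H -> H.
Hypothesis T_linear : forall (a : C) u v, T (a *: u + v) = a *: T u + T v.
Hypothesis T_symmetric : forall u v, ip (T u) v = ip u (T v).
(** For T = (L + I)^(-1) and v = T u this says <L v, v> >= 0. It makes T positive and a
    contraction. *)
Hypothesis T_coercive : forall u, (nrm (T u) ^+ 2)%:C <= ip (T u) u.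
Hypothesis T_injective : forall u, T u = 0 -> u = 0.
Hypothesis T_compact : precompact (T @` [set u | `|u| <= 1]).
Implicit Types (u v w x y b : H) (e r : R).

Lemma TD u v : T (u + v) = T u + T v.
Proof. by have := T_linear 1 u v; rewrite !scale1r. Qed.

Lemma T0 : T 0 = 0.
Proof. by apply: (addrI (T 0)); rewrite -TD !addr0. Qed.

Lemma TZ (a : C) u : T (a *: u) = a *: T u.
Proof. by have := T_linear a u 0; rewrite !addr0 T0 addr0. Qed.

Lemma TB u v : T (u - v) = T u - T v.
Proof. by rewrite TD -[- v]scaleN1r TZ scaleN1r. Qed.

Definition qf u : R := complex.Re (ip (T u) u).

Lemma ip_qf u : ip (T u) u = (qf u)%:C.
Proof.
have : 0 <= ip (T u) u by apply: le_trans (T_coercive u); rewrite lecR exprn_ge0 ?nrm_ge0.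
by rewrite /qf le_eqVlt => /orP[/eqP <-//|/gt0_complex[]].
Qed.

Lemma nrm_qf u : nrm (T u) ^+ 2 <= qf u.
Proof. by have := T_coercive u; rewrite ip_qf lecR. Qed.

Lemma qf_ge0 u : 0 <= qf u.
Proof. by apply: le_trans (nrm_qf u); rewrite exprn_ge0 ?nrm_ge0. Qed.

Lemma qf_le u : qf u <= nrm (T u) * nrm u.
Proof. by apply: le_trans (cauchy_schwarz ip _ _); rewrite ip_qf cmodR ler_norm. Qed.

Lemma nrmT u : nrm (T u) <= nrm u.
Proof.
have := le_trans (nrm_qf u) (qf_le u); have := nrm_ge0 (T u); have := nrm_ge0 u.
by rewrite le_eqVlt => /orP[/eqP <-|]; nra.
Qed.

Lemma qfZ r u : qf (r%:C *: u) = r ^+ 2 * qf u.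
Proof.
by rewrite /qf TZ ipZl ipZr conj_real ip_qf -!rmorphM/= mulrA expr2.
Qed.

Lemma Re_mull r (z : C) : complex.Re (r%:C * z) = r * complex.Re z.
Proof. by rewrite mulrC Re_mulR mulrC. Qed.

Lemma nrm_sub_sqr r u v : nrm (u - r%:C *: v) ^+ 2 =
  nrm u ^+ 2 - 2%:R * r * complex.Re (ip u v) + r ^+ 2 * nrm v ^+ 2.
Proof.
have e : ip (u - r%:C *: v) (u - r%:C *: v) = ip u u - r%:C * ip u v -
    r%:C * ip v u + r%:C * (r%:C * ip v v).
  by rewrite ipBl !ipBr !ipZl !ipZr conj_real; ring.
have h : complex.Re (ip v u) = complex.Re (ip u v).
  by rewrite (inner_conj ip u v) /Num.conj/=; case: (ip u v).
have := congr1 (@complex.Re R) e; rewrite !ip_nrm Re_real => ->.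
by rewrite !cReD !cReN !Re_mull h !Re_real; ring.
Qed.

(** A cluster point, approached beyond every N, stands in for the limit of a subsequence. *)
Lemma T_cluster (v_ : nat -> H) : (forall n, nrm (v_ n) <= 1) ->
  exists y, forall e, 0 < e -> forall N, exists n, (N <= n)%N /\ nrm (T (v_ n) - y) < e.
Proof.
move=> v1; have [U TU [cU _]] := T_compact.
have [|y [_ yc]] := cU ((T \o v_) @ \oo) _.
  exists 0%N => // n _ /=; apply: TU; exists (v_ n) => //=.
  by rewrite normE -[1]/((1 : R)%:C) lecR.
exists y => e e0 N.
have FN : ((T \o v_) @ \oo) [set T (v_ n) | n in [set n | (N <= n)%N]].
  by exists N => // n Nn; exists n.
have yN : nbhs y (ball y e%:C) by apply: nbhsx_ballx; rewrite ltcR.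
have [z [[n Nn <-] /ball_nrm]] := yc _ _ FN yN; by rewrite nrmB; exists n.
Qed.

Lemma normalize u : u <> 0 -> exists r, 0 < r /\ nrm (r%:C *: u) = 1.
Proof.
move=> u0; have n0 : 0 < nrm u.
  by rewrite lt_neqAle nrm_ge0 andbT eq_sym; apply/eqP => /nrm_eq0.
exists (nrm u)^-1; rewrite invr_gt0; split => //.
by rewrite nrmZ cmodR gtr0_norm ?invr_gt0// mulVf// gt_eqF.
Qed.

Lemma small_inv e : 0 < e -> exists N : nat, forall n, (N <= n)%N -> n.+1%:R^-1 < e.
Proof.
move=> e0; have [N hN] := natr_ge_near e^-1; exists N => n /hN h.
by rewrite invf_plt ?posrE// (le_lt_trans h)// ltr_nat.
Qed.

(* The eigenvalue is the maximum m of <T v, v> over the unit vectors v of V: since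
   ||T v||^2 <= m <T v, v> on V, a maximizing sequence satisfies T v_n - m v_n -> 0. *)
Lemma eigenvector_exists (B : set H) : (forall b, B b -> exists r, T b = r%:C *: b) ->
  (exists w, (forall b, B b -> ip w b = 0) /\ w <> 0) ->
  exists x r, [/\ forall b, B b -> ip x b = 0, nrm x = 1, 0 < r & T x = r%:C *: x].
Proof.
move=> TB' [w [wB w0]]; pose V v := forall b, B b -> ip v b = 0.
have VZ (a : C) v : V v -> V (a *: v) by move=> Vv b Bb; rewrite ipZl Vv// mulr0.
have VT v : V v -> V (T v).
  by move=> Vv b Bb; have [r e] := TB' _ Bb; rewrite T_symmetric e ipZr Vv// mulr0.
pose A := [set q : R | exists v, [/\ V v, nrm v = 1 & q = qf v]].
have [r0 [r00 nw]] := normalize w0; set w1 := r0%:C *: w in nw.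
have Vw1 : V w1 by exact: VZ.
have supA : has_sup A.
  split; first by exists (qf w1), w1.
  exists 1 => _ [v [_ v1 ->]]; apply: le_trans (qf_le v) _; rewrite v1 mulr1 -v1.
  exact: nrmT.
pose m := sup A.
have m_ub v : V v -> nrm v = 1 -> qf v <= m.
  by move=> Vv v1; apply: ub_le_sup; [case: supA|exists v].
have m0 : 0 < m.
  apply: lt_le_trans (m_ub _ Vw1 nw); apply: lt_le_trans (nrm_qf _).
  rewrite exprn_gt0// lt_neqAle nrm_ge0 andbT eq_sym; apply/eqP => /nrm_eq0/T_injective e.
  by move: nw; rewrite e nrm0 => /eqP; rewrite eq_sym oner_eq0.
have m_le v : V v -> qf v <= m * nrm v ^+ 2.
  move=> Vv; have [->|/eqP v0] := eqVneq v 0.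
    by rewrite /qf T0 ip0l nrm0 expr0n mulr0.
  have [r [rp rv]] := normalize v0.
  have := m_ub _ (VZ r%:C _ Vv) rv; rewrite qfZ => h.
  move: rv; rewrite nrmZ cmodR gtr0_norm// => rv.
  have rr : r ^+ 2 * nrm v ^+ 2 = 1 by rewrite -exprMn rv expr1n.
  rewrite -(ler_pM2l (exprn_gt0 2 rp)) (le_trans h)//.
  by rewrite mulrCA rr mulr1.
(* Cauchy-Schwarz for the form <T u, v> at v and T v: |T v|^4 <= q(v) q(T v) <= q(v) m |T v|^2. *)
have T_le v : V v -> nrm (T v) ^+ 2 <= m * qf v.
  move=> Vv; have := @positive_cauchy_schwarz _ _ (fun u v => ip (T u) v) _ _ _ v (T v).
  have -> : ip (T v) (T v) = (nrm (T v) ^+ 2)%:C by exact: ip_nrm.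
  rewrite -/(qf v) -/(qf (T v)) cmodR ger0_norm ?exprn_ge0 ?nrm_ge0// => h.
  have {}h : (nrm (T v) ^+ 2) ^+ 2 <= qf v * qf (T v).
    apply: h => [a x y z|x y|x]; first by rewrite T_linear ipDl ipZl.
      by rewrite T_symmetric (inner_conj ip).
    by rewrite ip_qf lecR qf_ge0.
  have h2 := le_trans h (ler_wpM2l (qf_ge0 v) (m_le _ (VT _ Vv))).
  have [z|p] := leP (nrm (T v) ^+ 2) 0.
    by apply: le_trans z _; rewrite mulr_ge0 ?qf_ge0 ?(ltW m0).
  by rewrite -(ler_pM2r p) -expr2; apply: le_trans h2 _; rewrite mulrCA mulrA.
have /choice[v_ hv] : forall n : nat, exists v, [/\ V v, nrm v = 1 & m - n.+1%:R^-1 < qf v].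
  move=> n; have n0 : 0 < n.+1%:R^-1 :> R by rewrite invr_gt0.
  by have [_ [v [Vv v1 ->]] h] := sup_adherent n0 supA; exists v.
pose d n := T (v_ n) - m%:C *: v_ n.
(* For unit v in V: |T v - m v|^2 = |T v|^2 - 2 m q(v) + m^2 <= m (m - q(v)). *)
have d_le n : nrm (d n) ^+ 2 <= m * n.+1%:R^-1.
  have [Vv v1 hq] := hv n; rewrite /d nrm_sub_sqr -/(qf _) v1 expr1n mulr1.
  suff gap (m' c a k : R) : 0 < m' -> c <= m' * a -> m' - k < a -> c - 2%:R * m' * a + m' ^+ 2 <= m' * k.
    by apply: gap => //; exact: T_le.
  by move=> {}m0 h1 h2; nra.
have d_small e : 0 < e -> exists N : nat, forall n, (N <= n)%N -> nrm (d n) < e.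
  move=> e0; have [N hN] := small_inv (divr_gt0 (exprn_gt0 2 e0) m0); exists N => n /hN h.
  rewrite -(@ltr_pXn2r _ 2)// ?nnegrE ?nrm_ge0 ?(ltW e0)//.
  by apply: le_lt_trans (d_le n) _; rewrite mulrC -ltr_pdivlMr.
have [|y yc] := @T_cluster v_; first by move=> n; have [_ -> _] := hv n.
have pick e : 0 < e -> exists n, nrm (d n) < e /\ nrm (T (v_ n) - y) < e.
  move=> e0; have [N hN] := d_small _ e0; have [n [Nn hn]] := yc _ e0 N.
  by exists n; split => //; exact: hN.
have yn : y <> 0.
  have m3 : 0 < m / 3%:R by rewrite divr_gt0.
  have [n [h1 h2]] := pick _ m3 => y0.
  have : nrm (m%:C *: v_ n) <= nrm (T (v_ n) - y) + nrm (d n).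
    rewrite y0 subr0 [_ *: _](_ : _ = T (v_ n) - d n); last by rewrite /d opprB addrC subrK.
    by apply: le_trans (nrmD _ _) _; rewrite nrmN.
  have [_ v1 _] := hv n; rewrite nrmZ v1 mulr1 cmodR gtr0_norm//; lra.
have Vy : V y.
  move=> b Bb; apply/eqP; rewrite -cmod_eq0; apply/eqP/le_anti; rewrite cmod_ge0 andbT.
  apply/ler_addgt0Pr => e e0; rewrite add0r.
  have b1 : 0 < nrm b + 1 by rewrite ltr_wpDl ?nrm_ge0.
  have [n [_ h]] := pick _ (divr_gt0 e0 b1); have [Vv _ _] := hv n.
  have -> : ip y b = ip (y - T (v_ n)) b by rewrite ipBl (VT _ Vv)// subr0.
  rewrite (le_trans (cauchy_schwarz _ _ _))// nrmB.
  rewrite (@le_trans _ _ (nrm (T (v_ n) - y) * (nrm b + 1)))//.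
    by rewrite ler_wpM2l ?nrm_ge0// lerDl.
  by rewrite -ler_pdivlMr// ltW.
have Ty : T y = m%:C *: y.
  apply/eqP; rewrite -subr_eq0; apply/eqP/nrm_eq0/le_anti; rewrite nrm_ge0 andbT.
  apply/ler_addgt0Pr => e e0; rewrite add0r.
  have m2 : 0 < 2%:R + m by rewrite addr_gt0.
  have [n [h1 h2]] := pick _ (divr_gt0 e0 m2).
  (* T y - m y is expressed by the defect d_n = T v_n - m v_n and the difference T v_n - y, both
     small for the chosen n. *)
  have -> : T y - m%:C *: y = T (d n) + (m%:C *: (T (v_ n) - y) - T (T (v_ n) - y)).
    by rewrite !TB TZ scalerBr addrA subrKA opprB addrC subrKA.
  rewrite (le_trans (nrmD _ _))// (le_trans (lerD (lexx _) (nrmD _ _)))// nrmN nrmZ cmodR gtr0_norm//.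
  have := nrmT (d n); have := nrmT (T (v_ n) - y).
  move: h1 h2; rewrite !ltr_pdivlMr//.
  have := nrm_ge0 (d n); have := nrm_ge0 (T (v_ n) - y); nra.
have [r [rp ry]] := normalize yn.
exists (r%:C *: y), m; split => //; first exact: VZ.
by rewrite TZ Ty !scalerA mulrC.
Qed.

(** Zorn's lemma for orthonormal sets of eigenvectors: a maximal one is total, since its orthogonal
    complement would otherwise contain a further unit eigenvector. *)
Lemma eigenbasis : exists B, orthonormal_basis ip B /\
  forall b, B b -> exists r, 0 < r /\ T b = r%:C *: b.
Proof.
pose P B := (forall u v, B u -> B v -> ip u v = (u == v)%:R) /\
  forall b, B b -> exists r, 0 < r /\ T b = r%:C *: b.
have [F FP tot|B [[B1 B2] Bmax]] := @Zorn_bigcup _ P.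
  split=> [u v [X FX Xu] [Y FY Yv]|b [X FX Xb]]; last exact: (FP _ FX).2.
  have [XY|YX] := tot _ _ FX FY; first by apply: (FP _ FY).1 => //; exact: XY.
  by apply: (FP _ FX).1 => //; exact: YX.
exists B; split => //; split => // w wB; apply: contrapT => w0.
have [|x [r [xB x1 r0 Tx]]] := @eigenvector_exists B _ (ex_intro _ w (conj wB w0)).
  by move=> b /B2[r [_ ->]]; exists r.
have ipx : ip x x = 1 by rewrite ip_nrm x1 expr1n.
apply: (Bmax (B `|` [set x])).
  split; first by move=> b Bb; left.
  by move=> h; have /xB := h x (or_intror erefl); rewrite ipx => /eqP; rewrite oner_eq0.
split=> [u v [Bu|->] [Bv|->]|b [/B2//|->]]; last by exists r.
- exact: B1.
- rewrite (inner_conj ip x) xB// rmorph0; case: eqP => // e.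
  by move: ipx; rewrite -{2}e xB// => /eqP; rewrite eq_sym oner_eq0.
- rewrite xB//; case: eqP => // e.
  by move: ipx; rewrite {2}e xB// => /eqP; rewrite eq_sym oner_eq0.
- by rewrite ipx eqxx.
Qed.

End CompactOperator.

Section NatSums.
Variable R : realType.
Implicit Types (x : nat -> R) (s e : R).

Lemma sum_ord_le_esum x s N : \esum_(i in [set: nat]) (x i)%:E = s%:E -> \sum_(i < N) x i <= s.
Proof.
move=> h; rewrite -lee_fin -h; apply: esum_ge; exists `I_N; first by split => //; exact: finite_II.
by rewrite -fsbig_ord sumEFin.
Qed.

Lemma esum_cvg x s : (forall i, 0 <= x i) -> \esum_(i in [set: nat]) (x i)%:E = s%:E ->
  (fun N => \sum_(i < N) x i) @ \oo --> s.
Proof.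
move=> x0 h; apply/cvgrPdist_lt => e /(esum_fset_approx h)[J [_ hJ]].
exists (\max_(i <- J) i).+1 => // N JN; rewrite ger0_norm ?subr_ge0 ?sum_ord_le_esum//.
rewrite ltrBlDr -ltrBlDl (lt_le_trans hJ)//.
have := @lee_sum_fset_nat R (EFin \o x) J N predT.
rewrite !sumEFin lee_fin big_mkord; apply.
  by move=> i _; rewrite lee_fin.
by move=> i /= iJ; apply: leq_ltn_trans JN; exact: leq_bigmax_seq.
Qed.

End NatSums.

Section Dimension.
Variables (R : realType) (H : completeNormedModType R[i]).
Local Notation C := R[i].

(** [vdim] is a choice, so the length of a basis has to be shown unique: the matrices expressing two
    bases in each other have product 1, and the rank compares their sizes. *)
Lemma vdim_eq (V : set H) n (b : 'I_n -> H) :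
  (forall c : 'I_n -> C, \sum_i c i *: b i = 0 -> forall i, c i = 0) ->
  V = [set \sum_i c i *: b i | c in [set: 'I_n -> C]] -> vdim V = n.
Proof.
move=> ib Vb; have unique m m' (x : 'I_m -> H) (y : 'I_m' -> H) :
    (forall c : 'I_m -> C, \sum_i c i *: x i = 0 -> forall i, c i = 0) ->
    [set \sum_i c i *: x i | c in [set: 'I_m -> C]] `<=`
    [set \sum_i c i *: y i | c in [set: 'I_m' -> C]] ->
    (forall j, exists c, y j = \sum_i c i *: x i) -> (m <= m')%N.
  move=> ix xy /choice[f hf].
  have /choice[g hg] i : exists c : 'I_m' -> C, x i = \sum_j c j *: y j.
    have [|c _ e] := xy (x i); last by exists c.
    exists (fun j => (j == i)%:R) => //; rewrite (bigD1 i)//= eqxx scale1r big1 ?addr0//.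
    by move=> j /negPf ->; rewrite scale0r.
  pose A : 'M[C]_(m, m') := \matrix_(i, j) g i j.
  pose B : 'M[C]_(m', m) := \matrix_(j, i) f j i.
  have AB : A *m B = 1%:M.
    apply/matrixP => i k; rewrite !mxE; apply/eqP; rewrite -subr_eq0; apply/eqP.
    move: k; apply: ix.
    under eq_bigr do rewrite scalerBl.
    rewrite sumrB [X in _ - X](bigD1 i)//= eqxx scale1r [X in _ - (_ + X)]big1 ?addr0; last first.
      by move=> j /negPf h; rewrite eq_sym h scale0r.
    apply/eqP; rewrite subr_eq0; apply/eqP; rewrite [RHS]hg.
    under eq_bigr do rewrite scaler_suml.
    rewrite exchange_big/=; apply: eq_bigr => j _; rewrite hf scaler_sumr.
    by apply: eq_bigr => k _; rewrite !mxE scalerA.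
  by rewrite -(mxrank1 C m) -AB (leq_trans (mxrankM_maxl _ _))// rank_leq_col.
have memb m (x : 'I_m -> H) j : [set \sum_i c i *: x i | c in [set: 'I_m -> C]] (x j).
  exists (fun i => (i == j)%:R) => //; rewrite (bigD1 j)//= eqxx scale1r big1 ?addr0//.
  by move=> i /negPf ->; rewrite scale0r.
apply: xget_unique; first by exists b.
move=> m [x [ix Vx]]; apply/eqP; rewrite eqn_leq; apply/andP; split.
  apply: (unique _ _ x b) => //; first by rewrite -Vx -Vb.
  by move=> j; have := memb _ b j; rewrite -Vb Vx => -[c _ <-]; exists c.
apply: (unique _ _ b x) => //; first by rewrite -Vx -Vb.
by move=> j; have := memb _ x j; rewrite -Vx Vb => -[c _ <-]; exists c.
Qed.

End Dimension.

(** * Eigenvalues of the compact operator with multiplicities *)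

Section Spectrum.
Variables (R : realType) (H : completeNormedModType R[i]) (ip : inner_product H).
Local Notation C := R[i].
Variable T : H -> H.
Hypothesis T_linear : forall (a : C) u v, T (a *: u + v) = a *: T u + T v.
Hypothesis T_symmetric : forall u v, ip (T u) v = ip u (T v).
Hypothesis T_coercive : forall u, (nrm (T u) ^+ 2)%:C <= ip (T u) u.
Hypothesis T_compact : precompact (T @` [set u | `|u| <= 1]).
Variable B : set H.
Hypothesis onb : orthonormal_basis ip B.
Hypothesis eigB : forall b, B b -> exists r, 0 < r /\ T b = r%:C *: b.
Implicit Types (u v w x y b : H) (e r mu : R).

Lemma nrm_onb b : B b -> nrm b = 1.
Proof.
move=> Bb; have := ip_nrm ip b; rewrite (onb.1 _ _ Bb Bb) eqxx => /(@complexI R 1)/esym/eqP.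
by rewrite -[X in _ == X](expr1n _ 2) eqrXn2 ?nrm_ge0// => /eqP.
Qed.

(* For a unit eigenvector b this is its eigenvalue. *)
Definition ev b : R := qf ip T b.

Lemma ev_spec b : B b -> T b = (ev b)%:C *: b /\ 0 < ev b <= 1.
Proof.
move=> Bb; have [r [r0 e]] := eigB Bb; have b1 := nrm_onb Bb.
have er : ev b = r by rewrite /ev /qf e ipZl ip_nrm b1 expr1n mulr1.
rewrite er r0; split => //=; have := nrmT T_coercive b.
by rewrite e nrmZ b1 mulr1 cmodR gtr0_norm.
Qed.

Lemma ip_T_eigen u b : B b -> ip (T u) b = (ev b)%:C * ip u b.
Proof. by move=> Bb; rewrite T_symmetric (ev_spec Bb).1 ipZr conj_real. Qed.

(** Infinitely many orthonormal eigenvectors with eigenvalue at least e would have images at mutual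
    distance at least e, which compactness excludes. *)
Lemma finite_large e : 0 < e -> finite_set (B `&` [set b | e <= ev b]).
Proof.
move=> e0; apply: contrapT => /infiniteP/pcard_leP[f].
have fB n : B (f n) /\ e <= ev (f n) by have := @funS _ _ _ _ f n I.
have fI n m : n <> m -> f n <> f m.
  by move=> nm /(@inj _ _ _ f) h; apply: nm; apply: h; rewrite inE.
have [|y hy] := @T_cluster _ _ T T_compact f.
  by move=> n; rewrite (nrm_onb (fB n).1).
have e2 : 0 < e / 2%:R by rewrite divr_gt0.
have [n [_ hn]] := hy _ e2 0%N; have [m [nm hm]] := hy _ e2 n.+1.
have fnm : f n <> f m by apply: fI => h; rewrite h ltnn in nm.
have h1 : nrm (T (f n) - T (f m)) < e.
  by rewrite (le_lt_trans (nrm_tri _ y _))// [X in _ + X]nrmB; lra.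
have h2 : e ^+ 2 <= nrm (T (f n) - T (f m)) ^+ 2.
  have [en0 _] := ev_spec (fB n).1; have [em0 _] := ev_spec (fB m).1.
  rewrite em0 (nrm_sub_sqr ip) en0 ipZl (onb.1 _ _ (fB n).1 (fB m).1).
  case: eqP => // _; rewrite mulr0 mulr0 subr0 nrmZ (nrm_onb (fB n).1) mulr1 cmodR.
  rewrite real_normK ?num_real// -[leLHS]addr0 lerD ?(mulr_ge0 (sqr_ge0 _) (sqr_ge0 _))//.
  by rewrite ler_pXn2r ?nnegrE ?(ltW e0)// ?(fB n).2// (le_trans (ltW e0) (fB n).2).
by move: h2; rewrite ler_pXn2r ?nnegrE ?nrm_ge0 ?(ltW e0)// leNgt h1.
Qed.

Lemma countable_ev : countable (ev @` B).
Proof.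
apply: sub_countable (card_image_le _ _) _.
rewrite (_ : B = \bigcup_(n in [set: nat]) (B `&` [set b | n.+1%:R^-1 <= ev b])).
  apply: bigcup_countable => // n _; apply: finite_set_countable.
  by apply: finite_large; rewrite invr_gt0.
apply/seteqP; split => [b Bb|b [n _ []//]].
have [_ /andP[b0 _]] := ev_spec Bb; have [N hN] := small_inv b0.
by exists N => //; split => //=; apply: ltW; exact: hN.
Qed.

Definition level mu : {fset H} := fset_set (B `&` [set b | ev b = mu]).

Lemma finite_level mu : finite_set (B `&` [set b | ev b = mu]).
Proof.
have [mu0|mu0] := ltP 0 mu.
  by apply: sub_finite_set (finite_large mu0) => b [Bb /= ->].
rewrite (_ : _ `&` _ = set0)//; apply/seteqP; split => // b [Bb e].
by have [_ /andP[]] := ev_spec Bb; rewrite e ltNge mu0.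
Qed.

Lemma mem_level mu b : (b \in level mu) <-> (B b /\ ev b = mu).
Proof. by rewrite in_fset_set ?inE//; exact: finite_level. Qed.

Lemma level_sub mu : [set` level mu] `<=` B.
Proof. by move=> b /= /mem_level[]. Qed.

Lemma eigen_comb mu u : T u = mu%:C *: u -> u = comb (level mu) (ip u).
Proof.
move=> Tu; apply: (onb_ext onb) => b Bb; rewrite (ip_comb onb)//; last exact: level_sub.
case: ifPn => // nb; have := ip_T_eigen u Bb; rewrite Tu ipZl => /eqP.
rewrite -subr_eq0 -mulrBl -rmorphB mulf_eq0 => /orP[|/eqP //].
move=> /eqP/(@complexI R (mu - ev b) 0)/eqP; rewrite subr_eq0 => /eqP h.
by exfalso; move/negP: nb; apply; apply/mem_level.
Qed.

Lemma vdim_eigen mu : vdim [set u | T u = mu%:C *: u] = size (level mu).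
Proof.
pose b (i : 'I_(size (level mu))) := nth 0 (level mu) i.
have bl i : b i \in level mu by exact: mem_nth.
have bB i := level_sub (bl i).
have sumE (c : H -> C) : comb (level mu) c = \sum_i c (b i) *: b i.
  by rewrite /comb (big_nth 0) big_mkord.
apply: (@vdim_eq _ _ _ _ b) => [c c0 i|].
  have := congr1 (ip^~ (b i)) c0; rewrite ip0l ip_suml (bigD1 i)//= big1 ?addr0 => [|j ji].
    by rewrite ipZl (onb.1 _ _ (bB i) (bB i)) eqxx mulr1.
  rewrite ipZl (onb.1 _ _ (bB j) (bB i)) nth_uniq ?fset_uniq//.
  case: eqP => [/val_inj e|_]; last by rewrite mulr0.
  by rewrite e eqxx in ji.
apply/seteqP; split => u /=.
  by move=> /eigen_comb ->; exists (fun i => ip u (b i)) => //; rewrite sumE.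
move=> [c _ <-].
elim/big_ind: _ => [|x y Tx Ty|i _]; first by rewrite (T0 T_linear) scaler0.
  by rewrite (TD T_linear) Tx Ty scalerDr.
have [Bb ebi] := (mem_level mu (b i)).1 (bl i).
by rewrite (TZ T_linear) (ev_spec Bb).1 ebi !scalerA mulrC.
Qed.

(* Indices i that correspond to no eigenvalue have multiplicity w_ i = 0. *)
Lemma spectral_sequence : exists (mu_ : nat -> R) (w_ : nat -> nat),
  [/\ forall i, 0 < mu_ i <= 1,
      forall i, w_ i != 0%N -> w_ i = size (level (mu_ i)),
      forall i j, w_ i != 0%N -> w_ j != 0%N -> mu_ i = mu_ j -> i = j,
      forall b, B b -> exists2 i, w_ i != 0%N & mu_ i = ev b &
      forall g : R -> R, (forall r, 0 <= g r) ->
        \esum_(b in B) (g (ev b))%:E = \esum_(i in [set: nat]) ((w_ i)%:R * g (mu_ i))%:E].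
Proof.
have /countable_injP[f finj] := countable_ev.
pose P i := [set m | (ev @` B) m /\ f m = i].
(* The injection f numbers the eigenvalues. An index not taken gets the default eigenvalue 1, which
   respects the bounds, and weight 0. *)
pose mu_ i := xget 1 (P i); pose w_ i := if `[< exists m, P i m >] then size (level (mu_ i)) else 0%N.
have muP i : w_ i != 0%N -> P i (mu_ i).
  by rewrite /w_; case: asboolP => // h _; exact: xgetPex.
have mu1 i : 0 < mu_ i <= 1.
  rewrite /mu_; case: xgetP => [m _ [[b Bb <-] _]|_]; first exact: (ev_spec Bb).2.
  by rewrite ltr01 lexx.
have inj m m' : (ev @` B) m -> (ev @` B) m' -> f m = f m' -> m = m'.
  by move=> h h'; apply: finj; rewrite inE.
have evw b : B b -> mu_ (f (ev b)) = ev b /\ w_ (f (ev b)) != 0%N.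
  move=> Bb; have Pb : P (f (ev b)) (ev b) by split => //; exists b.
  have Pm : P (f (ev b)) (mu_ (f (ev b))) by exact: xgetI Pb.
  have e : mu_ (f (ev b)) = ev b by apply: inj; [exact: Pm.1|exists b|exact: Pm.2].
  split => //; rewrite /w_ asboolT; last by exists (ev b).
  by rewrite -lt0n; apply: (@leq_ltn_trans (index b (level (mu_ (f (ev b))))));
    rewrite // index_mem; apply/mem_level.
exists mu_, w_; split => //.
- by move=> i; rewrite /w_; case: asboolP.
- by move=> i j /muP[_ ei] /muP[_ ej] e; rewrite -ei -ej e.
- by move=> b /evw[e w0]; exists (f (ev b)).
move=> g g0; pose J i := B `&` [set b | f (ev b) = i].
rewrite (_ : B = \bigcup_(i in [set: nat]) J i); last first.
  by apply/seteqP; split => [b Bb|b [i _ []]//]; exists (f (ev b)).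
rewrite esum_bigcupT; [|by move=> i j _ _ [b [[_ <-] [_ <-]]]|by move=> b; rewrite lee_fin].
apply: eq_esum => i _; have [w0|w0] := eqVneq (w_ i) 0%N.
  rewrite w0 mul0r (_ : J i = set0) ?esum_set0//.
  by apply/seteqP; split => // b [Bb e]; have [_] := evw _ Bb; rewrite e w0.
have [mB fm] := muP _ w0.
have Ji : J i = [set` level (mu_ i)].
  apply/seteqP; split => b /=.
    by move=> [Bb e]; apply/mem_level; split => //; have [<- _] := evw _ Bb; rewrite e.
  by move=> /mem_level[Bb e]; split => //=; rewrite e.
rewrite Ji esum_fset//; last by move=> b _; rewrite lee_fin.
rewrite fsbig_finite//= set_fsetK sumEFin; congr (_%:E).
rewrite (eq_big_seq (fun=> g (mu_ i))) => [|b /mem_level[_ ->]//].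
have ws : w_ i = size (level (mu_ i)) by move: w0; rewrite /w_; case: asboolP.
by rewrite big_const_seq count_predT iter_addr_0 ws mulr_natl.
Qed.

End Spectrum.

#[global] Existing Instance summability.totally_filter.

Section UnorderedLimits.
Variable R : realType.
Local Notation C := R[i].

Lemma totally_cvg (I : choiceType) (F : I -> C) (X : C) :
  (forall e : R, 0 < e -> exists J0 : {fset I}, forall J : {fset I}, {subset J0 <= J} ->
     cmod (\sum_(l <- J) F l - X) < e) ->
  summability.partial_sum F J @[J --> summability.totally] --> X.
Proof.
move=> h; apply/cvg_ballP => e /gt0_complex[-> e0]; have [J0 hJ] := h _ e0.
exists J0 => // J /= J0J; rewrite -ball_normE /ball_/= distrC normr_cmod ltcR.
have -> : summability.partial_sum F J = \sum_(l <- J) F l by rewrite big_seq_fsetE.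
by apply: hJ; apply/fsubsetP.
Qed.

Lemma totally_nonneg (I : choiceType) (A : set I) (f : I -> R) (s : R) :
  (forall i, A i -> 0 <= f i) -> \esum_(i in A) (f i)%:E = s%:E ->
  forall F : I -> C, (forall i, F i = (i \in A)%:R * (f i)%:C) ->
  summability.partial_sum F J @[J --> summability.totally] --> s%:C.
Proof.
move=> f0 As F FE; apply: totally_cvg => e e0; have [J0 [J0A h]] := esum_fset_approx As e0.
exists J0 => J J0J; pose K := [fset i in J | i \in A]%fset.
have KA : [set` K] `<=` A by move=> i /=; rewrite !inE => /andP[_]; rewrite inE.
have -> : \sum_(l <- J) F l = (\sum_(i <- K) f i)%:C.
  rewrite -(@sum_subfset _ _ f J K) => [|i]; last by rewrite !inE => /andP[].
  rewrite rmorph_sum/= [RHS]big_mkcond/=; apply: eq_big_seq => i iJ.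
  by rewrite FE !inE iJ /=; case: (i \in A); rewrite ?mul1r ?mul0r.
rewrite -rmorphB cmodR /= ltr_norml; apply/andP; split; last first.
  have : \sum_(i <- K) f i <= s by rewrite -lee_fin -As le_esum_fset.
  by lra.
suff : \sum_(i <- J0) f i <= \sum_(i <- K) f i by lra.
have J0K : {subset J0 <= K} by move=> i iJ0; rewrite !inE J0J//= inE; exact: J0A.
rewrite -(sum_subfset _ J0K) big_mkcond/=; apply: ler_sum_fset => i /KA Ai.
by case: ifP => // _; exact: f0.
Qed.

(** Once J contains the first N terms, its other nonzero terms are among the x_i with i >= N,
    because a numbers the support of g injectively; the tail of the absolute series bounds them. *)
Lemma totally_sequence (I : choiceType) (g : I -> C) (a : nat -> I) (x : nat -> C) (S : R) (X : C) :
  (forall i j, x i != 0 -> x j != 0 -> a i = a j -> i = j) ->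
  (forall i, x i != 0 -> x i = g (a i)) ->
  (forall l, g l != 0 -> exists2 i, x i != 0 & a i = l) ->
  (forall N, \sum_(k < N) cmod (x k) <= S) ->
  ccvg (fun N => \sum_(k < N) x k) X ->
  summability.partial_sum g J @[J --> summability.totally] --> X.
Proof.
move=> ainj xg gx xS xX; apply: totally_cvg => e e0.
have e2 : 0 < e / 3%:R by rewrite divr_gt0.
have [N0 hN0] := sum_tail (fun k => cmod_ge0 (x k)) xS e2.
have [N1 hN1] := xX _ e2; pose N := maxn N0 N1.
exists [fset a i | i in iota 0 N]%fset => J J0J.
have [M [NM hM]] : exists M, (N <= M)%N /\ forall l, l \in J -> g l != 0 ->
    exists2 i, (i < M)%N & x i != 0 /\ a i = l.
  suff [M hM] : exists M, forall l, l \in (J : seq I) -> g l != 0 ->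
      exists2 i, (i < M)%N & x i != 0 /\ a i = l.
    exists (maxn N M); rewrite leq_maxl; split => // l lJ gl.
    by have [i iM h] := hM _ lJ gl; exists i => //; rewrite leq_max iM orbT.
  elim: (J : seq I) => [|l s [M IH]]; first by exists 0%N.
  have [gl|gl] := eqVneq (g l) 0.
    by exists M => l'; rewrite inE => /orP[/eqP ->|/IH//]; rewrite gl eqxx.
  have [i xi ai] := gx _ gl; exists (maxn M i.+1) => l'.
  rewrite inE => /orP[/eqP -> _|/IH h /h[j jM hj]]; first by exists i; rewrite ?leq_max ?leqnn ?orbT.
  by exists j; rewrite ?leq_max ?jM.
have -> : \sum_(l <- J) g l = \sum_(i < M) if a i \in J then x i else 0.
  transitivity (\sum_(l <- J) \sum_(i < M) if a i == l then x i else 0).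
    apply: eq_big_seq => l lJ; have [gl|gl] := eqVneq (g l) 0.
      rewrite gl big1// => i _; case: eqP => // ai; apply/eqP; apply: contraTT isT => xi.
      by move: (xi); rewrite (xg _ xi) ai gl eqxx.
    have [i iM [xi ai]] := hM _ lJ gl; rewrite (bigD1 (Ordinal iM))//= ai eqxx big1.
      by rewrite addr0 (xg _ xi) ai.
    move=> j ji; case: eqP => // aj; apply/eqP; apply: contraNT ji => xj.
    by apply/eqP/val_inj => /=; apply: ainj => //; rewrite aj ai.
  rewrite exchange_big/=; apply: eq_bigr => i _; case: ifPn => aJ.
    rewrite (bigD1_seq (a i))//= ?fset_uniq// eqxx big1 ?addr0// => l.
    by rewrite eq_sym => /negPf ->.
  by rewrite big1_seq// => l /= lJ; case: eqP => // e'; rewrite e' lJ in aJ.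
rewrite -(big_mkord xpredT (fun i => if a i \in J then x i else 0)) (big_cat_nat (n := N))//=.
have -> : \sum_(0 <= i < N) (if a i \in J then x i else 0) = \sum_(i < N) x i.
  rewrite big_mkord; apply: eq_bigr => i _; rewrite J0J//.
  by apply/imfsetP; exists (val i) => //=; rewrite mem_iota/=.
have h1 := hN1 N (leq_maxr _ _).
have h2 : cmod (\sum_(N <= i < M) (if a i \in J then x i else 0)) <= e / 3%:R.
  apply: le_trans (hN0 M); apply: le_trans (cmod_sum _ _ _) _.
  rewrite [leRHS](big_cat_nat (n := N)) ?leq_maxl//=.
  rewrite -[leLHS]add0r lerD ?sumr_ge0// => [i _|]; first exact: cmod_ge0.
  by apply: ler_sum => i _; case: ifP => // _; rewrite cmod0 cmod_ge0.
rewrite addrAC (le_lt_trans (cmodD _ _))//; move: h1 h2; lra.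
Qed.

(* e^-x <= (1 + x/n)^-n <= e^(x^2/n - x), the upper bound since
   (1 + y) (1 + y^2 - y) = 1 + y^3. *)
Lemma euler_cvg (x : R) : 0 <= x -> (fun n : nat => ((1 + x / n%:R)^-1) ^+ n) @ \oo --> expR (- x).
Proof.
move=> x0.
have bounds (n : nat) : expR (- x) <= ((1 + x / n.+1%:R)^-1) ^+ n.+1 <=
    expR (- x) * expR (x ^+ 2 / n.+1%:R).
  have n0 : n.+1%:R != 0 :> R by rewrite pnatr_eq0.
  set y := x / n.+1%:R; have y0 : 0 <= y by rewrite divr_ge0.
  have y1 : 0 < 1 + y by rewrite ltr_pwDl.
  have e1 : expR (- x) = expR (- y) ^+ n.+1.
    by rewrite -expRM_natl; congr expR; rewrite /y; field.
  have e2 : expR (x ^+ 2 / n.+1%:R) = expR (y ^+ 2) ^+ n.+1.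
    by rewrite -expRM_natl; congr expR; rewrite /y; field.
  rewrite e1 e2 -exprMn !ler_pXn2r ?nnegrE ?mulr_ge0 ?expR_ge0 ?invr_ge0 ?(ltW y1)//.
  rewrite expRN lef_pV2 ?posrE ?expR_gt0// expR_ge1Dx/=.
  rewrite -expRN -expRD -[leLHS]mul1r ler_pdivrMr//.
  apply: le_trans (ler_wpM2r (ltW y1) (expR_ge1Dx _)).
  have : 0 <= y ^+ 3 by rewrite exprn_ge0.
  by rewrite (_ : y ^+ 3 = y * y * y); [nra|ring].
rewrite -cvg_shiftS /=.
apply: (@squeeze_cvgr _ _ _ _ (fun=> expR (- x)) (fun n : nat => expR (- x) * expR (x ^+ 2 / n.+1%:R))).
- by apply: nearW => n; exact: bounds.
- exact: cvg_cst.
have h : (fun n : nat => expR (x ^+ 2 / n.+1%:R)) @ \oo --> expR (0 : R).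
  apply: continuous_cvg; first exact: continuous_expR.
  have := cvgM (cvg_cst (x ^+ 2)) (@cvg_harmonic R); rewrite mulr0; exact.
by have := cvgM (cvg_cst (expR (- x))) h; rewrite expR0 mulr1; exact.
Qed.

End UnorderedLimits.

(** * Heat semigroup and zeta function of L *)

Section HeatSemigroup.
Variables (R : realType) (H : completeNormedModType R[i]) (ip : inner_product H).
Local Notation C := R[i].
Variables (L : operator H) (T : H -> H).
Hypothesis L_self_adjoint : self_adjoint ip L.
Hypothesis L_nonneg : nonneg_operator ip L.
Hypothesis TL : forall v, dom L (T v) /\ L (T v) + T v = v.
Hypothesis LT : forall u, dom L u -> T (L u + u) = u.
Hypothesis T_linear : forall (a : C) u v, T (a *: u + v) = a *: T u + T v.
Implicit Types (u v w x y b : H) (e r s t mu : R).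

Lemma L_symmetric u v : dom L u -> dom L v -> ip (L u) v = ip u (L v).
Proof. by move=> du dv; apply: (L_self_adjoint.2 v (L v)).2. Qed.

Lemma T_symmetric u v : ip (T u) v = ip u (T v).
Proof.
have [du eu] := TL u; have [dv ev] := TL v.
by rewrite -{1}ev -{2}eu ipDr ipDl L_symmetric.
Qed.

Lemma T_coercive u : (nrm (T u) ^+ 2)%:C <= ip (T u) u.
Proof.
have [du eu] := TL u; have -> : ip (T u) u = ip (T u) (L (T u) + T u) by rewrite eu.
rewrite ipDr -L_symmetric// ip_nrm lerDr.
exact: L_nonneg.
Qed.

Lemma L_zero : L 0 = 0.
Proof.
have := app_linear 1 (dom0 L) (dom0 L); rewrite !scale1r addr0 => h.
by apply: (addrI (L 0)); rewrite -h addr0.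
Qed.

Lemma T_injective u : T u = 0 -> u = 0.
Proof. by move=> Tu; have [_] := TL u; rewrite Tu L_zero addr0. Qed.

Variable B : set H.
Hypothesis onb : orthonormal_basis ip B.
Hypothesis eigB : forall b, B b -> exists r, 0 < r /\ T b = r%:C *: b.

Local Notation evT := (ev ip T).

Definition lamb b : R := (evT b)^-1 - 1.

Lemma evT_spec b : B b -> T b = (evT b)%:C *: b /\ 0 < evT b <= 1.
Proof. exact: (ev_spec T_coercive onb eigB). Qed.

Lemma lamb_ge0 b : B b -> 0 <= lamb b.
Proof.
move=> /evT_spec[_ /andP[e0 e1]].
by rewrite subr_ge0 invf_ge1.
Qed.

Lemma eigen_transfer mu u : 0 < mu ->
  (dom L u /\ L u = (mu^-1 - 1)%:C *: u) <-> T u = mu%:C *: u.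
Proof.
move=> mu0; have mc : mu%:C * (mu^-1)%:C = 1 by rewrite -rmorphM/= mulfV ?gt_eqF.
split=> [[du Lu]|Tu].
  have := LT du; rewrite Lu -[X in _ *: u + X]scale1r -scalerDl.
  rewrite rmorphB rmorph1 subrK (TZ T_linear) => h.
  by rewrite -[in RHS]h scalerA mc scale1r.
have e : u = T ((mu^-1)%:C *: u) by rewrite (TZ T_linear) Tu scalerA mulrC mc scale1r.
have [dT LTu] := TL ((mu^-1)%:C *: u); rewrite -e in dT LTu.
by split => //; rewrite rmorphB rmorph1 scalerBl scale1r -LTu addrK.
Qed.

Lemma L_eigen b : B b -> dom L b /\ L b = (lamb b)%:C *: b.
Proof. by move=> /evT_spec[Tb /andP[e0 _]]; apply/eigen_transfer. Qed.

Lemma ip_L u b : dom L u -> B b -> ip (L u) b = (lamb b)%:C * ip u b.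
Proof.
by move=> du /L_eigen[db Lb]; rewrite L_symmetric// Lb ipZr conj_real.
Qed.

(* For v = T y, v + s L v = u becomes the bounded equation (s + (1 - s) T) y = u, which is
   diagonal in B. *)
Lemma ip_resolvent s u b : 0 < s -> B b ->
  ip (resolvent L s u) b = ((1 + s * lamb b)^-1)%:C * ip u b.
Proof.
move=> s0 Bb; pose m c : R := s + (1 - s) * evT c.
(* m is a convex combination of s and 1, with weights 1 - ev and ev, hence bounded away from 0. *)
have m_ge c : B c -> Num.min s 1 <= m c.
  move=> /evT_spec[_ /andP[e0 e1]]; rewrite ge_min /m.
  by have [s1|s1] := leP s 1; apply/orP; [left|right]; nra.
have ms : 0 < Num.min s 1 by rewrite lt_min s0 ltr01.
have [y hy] : exists y, forall c, B c -> ip y c = ((m c)^-1)%:C * ip u c.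
  apply: (multiplier onb (m := fun c => ((m c)^-1)%:C) (M := (Num.min s 1)^-1)) => c Bc.
  have mc := lt_le_trans ms (m_ge _ Bc).
  by rewrite cmodR gtr0_norm ?invr_gt0// lef_pV2 ?posrE ?m_ge.
have [dT LTy] := TL y.
have ex : dom L (T y) /\ T y + s%:C *: L (T y) = u.
  split => //; apply: (onb_ext onb) => c Bc.
  have -> : L (T y) = y - T y by rewrite -{2}LTy addrK.
  rewrite ipDl ipZl ipBl (ip_T_eigen T_symmetric T_coercive onb eigB)// hy//.
  have mc := lt_le_trans ms (m_ge _ Bc).
  have e : (evT c)%:C * ((m c)^-1)%:C + s%:C * (((m c)^-1)%:C - (evT c)%:C * ((m c)^-1)%:C) = 1.
    rewrite -!(rmorphM, rmorphB, rmorphD)/= -[1]/((1 : R)%:C); congr (_%:C).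
    rewrite -[RHS](mulfV (lt0r_neq0 mc)); move: ((m c)^-1) => k; rewrite /m; ring.
  rewrite -[RHS]mul1r -e; move: (ip u c) ((evT c)%:C) (((m c)^-1)%:C) (s%:C) => x1 x2 x3 x4; ring.
(* [resolvent] picks some solution; the equation alone determines its coefficients in B. *)
have [dv ve] := xgetPex (0 : H) (ex_intro (fun v => dom L v /\ v + s%:C *: L v = u) _ ex).
rewrite -[xget _ _]/(resolvent L s u) in dv ve.
have l0 : 0 < 1 + s * lamb b by rewrite ltr_pwDl// mulr_ge0 ?lamb_ge0// ltW.
have := congr1 (ip^~ b) ve; rewrite ipDl ipZl ip_L// => <-.
have -> (x : C) : x + s%:C * ((lamb b)%:C * x) = (1 + s * lamb b)%:C * x.
  by rewrite [(1 + _)%:C]rmorphD rmorphM/= rmorph1; ring.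
by rewrite mulrA -rmorphM mulVf ?gt_eqF// rmorph1 mul1r.
Qed.

Lemma ip_iter_resolvent n s u b : 0 < s -> B b ->
  ip (iter n (resolvent L s) u) b = (((1 + s * lamb b)^-1) ^+ n)%:C * ip u b.
Proof.
move=> s0 Bb; elim: n => [|n IH]; first by rewrite expr0 mul1r.
by rewrite iterS ip_resolvent// IH mulrA -rmorphM exprS.
Qed.

Lemma cvg_sum_seq0 (J : seq H) (x : nat -> H -> R) :
  (forall b, b \in J -> (x^~ b) @ \oo --> (0 : R)) ->
  forall e, 0 < e -> exists N : nat, forall n, (N <= n)%N -> \sum_(b <- J) x n b < e.
Proof.
elim: J => [|b J IH] h e e0; first by exists 0%N => n _; rewrite big_nil.
have e2 : 0 < e / 2%:R by rewrite divr_gt0.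
have [|N hN] := IH _ _ e2; first by move=> c cJ; apply: h; rewrite inE cJ orbT.
have /cvgrPdist_lt /(_ _ e2)[M _ hM] := h b (mem_head _ _).
exists (maxn N M) => n; rewrite geq_max => /andP[Nn Mn]; rewrite big_cons.
have := hN _ Nn; have /= := hM _ Mn; rewrite sub0r normrN => /(le_lt_trans (ler_norm _)); lra.
Qed.

(** Dominated convergence in the coefficients: a finite J carries |u|^2 up to a small error, on J
    the factors converge, and off J they differ by at most 1. So the iterated resolvents converge in
    norm to the vector with the limiting coefficients. *)
Lemma ip_heat_op t u b : 0 < t -> B b ->
  ip (heat_op L t u) b = (expR (- (t * lamb b)))%:C * ip u b.
Proof.
move=> t0 Bb; pose m (n : nat) c : R := ((1 + t / n%:R * lamb c)^-1) ^+ n.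
pose m0 c : R := expR (- (t * lamb c)).
have m0_le c : B c -> 0 <= m0 c <= 1.
  move=> Bc; rewrite expR_ge0/= -[leRHS]expR0 ler_expR oppr_le0.
  by rewrite mulr_ge0 ?lamb_ge0// ltW.
have m_le n c : B c -> 0 <= m n c <= 1.
  move=> Bc; have h : 0 <= t / n%:R * lamb c by rewrite mulr_ge0 ?lamb_ge0// divr_ge0// ltW.
  by rewrite exprn_ge0 ?invr_ge0 ?addr_ge0//= exprn_ile1 ?invr_ge0 ?addr_ge0// invf_le1 ?lerDl// ltr_pwDl.
have m_cvg c : B c -> (m^~ c) @ \oo --> m0 c.
  move=> Bc; have := euler_cvg (mulr_ge0 (ltW t0) (lamb_ge0 Bc)).
  rewrite (_ : (fun n : nat => _) = m^~ c)//; apply/funext => n.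
  by rewrite /m mulrAC.
have [y hy] : exists y, forall c, B c -> ip y c = (m0 c)%:C * ip u c.
  apply: (multiplier onb (m := fun c => (m0 c)%:C) (M := 1)) => c Bc.
  by have /andP[h0 h1] := m0_le _ Bc; rewrite cmodR ger0_norm.
have cvy : hcvg (fun n => iter n (resolvent L (t / n%:R)) u) y.
  move=> e e0; have e2 : 0 < e ^+ 2 / 2%:R by rewrite divr_gt0// exprn_gt0.
  have se : 0 < Num.sqrt (e ^+ 2 / 2%:R) by rewrite sqrtr_gt0.
  have [J [JB hJ]] := comb_dense onb u se.
  have {}hJ : nrm u ^+ 2 - \sum_(c <- J) cmod (ip u c) ^+ 2 < e ^+ 2 / 2%:R.
    rewrite -(nrm_sub_comb onb u JB) -[ltRHS]sqr_sqrtr ?(ltW e2)//.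
    by rewrite ltr_pXn2r ?nnegrE ?nrm_ge0 ?sqrtr_ge0.
  pose d n c := (m n c - m0 c) ^+ 2 * cmod (ip u c) ^+ 2.
  have dn c : B c -> (d^~ c) @ \oo --> (0 : R).
    move=> Bc; have h : (fun n => m n c - m0 c) @ \oo --> (0 : R).
      by rewrite -(subrr (m0 c)); apply: cvgB; [exact: m_cvg|exact: cvg_cst].
    rewrite (_ : d^~ c = fun n => (m n c - m0 c) * (m n c - m0 c) * cmod (ip u c) ^+ 2).
      have -> : (0 : R) = 0 * 0 * cmod (ip u c) ^+ 2 by rewrite !mul0r.
      by apply: cvgM; [exact: cvgM|exact: cvg_cst].
    by apply/funext => n; rewrite /d expr2.
  have [|N hN] := @cvg_sum_seq0 J d _ _ e2; first by move=> c /JB; exact: dn.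
  (* n = 0 is excluded because t / 0 = 0, while the resolvent formula needs a positive step. *)
  exists (maxn N 1) => n; rewrite geq_max => /andP[Nn n1].
  have tn : 0 < t / n%:R by rewrite divr_gt0// ltr0n.
  rewrite -(@ltr_pXn2r _ 2)// ?nnegrE ?nrm_ge0 ?(ltW e0)//.
  apply: (@le_lt_trans _ _ (\sum_(c <- J) d n c + (nrm u ^+ 2 - \sum_(c <- J) cmod (ip u c) ^+ 2))).
    apply: (nrm_sqr_le onb) => K KB.
    have d_eq c : B c -> cmod (ip (iter n (resolvent L (t / n%:R)) u - y) c) ^+ 2 = d n c.
      move=> Bc; rewrite ipBl ip_iter_resolvent// hy// -mulrBl -rmorphB cmodM exprMn.
      by rewrite cmodR real_normK ?num_real.
    rewrite (eq_big_seq (d n)); last by move=> c /KB; exact: d_eq.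
    rewrite (bigID (mem J))/= lerD//.
      have d0 c : 0 <= d n c by rewrite mulr_ge0 ?sqr_ge0.
      pose X := [fset c in K | c \in J]%fset.
      have XJ : {subset X <= J} by move=> c; rewrite !inE => /andP[].
      have XK : {subset X <= K} by move=> c; rewrite !inE => /andP[].
      rewrite (_ : \sum_(c <- K | c \in J) _ = \sum_(c <- X) d n c).
        by rewrite -(sum_subfset _ XJ) [leLHS]big_mkcond/=; apply: ler_sum => c _; case: ifP.
      rewrite -(sum_subfset _ XK) [LHS]big_mkcond [RHS]big_mkcond/=; apply: eq_big_seq => c cK.
      by rewrite !inE cK.
    rewrite lerBrDl.
    pose U := (J `|` K)%fset; have UB : [set` U] `<=` B.
      by move=> c /=; rewrite inE => /orP[/(JB c)|/(KB c)].
    apply: le_trans (bessel onb u UB).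
    have JU : {subset J <= U} by apply/fsubsetP/fsubsetUl.
    have KU : {subset K <= U} by apply/fsubsetP/fsubsetUr.
    rewrite [leRHS](bigID (mem J))/= (sum_subfset _ JU) lerD2l.
    apply: (@le_trans _ _ (\sum_(c <- K | c \notin J) cmod (ip u c) ^+ 2)).
      rewrite big_mkcond [leRHS]big_mkcond/=; apply: ler_sum_fset => c /KB Bc.
      case: ifP => // _; rewrite /d -[leRHS]mul1r ler_wpM2r ?sqr_ge0//.
      have /andP[p1 p2] := m_le n _ Bc; have /andP[q1 q2] := m0_le _ Bc.
      by rewrite -real_normK ?num_real// exprn_ile1// ler_norml; lra.
    rewrite big_mkcond [leRHS]big_mkcond/= -(sum_subfset _ KU) big_mkcond/=.
    by apply: ler_sum => c _; do 2 case: ifP => //; rewrite ?sqr_ge0.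
  have := hN _ Nn; lra.
have -> : heat_op L t u = y by apply: cvg_lim => //; exact: hcvg_cvg.
exact: hy.
Qed.

Lemma heat_trace_eq t s : 0 < t -> \esum_(b in B) (expR (- (t * lamb b)))%:E = s%:E ->
  heat_trace ip L t = s%:C.
Proof.
move=> t0 hs.
have key B' : orthonormal_basis ip B' ->
    summability.partial_sum (fun u : H => (u \in B')%:R * ip (heat_op L t u) u) J
      @[J --> summability.totally] --> s%:C.
  move=> onb'.
  have /choice[q hq] u : exists q : R, ip (heat_op L t u) u = q%:C /\
      \esum_(b in B) (expR (- (t * lamb b)) * cmod (ip u b) ^+ 2)%:E = q%:E.
    have [q h1 h2] := diagonal_form onb (u := u) (v := heat_op L t u)
      (m := fun b => expR (- (t * lamb b))) (fun b _ => expR_ge0 _)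
      (fun b Bb => ip_heat_op u t0 Bb).
    by exists q.
  apply: (totally_nonneg (A := B') (f := q)); last by move=> u; rewrite (hq u).1.
    move=> u _; rewrite -lee_fin -(hq u).2; apply: esum_ge0 => b _.
    by rewrite lee_fin mulr_ge0 ?expR_ge0 ?sqr_ge0.
  (* Tonelli exchanges the two bases; for each b the sum over B' of |<u, b>|^2 is then 1 by
     Parseval. *)
  transitivity (\esum_(u in B') \esum_(b in B) (expR (- (t * lamb b)) * cmod (ip u b) ^+ 2)%:E)%E.
    by apply: eq_esum => u _; rewrite (hq u).2.
  have nn u b : (0 <= (expR (- (t * lamb b)) * cmod (ip u b) ^+ 2)%:E)%E.
    by rewrite lee_fin mulr_ge0 ?expR_ge0 ?sqr_ge0.
  rewrite esum_esum// -hs.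
  rewrite (@reindex_esum _ _ _ (B `*`` (fun=> B')) _ (fun k => (k.2, k.1))); last first.
    split; [by move=> [b u] [/= ? ?]|by move=> [b u] [b' u'] _ _ [-> ->]|].
    by move=> [u b] [/= ? ?]; exists (b, u).
  rewrite -(@esum_esum _ _ _ B (fun=> B')
    (fun b u => (expR (- (t * lamb b)) * cmod (ip u b) ^+ 2)%:E))//.
  apply: eq_esum => b Bb.
  have E : \esum_(u in B') (cmod (ip u b) ^+ 2)%:E = 1%:E.
    have := parseval onb' b; rewrite (nrm_onb onb Bb) expr1n => <-; apply: eq_esum => u _.
    by rewrite (inner_conj ip u b) cmod_conj.
  apply: esum_fset_eq => [J JB|e e0].
    rewrite -mulr_sumr ler_piMr ?expR_ge0// -lee_fin -E; exact: le_esum_fset.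
  have [J [JB hJ]] := esum_fset_approx E (divr_gt0 e0 (expR_gt0 (- (t * lamb b)))).
  exists J; split => //; rewrite -mulr_sumr.
  have := hJ; rewrite -(ltr_pM2l (expR_gt0 (- (t * lamb b)))) mulrBr mulr1 [X in _ - X]mulrC divfK//.
  by rewrite gt_eqF// expR_gt0.
(* Two candidates for the trace agree because both are limits along B; without any basis the
   condition would be void. *)
apply: xget_unique; first exact: key.
move=> tau h; rewrite -(cvg_lim (@norm_hausdorff _ _) (h B onb)).
exact: (cvg_lim (@norm_hausdorff _ _) (key B onb)).
Qed.

Hypothesis T_compact : precompact (T @` [set u | `|u| <= 1]).

Lemma vdim_eigenspace_L mu : 0 < mu ->
  vdim (Defs.eigenspace (dom L) L (mu^-1 - 1)%:C) = size (level ip T B mu).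
Proof.
move=> mu0; rewrite -(vdim_eigen T_linear T_symmetric T_coercive T_compact)//.
by congr (vdim _); apply/seteqP; split => u /=; [move/(eigen_transfer u mu0)|move/(eigen_transfer u mu0).2].
Qed.

(** An eigenvector gives l |u|^2 = <L u, u> >= 0, so l is real and nonnegative, and mu = 1 / (1 +
    l). *)
Lemma eigenvalue_L (l : C) : vdim (Defs.eigenspace (dom L) L l) != 0%N ->
  exists2 mu, 0 < mu & l = (mu^-1 - 1)%:C.
Proof.
move=> d0; have [u [[du Lu] /eqP u0]] : exists u, Defs.eigenspace (dom L) L l u /\ u <> 0.
  apply: contrapT => h; move/eqP: d0; apply; apply: (@vdim_eq _ _ _ _ (fun _ : 'I_0 => 0)); first by move=> c _ [].
  apply/seteqP; split => u /=; last first.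
    by move=> [c _ <-]; rewrite big_ord0; split; [exact: dom0|rewrite L_zero scaler0].
  move=> lu; exists (fun=> 0) => //; rewrite big_ord0; apply/esym; apply: contrapT => u0.
  by apply: h; exists u.
have n0 : 0 < (nrm u ^+ 2)%:C :> C.
  rewrite ltcR exprn_gt0// lt_neqAle nrm_ge0 andbT eq_sym.
  by apply/eqP => /nrm_eq0 e; rewrite e eqxx in u0.
have : 0 <= l.
  by have := L_nonneg du; rewrite Lu ipZl ip_nrm pmulr_lge0.
have real (r : R) : 0 <= r -> exists2 mu, 0 < mu & r%:C = (mu^-1 - 1)%:C :> C.
  move=> r0; exists (1 + r)^-1; first by rewrite invr_gt0 ltr_pwDl.
  by rewrite invrK addrAC subrr add0r.
rewrite le_eqVlt => /orP[/eqP <-|/gt0_complex[-> /ltW]]; exact: real.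
Qed.

(** T is self-adjoint and positive, so its singular values are its eigenvalues: if T^2 u = mu^2 u,
    then w = T u - mu u satisfies T w = - mu w, and positivity forces w = 0. *)
Lemma schatten_sum (p : R) : schatten ip p T -> exists S : R,
  \esum_(mu in [set mu : R | (0 < mu)%R]) ((size (level ip T B mu))%:R * mu `^ p)%:E = S%:E.
Proof.
move=> [Tadj [_ adj _ fin]].
have TadjE v : Tadj v = T v.
  by apply: (ip_ext (ip := ip)) => u; rewrite (inner_conj ip u) -adj T_symmetric -(inner_conj ip u).
have eqE : (\esum_(mu in [set mu : R | (0 < mu)%R]) ((size (level ip T B mu))%:R * mu `^ p)%:E =
    \esum_(mu in [set mu : R | (0 < mu)%R])
      ((vdim (Defs.eigenspace setT (Tadj \o T) (mu ^+ 2)%:C))%:R * mu `^ p)%:E)%E.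
  apply: eq_esum => mu mu0; do 3 congr (_ _); congr (_ * _); congr (_%:R).
  rewrite -(vdim_eigen T_linear T_symmetric T_coercive T_compact)//; congr (vdim _).
  apply/seteqP; split => u /=.
    by move=> Tu; split => //=; rewrite TadjE Tu (TZ T_linear) Tu scalerA -rmorphM expr2.
  move=> [_ /=]; rewrite TadjE => TTu; apply/eqP; rewrite -subr_eq0; apply/eqP.
  set w := T u - mu%:C *: u.
  have Tw : T w = - (mu%:C *: w).
    rewrite (TB T_linear) (TZ T_linear) TTu /w scalerBr scalerA -rmorphM -expr2 opprB.
    by [].
  have := T_coercive w; rewrite Tw ipNl ipZl ip_nrm -rmorphM -rmorphN lecR nrmN nrmZ cmodR.
  rewrite (gtr0_norm mu0) exprMn => h; apply: (@nrm_eq0 _ H); apply/eqP; rewrite -sqrf_eq0.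
  apply/eqP/le_anti; rewrite sqr_ge0 andbT.
  have := sqr_ge0 (nrm w); have : 0 < mu ^+ 2 by rewrite exprn_gt0.
  by move: h mu0 => /=; nra.
exists (fine (\esum_(mu in [set mu : R | (0 < mu)%R]) ((size (level ip T B mu))%:R * mu `^ p)%:E)).
rewrite fineK// ge0_fin_numE ?eqE//; apply: esum_ge0 => mu _.
by rewrite lee_fin mulr_ge0 ?powR_ge0.
Qed.

End HeatSemigroup.

Section ZetaBound.
Variable R : realType.
Local Notation C := R[i].

Lemma clogE (z : C) : clog z = ln (cmod z) +i* carg z.
Proof. by []. Qed.

(** For y = lam + z, |y^(-s)| = |y|^(-Re s) e^(Im s arg y). The last factor is at most e^(pi |Im
    s|), and |y| >= q (1 + lam) handles the first. *)
Lemma cmod_cpow_le (p : R) (z s : C) : 0 <= p -> 0 < complex.Re z -> p < complex.Re s ->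
  exists2 M : R, 0 <= M & forall lam : R, 0 <= lam ->
    cmod (cpow (lam%:C + z) (- s)) <= M * expR (- p * ln (1 + lam)).
Proof.
move=> p0 z0 ps; pose q := Num.min 1 (complex.Re z).
have q0 : 0 < q by rewrite lt_min ltr01.
exists (expR (- complex.Re s * ln q + `|complex.Im s| * pi)) => [|lam lam0]; first exact: expR_ge0.
set y := lam%:C + z; have y0 : 0 < complex.Re y by rewrite cReD Re_real ltr_wpDl.
have l1 : 0 < 1 + lam by rewrite ltr_pwDl.
rewrite /cpow cmod_cexp -expRD ler_expR clogE cReM cReN cImN.
have hy : ln (q * (1 + lam)) <= ln (cmod y).
  have yc : complex.Re y <= cmod y by apply: le_trans (cmod_Re y); exact: ler_norm.
  have cy : 0 < cmod y by exact: lt_le_trans y0 yc.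
  rewrite ler_ln ?posrE ?mulr_gt0//.
  apply: le_trans yc; rewrite cReD Re_real mulrDr mulr1 addrC lerD//.
    by rewrite ler_piMl// ge_min lexx.
  by rewrite ge_min lexx orbT.
rewrite lnM ?posrE// in hy.
have ln0 : 0 <= ln (1 + lam) by rewrite ln_ge0// lerDl.
have arg : complex.Im s * carg y <= `|complex.Im s| * pi.
  apply: le_trans (ler_norm _) _; rewrite normrM ler_wpM2l//.
  rewrite carg_atan// ler_norml; have := atan_ltpi2 (complex.Im y / complex.Re y).
  by have := atan_gtNpi2 (complex.Im y / complex.Re y); have := pi_gt0 R; lra.
rewrite /= !mulNr opprK; move: hy arg ps ln0.
move: (complex.Im s * carg y) (`|complex.Im s| * pi) (ln q) (ln (1 + lam)) (ln (cmod y)) => a b c d e.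
move=> h1 h2 h3 h4; have hs : 0 <= complex.Re s by exact: le_trans p0 (ltW h3).
have := ler_wpM2l hs h1; have := ler_wpM2r h4 (ltW h3); rewrite mulrDr; lra.
Qed.

Lemma le_esum_subset (T : choiceType) (A D : set T) (f : T -> \bar R) : A `<=` D ->
  (\esum_(i in A) f i <= \esum_(i in D) f i)%E.
Proof.
move=> AD; apply: ge_ereal_sup => _ [X [fX XA] <-]; apply: esum_ge; exists X => //.
by split => //; exact: subset_trans AD.
Qed.

End ZetaBound.

(** * From the operator to sequences of eigenvalues and multiplicities *)

Section SpectralData.
Variables (R : realType) (H : completeNormedModType R[i]) (ip : inner_product H).
Local Notation C := R[i].
Variables (L : operator H) (p : R).
Hypothesis L_self_adjoint : self_adjoint ip L.
Hypothesis L_nonneg : nonneg_operator ip L.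
Hypothesis p1 : 1 <= p.
Hypothesis L_schatten : inverse_in_schatten ip L p.

Lemma spectral_data : exists (lam w : nat -> R) (S : R) (th : R -> R),
  [/\ (forall i, 0 <= lam i) /\ (forall i, 0 <= w i),
      forall N, \sum_(i < N) w i * expR (- p * ln (1 + lam i)) <= S,
      forall t, 0 < t -> (fun N => \sum_(i < N) w i * expR (- (t * lam i))) @ \oo --> th t,
      forall t, 0 < t -> heat_trace ip L t = (th t)%:C &
      forall z s, 0 < complex.Re z -> p < complex.Re s ->
        ccvg (fun N => \sum_(i < N) (w i)%:C * cpow ((lam i)%:C + z) (- s)) (zeta_series L z s)].
Proof.
have [T [TL LT Tschatten]] := L_schatten; have [_ [T_linear _ T_compact _]] := Tschatten.
have Tsym := T_symmetric L_self_adjoint TL.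
have Tco := T_coercive L_self_adjoint L_nonneg TL.
have [B [onb eigB]] := eigenbasis T_linear Tsym Tco (T_injective TL) T_compact.
have [mu_ [w_ [mu1 ws winj Bw wsum]]] := spectral_sequence Tco T_compact onb eigB.
have [S0 hS0] := schatten_sum L_self_adjoint L_nonneg TL T_linear onb eigB T_compact Tschatten.
have mu0 i : 0 < mu_ i by have /andP[] := mu1 i.
pose lam i := (mu_ i)^-1 - 1; pose w i : R := (w_ i)%:R.
have lam0 i : 0 <= lam i by have /andP[h1 h2] := mu1 i; rewrite subr_ge0 invf_ge1.
have w0 i : 0 <= w i by rewrite ler0n.
have lamp i : expR (- p * ln (1 + lam i)) = mu_ i `^ p.
  by rewrite /lam addrC subrK lnV ?posrE// mulrNN powR_expR.
pose W := [set i | w_ i != 0%N].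
have wW J : (\sum_(i \in J) (w i * mu_ i `^ p)%:E = \sum_(i \in J `&` W) (w i * mu_ i `^ p)%:E)%E.
  apply/esym/fsbig_widen; first by move=> i [].
  by move=> i [Ji /not_andP[//|/negP]]; rewrite negbK => /eqP wi /=; rewrite /w wi mul0r.
(* On the indices of positive weight [mu_] is injective, so the sum over i is part of the Schatten
   sum over all mu > 0. *)
have sumS : (\esum_(i in [set: nat]) (w i * mu_ i `^ p)%:E <= S0%:E)%E.
  rewrite -hS0; apply: (@le_trans _ _ (\esum_(mu in mu_ @` W)
      ((size (level ip T B mu))%:R * mu `^ p)%:E)%E); last first.
    by apply: le_esum_subset => _ [i _ <-]; exact: mu0.
  rewrite esum_image; last by move=> i j; rewrite !inE; exact: winj.
  rewrite -(@eq_esum _ _ W (fun i => (w i * mu_ i `^ p)%:E)); last by move=> i wi; rewrite -ws.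
  apply: ge_ereal_sup => _ [X [fX _] <-]; rewrite wW; apply: esum_ge; exists (X `&` W) => //.
  by split; [exact: finite_setIl|move=> i []].
have wS (J : {fset nat}) : \sum_(i <- J) w i * expR (- p * ln (1 + lam i)) <= S0.
  under eq_bigr do rewrite lamp.
  by rewrite -lee_fin; apply: le_trans sumS; exact: le_esum_fset.
have wSN N : \sum_(i < N) w i * expR (- p * ln (1 + lam i)) <= S0.
  apply: le_trans (wS [fset i in iota 0 N]%fset); rewrite -(big_mkord xpredT (fun i => w i * expR (- p * ln (1 + lam i)))) /index_iota subn0.
  rewrite le_eqVlt; apply/orP; left; apply/eqP; apply: perm_big; apply: uniq_perm.
  - exact: iota_uniq.
  - exact: fset_uniq.
  - by move=> i; rewrite inE.
pose heat t : R -> R := fun r => expR (- (t * (r^-1 - 1))).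
have heat_sum t : 0 < t -> exists s : R,
    \esum_(b in B) (expR (- (t * lamb ip T b)))%:E = s%:E /\
    \esum_(i in [set: nat]) (w i * expR (- (t * lam i)))%:E = s%:E.
  move=> t0; have := wsum (heat t) (fun r => expR_ge0 _); rewrite /heat -/(lamb _ _ _) => e.
  have p0 : 0 <= p by apply: le_trans p1.
  (* From p ln (1 + lam) <= t (1 + lam) + c follows e^(-t lam) <= e^(t + c) (1 + lam)^(-p), so the
     Schatten bound makes the trace finite for every t > 0. *)
  have [c hc] := ln_le_linear p0 t0.
  have fin : (\esum_(i in [set: nat]) (w i * expR (- (t * lam i)))%:E <= (expR (t + c) * S0)%:E)%E.
    apply: esum_fset_le => J _; apply: le_trans (ler_wpM2l (expR_ge0 _) (wS J)).
    rewrite mulr_sumr; apply: ler_sum_fset => i _; rewrite mulrCA ler_wpM2l// -expRD ler_expR.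
    have l1 : 0 < 1 + lam i by rewrite ltr_pwDl.
    by have := hc _ l1; lra.
  have ge0 : (0 <= \esum_(i in [set: nat]) (w i * expR (- (t * lam i)))%:E)%E.
    by apply: esum_ge0 => i _; rewrite lee_fin mulr_ge0 ?expR_ge0.
  exists (fine (\esum_(i in [set: nat]) (w i * expR (- (t * lam i)))%:E)).
  by rewrite e fineK ?ge0_fin_numE// (le_lt_trans fin)// ltry.
pose th t := if pselect (0 < t) is left t0 then sval (cid (heat_sum t t0)) else 0.
have thP t : 0 < t -> \esum_(b in B) (expR (- (t * lamb ip T b)))%:E = (th t)%:E /\
    \esum_(i in [set: nat]) (w i * expR (- (t * lam i)))%:E = (th t)%:E.
  by move=> t0; rewrite /th; case: pselect => // t0'; case: cid.
exists lam, w, S0, th; split => //.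
- move=> t t0; apply: esum_cvg (thP _ t0).2 => i; by rewrite mulr_ge0 ?expR_ge0.
- move=> t t0; apply: (heat_trace_eq L_self_adjoint L_nonneg TL LT T_linear onb eigB t0).
  exact: (thP _ t0).1.
move=> z s z0 ps; have [M M0 hM] := cmod_cpow_le (le_trans ler01 p1) z0 ps.
pose x i : C := (w i)%:C * cpow ((lam i)%:C + z) (- s).
have xS N : \sum_(i < N) cmod (x i) <= M * S0.
  apply: le_trans (ler_wpM2l M0 (wSN N)); rewrite mulr_sumr; apply: ler_sum => i _.
  by rewrite cmodM cmodR ger0_norm// mulrCA ler_wpM2l// hM.
have [X hX] := abs_csum_cvg xS.
have xw i : x i != 0 -> w_ i != 0%N.
  by apply: contraNneq => wi; rewrite /x /w wi mul0r.
have vdimE i : w_ i != 0%N -> vdim (Defs.eigenspace (dom L) L (lam i)%:C) = w_ i.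
  move=> wi; rewrite ws// /lam.
  exact: (vdim_eigenspace_L L_self_adjoint L_nonneg TL LT T_linear onb eigB T_compact).
suff -> : zeta_series L z s = X by [].
apply: cvg_lim; first exact: norm_hausdorff.
apply: (totally_sequence (a := fun i => (lam i)%:C) (x := x) _ _ _ xS hX).
- move=> i j /xw wi /xw wj /(@complexI R); rewrite /lam => /addIr/invr_inj; exact: winj.
- by move=> i /xw wi; rewrite vdimE// /x /w rmorph_nat.
- move=> l gl; have dl : vdim (Defs.eigenspace (dom L) L l) != 0%N.
    by apply: contraNneq gl => ->; rewrite mul0r.
  have [mu m0 el] := eigenvalue_L L_nonneg dl.
  have := dl; rewrite el (vdim_eigenspace_L L_self_adjoint L_nonneg TL LT T_linear onb eigB T_compact m0).
  rewrite -lt0n => sz; pose b := nth 0 (level ip T B mu) 0.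
  have [Bb eb] := (mem_level Tco T_compact onb eigB mu b).1 (mem_nth 0 sz).
  have [i wi mi] := Bw b Bb; have ei : (lam i)%:C = (mu^-1 - 1)%:C :> C by rewrite /lam mi eb.
  exists i => //; move: gl; rewrite el -ei vdimE//.
  by rewrite /x /w rmorph_nat.
Qed.

End SpectralData.

Theorem theorem3p7 (R : realType) (H : completeNormedModType R[i])
  (ip : inner_product H) (hsep : separable H)
  (L : operator H) (hsa : self_adjoint ip L) (hpos : nonneg_operator ip L)
  (p : R) (hp : 1 <= p) (hS : inverse_in_schatten ip L p)
  (calA : set R[i]) (kmax : R[i] -> nat) (AH : R[i] -> nat -> R[i])
  (hA : admissible_exponents calA)
  (hAH0 : forall al k, ~ (calA al /\ (k <= kmax al)%N) -> AH al k = 0)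
  (hheat : heat_expansion (heat_trace ip L) calA kmax AH)
  (hlog : forall al k, is_Zplus (- al) -> (0 < k)%N -> AH al k = 0) :
  (forall z : R[i], 0 < complex.Re z ->
     zeta_continuation L p z (zeta L p z) /\ regular_at (zeta L p z) 0) /\
  (forall K : R, 0 < K -> exists M : R,
     \forall x \near +oo, forall z : R[i], complex.Re z = x ->
     `| log_det L p z -
        ( - (\sum_(al \in [set al | [/\ calA al, ~ is_Zplus (- al) &
                                        complex.Re al <= K]])
               \sum_(k < (kmax al).+1)
                 (-1) ^+ k *
                 (\sum_(k <= j < (kmax al).+1)
                    AH al j * 'C(j, k)%:R * Pf (derive1n (j - k) (@Gamma R)) al)
                 * cpow z (- al) * clog z ^+ k)
          + AH 0 0%N * clog z
          + \sum_(n \in [set n : nat | (0 < n)%N])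
              AH (- n%:R) 0%N * Res (@Gamma R) (- n%:R) *
              (z ^+ n * clog z - (\sum_(1 <= j < n.+1) j%:R^-1) * z ^+ n)) |
     <= (M * x `^ (- K))%:C).
Proof.
have [lam [w [S [th [[lam0 w0] wS th_sum trE zs_sum]]]]] := spectral_data hsa hpos hp hS.
have heat : heat_expansion (fun t => (th t)%:C) calA kmax AH.
  move=> K /hheat[M hM]; exists M; near=> t; rewrite -trE; last by near: t; exact: nbhs_right_gt.
  by near: t.
(* [zeta] is an [xget]: once some continuation exists it is one itself, and the statements on
   arbitrary continuations apply to it. *)
have zetaP z : 0 < complex.Re z -> continues p (zeta_series L) z (zeta L p z).
  move=> z0; have ex := continuation_exists hA heat lam0 w0 wS hp th_sum zs_sum z0.
  exact: (xgetPex (P := continues p (zeta_series L) z) (fun=> 0) ex).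
split=> [z z0|K K0].
  split; first exact: zetaP.
  exact: (continuation_regular hA hlog heat lam0 w0 wS hp th_sum zs_sum z0 (zetaP _ z0)).
have [M hM] := continuation_asymptotics hA hAH0 hlog heat lam0 w0 wS hp th_sum zs_sum K0.
(* The threshold is the bound Re z >= 2 of [Mel_tail_bound]. *)
exists M; exists 2%:R; split; first exact: num_real.
move=> x x2 z zx; rewrite -zx in x2 *.
apply: hM; first exact: ltW.
by apply: zetaP; apply: lt_trans x2; exact: ltr0Sn _ 1.
Unshelve. all: by end_near.
Qed.
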